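(* For any integer $n$, $$E_{a,b}(z)=(2\pi)^{\frac12(1-n)}n^{nb-\frac12}\int_{0}^{\infty}h_{n}(u)\,u^{b-1}E_{na,nb}\left(u^{a}n^{na}z\right)du ,$$ with the companion $$E_{a,b}(z)=(2\pi)^{\frac12(1-n)}n^{n(b-1)+\frac12}\int_{0}^{\infty}h_{n}(u)\,u^{b-2}E_{na,n(b-1)+1}\left(u^{a}n^{na}z\right)du ,$$ which reduces for $b=1$ to $$E_{a}(z)=(2\pi)^{\frac12(1-n)}n^{\frac12}\int_{0}^{\infty}h_{n}(u)\,u^{-1}E_{na}\left(u^{a}n^{na}z\right)du .$$
   Context: The Mittag-Leffler function is $E_{a,b}(z)=\sum_{k=0}^{\infty}\frac{z^{k}}{\Gamma(b+ak)}$ for $\operatorname{Re}(a)>0$ and complex $b$, with $1/\Gamma$ the entire reciprocal Gamma function, and $E_a(z)=E_{a,1}(z)$. The function $h_n$ is the inverse Mellin transform of the product of the Gamma functions $\Gamma\left(s+\frac jn\right)$ over $1\le j\le n-1$ (so $n\ge2$ for this product to be nonempty): $$h_n(u)=\frac{1}{2\pi i}\int_{c-i\infty}^{c+i\infty}\prod_{j=1}^{n-1}\Gamma\left(s+\frac{j}{n}\right)u^{-s}ds\qquad (c>0),$$ so that $\prod_{j=1}^{n-1}\Gamma\left(s+\frac jn\right)=\int_0^\infty u^{s-1}h_n(u)\,du$ for $\operatorname{Re}(s)>0$.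
   Formalization: The formulas are stated for n ≥ 2, the first for Re b > -1/n and the companion for Re b > 1 - 1/n; without such a bound the integral generally diverges, and at b = -1/n, z = 0 the first identity is false. *)

(* Defs.v *)
From HB Require Import structures.
From mathcomp Require Import all_boot all_order all_algebra.
From mathcomp Require Import all_classical all_reals all_analysis.
From mathcomp Require Import complex.

Set Implicit Arguments.
Unset Strict Implicit.
Unset Printing Implicit Defensive.

Import Order.TTheory GRing.Theory Num.Theory.
Import numFieldNormedType.Exports.

Local Open Scope classical_set_scope.
Local Open Scope ring_scope.
Local Open Scope complex_scope.

Section Defs.
Variable R : realType.
Local Notation C := R[i].

(* The regular module R[i]^o carries the topology of the complex modulus. *)
Definition climn (u : nat -> C) : C := lim ((u : nat -> R[i]^o) @ \oo).

Definition cexp (s : C) : C :=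
  (expR (complex.Re s) * cos (complex.Im s)) +i* (expR (complex.Re s) * sin (complex.Im s)).

(* x ^ s with the principal logarithm; only meaningful for 0 < x. *)
Definition rpowc (x : R) (s : C) : C := cexp ((ln x)%:C * s).

Definition cintegrable (D : set R) (f : R -> C) : Prop :=
  lebesgue_measure.-integrable D (fun x => (complex.Re (f x))%:E) /\
  lebesgue_measure.-integrable D (fun x => (complex.Im (f x))%:E).

Definition cintegral (D : set R) (f : R -> C) : C :=
  (\int[lebesgue_measure]_(x in D) complex.Re (f x)) +i*
  (\int[lebesgue_measure]_(x in D) complex.Im (f x)).

(* The entire function 1/Gamma, through Gauss's limit
   z (z + 1) ... (z + m) / (m! m^z), which converges for every complex z. *)
Definition rGamma (z : C) : C :=
  climn (fun m => (\prod_(0 <= k < m.+1) (z + k%:R)) /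
                  ((m`!)%:R * rpowc m%:R z)).

(* Takes the value 0 at the poles 0, -1, -2, ... *)
Definition Gamma (z : C) : C := (rGamma z)^-1.

Definition mittag_leffler (a b z : C) : C :=
  climn (fun m => \sum_(0 <= k < m) z ^+ k * rGamma (b + a * k%:R)).

(* The integral of f over the upward line Re s = c: s = c + i t, ds = i dt. *)
Definition vline_integral (c : R) (f : C -> C) : C :=
  (0 +i* 1) * cintegral setT (fun t => f (c +i* t)).

(* The inverse Mellin transform h_n, computed on the line Re s = c. *)
Definition hfun (n : nat) (c : R) (u : R) : C :=
  (2 * pi%:C * (0 +i* 1))^-1 *
  vline_integral c (fun s =>
    (\prod_(1 <= j < n) Gamma (s + j%:R / n%:R)) * rpowc u (- s)).

End Defs.

(* Main.v *)
Require Import Defs.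
From HB Require Import structures.
From mathcomp Require Import all_boot all_order all_algebra.
From mathcomp Require Import all_classical all_reals all_analysis.
From mathcomp Require Import complex.
From mathcomp Require Import measurable_realfun ring lra.

(** Expanding [E_{na,nb}] termwise, the theorem reduces to
    [1/Gamma(s) = (2 pi)^((1-n)/2) n^(ns-1/2) / Gamma(ns) * int_0^oo h_n(u) u^(s-1) du]
    at [s = b + a k].  The integral is the product of the [Gamma(s + j/n)], and the
    identity is Gauss's multiplication formula.  The companion is the same identity
    at [s - 1], divided by [s - 1].

    Euler's integral, written [int_R exp(s x - exp x) dx], is the inverse of Gauss's
    limit by a second moment estimate for the Gamma distribution.  The multiplication
    formula is read off Gauss's limit; Stirling's formula gives its constant, and the
    case [n = 2, z = 1/2] with [Gamma(1/2) = sqrt pi] gives the constant of Stirling.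

    No contour is moved: [h_n] is the Fourier inverse of a product of Gamma functions
    on a vertical line.  One factor is inverted with the Abel kernel [exp(- e |t|)],
    and each further factor convolves the result with [exp(b x - exp x)].  Hence [h_n]
    is nonnegative, and Fubini's theorem gives its Mellin transform on the whole
    half-plane [Re s > -1/n].  The series of absolute integrals converges because
    [|Gamma(Re z) / Gamma(z)|] grows at most exponentially in a sector while [1/Gamma]
    decays superexponentially on the positive axis. *)

Set Implicit Arguments.
Unset Strict Implicit.
Unset Printing Implicit Defensive.

Import Order.TTheory GRing.Theory Num.Theory.
Import numFieldNormedType.Exports.
Import ComplexField.

Local Open Scope classical_set_scope.
Local Open Scope ring_scope.
Local Open Scope complex_scope.

Local Notation normc := Normc.normc.
Local Notation Re := complex.Re.
Local Notation Im := complex.Im.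

(** * Complex numbers and complex limits *)

Section ComplexNumbers.
Context {R : realType}.
Local Notation C := R[i].
Implicit Types (x y : R) (z w : C).

(** All integrals live on the whole line: [u = exp x] turns Mellin transforms into two-sided Laplace
    transforms, Gamma on a vertical line into a Fourier transform, and multiplication by a Gamma
    factor into convolution with a kernel [eulerk]. The abscissa of convergence is read off the
    convolution factors and not off the line [Re s = c]. The obstacle is the exchange of sum and
    integral: the absolute integrals must be summable although [a], [b] and [z] are complex.
    Nonnegativity of [h_n] settles this, since the absolute Mellin integral at [s] is then the
    Mellin integral at [Re s], again a product of Gamma values. The multiplication formula on the
    real axis collapses that product, divided by [Gamma(n Re s)], to a multiple of
    [1 / Gamma(Re s)], and this factor absorbs both the powers of [z] and the loss in passing from
    complex to real arguments of [1 / Gamma]. Because [Re a] is positive, those arguments lie in a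
    fixed sector from some index on. *)

Lemma ReD z w : Re (z + w) = Re z + Re w. Proof. by case: z w => [? ?] []. Qed.
Lemma ImD z w : Im (z + w) = Im z + Im w. Proof. by case: z w => [? ?] []. Qed.
Lemma ReN z : Re (- z) = - Re z. Proof. by case: z. Qed.
Lemma ImN z : Im (- z) = - Im z. Proof. by case: z. Qed.
Lemma ReM z w : Re (z * w) = Re z * Re w - Im z * Im w.
Proof. by case: z w => [? ?] []. Qed.
Lemma ImM z w : Im (z * w) = Re z * Im w + Im z * Re w.
Proof. by case: z w => [? ?] []. Qed.
Lemma Re_nat k : Re (k%:R : C) = k%:R.
Proof. by rewrite -(rmorph_nat (real_complex R)). Qed.
Lemma Im_nat k : Im (k%:R : C) = 0.
Proof. by rewrite -(rmorph_nat (real_complex R)). Qed.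
Lemma Re_sum I (r : seq I) (P : pred I) (F : I -> C) :
  Re (\sum_(i <- r | P i) F i) = \sum_(i <- r | P i) Re (F i).
Proof. by elim/big_ind2: _ => // z1 x1 z2 x2 <- <-; rewrite ReD. Qed.
Lemma Im_sum I (r : seq I) (P : pred I) (F : I -> C) :
  Im (\sum_(i <- r | P i) F i) = \sum_(i <- r | P i) Im (F i).
Proof. by elim/big_ind2: _ => // z1 x1 z2 x2 <- <-; rewrite ImD. Qed.

Lemma eqC z w : Re z = Re w -> Im z = Im w -> z = w.
Proof. by case: z w => [? ?] [? ?] /= -> ->. Qed.

Lemma natC k : (k%:R : C) = (k%:R)%:C.
Proof. by rewrite rmorph_nat. Qed.

Lemma normcE z : normc z = Num.sqrt (Re z ^+ 2 + Im z ^+ 2).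
Proof. by case: z. Qed.

Lemma normc_ge0 z : 0 <= normc z. Proof. by rewrite normcE sqrtr_ge0. Qed.

Lemma normc_sqr z : normc z ^+ 2 = Re z ^+ 2 + Im z ^+ 2.
Proof. by rewrite normcE sqr_sqrtr// addr_ge0// sqr_ge0. Qed.

Lemma normc_real x : normc x%:C = `|x|.
Proof. by rewrite normcE /= expr0n addr0 sqrtr_sqr. Qed.

Lemma Re_le_normc z : `|Re z| <= normc z.
Proof.
rewrite -(ler_pXn2r (n := 2))// ?nnegrE ?normc_ge0// normc_sqr.
by rewrite real_normK ?num_real// lerDl sqr_ge0.
Qed.

Lemma Im_le_normc z : `|Im z| <= normc z.
Proof.
rewrite -(ler_pXn2r (n := 2))// ?nnegrE ?normc_ge0// normc_sqr.
by rewrite real_normK ?num_real// lerDr sqr_ge0.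
Qed.

Lemma normc_le_ReIm z : normc z <= `|Re z| + `|Im z|.
Proof.
rewrite -(ler_pXn2r (n := 2))// ?nnegrE ?normc_ge0 ?addr_ge0// normc_sqr.
rewrite sqrrD !real_normK ?num_real//.
have := mulr_ge0 (normr_ge0 (Re z)) (normr_ge0 (Im z)); lra.
Qed.

Lemma normc_sum (F : nat -> C) m :
  normc (\sum_(0 <= k < m) F k) <= \sum_(0 <= k < m) normc (F k).
Proof.
elim: m => [|m IH]; first by rewrite !big_geq// Normc.normc0.
by rewrite !big_nat_recr//= (le_trans (le_normcD _ _))// lerD2r.
Qed.

Lemma normc_eq0 z : (normc z == 0) = (z == 0).
Proof.
by apply/eqP/eqP => [/Normc.eq0_normc//|->]; rewrite Normc.normc0.
Qed.

Lemma normc_prod (F : nat -> C) m k :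
  normc (\prod_(m <= j < k) F j) = \prod_(m <= j < k) normc (F j).
Proof.
apply: (big_morph _ _ _) => [z w|]; [exact: Normc.normcM | exact: Normc.normc1].
Qed.

Lemma normcX z k : normc (z ^+ k) = normc z ^+ k.
Proof.
elim: k => [|k IH]; first by rewrite !expr0 Normc.normc1.
by rewrite !exprS Normc.normcM IH.
Qed.

Lemma Re_inv z : Re z^-1 = Re z / (Re z ^+ 2 + Im z ^+ 2).
Proof. by case: z. Qed.
Lemma Im_inv z : Im z^-1 = - (Im z / (Re z ^+ 2 + Im z ^+ 2)).
Proof. by case: z. Qed.

Lemma cexp0 : cexp 0 = 1 :> C.
Proof. by rewrite /cexp /= expR0 cos0 sin0 mulr1 mulr0. Qed.

Lemma cexpD z w : cexp (z + w) = cexp z * cexp w.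
Proof.
apply: eqC; rewrite ?ReM ?ImM /cexp /= ?ReD ?ImD expRD ?cosD ?sinD; ring.
Qed.

Lemma normc_cexp z : normc (cexp z) = expR (Re z).
Proof.
rewrite normcE /cexp /= !exprMn -mulrDr cos2Dsin2 mulr1 sqrtr_sqr.
by rewrite ger0_norm// expR_ge0.
Qed.

Lemma cexp_neq0 z : cexp z != 0.
Proof. by rewrite -normc_eq0 normc_cexp expR_eq0. Qed.

Lemma cexpN z : cexp (- z) = (cexp z)^-1.
Proof.
apply: (mulfI (cexp_neq0 z)).
by rewrite -cexpD subrr cexp0 mulfV// cexp_neq0.
Qed.

Lemma cexp_real x : cexp x%:C = (expR x)%:C.
Proof. by rewrite /cexp /= cos0 sin0 mulr1 mulr0. Qed.

Lemma cexpMn z k : cexp (k%:R * z) = cexp z ^+ k.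
Proof.
elim: k => [|k IH]; first by rewrite mul0r cexp0 expr0.
by rewrite -natr1 mulrDl mul1r cexpD IH exprSr.
Qed.

Lemma rpowcD x z w : rpowc x (z + w) = rpowc x z * rpowc x w.
Proof. by rewrite /rpowc mulrDr cexpD. Qed.
Lemma rpowc0 x : rpowc x 0 = 1.
Proof. by rewrite /rpowc mulr0 cexp0. Qed.
Lemma rpowc_neq0 x z : rpowc x z != 0.
Proof. exact: cexp_neq0. Qed.
Lemma rpowcMl x y z : 0 < x -> 0 < y ->
  rpowc (x * y) z = rpowc x z * rpowc y z.
Proof. by move=> x0 y0; rewrite /rpowc lnM ?posrE// rmorphD mulrDl cexpD. Qed.
Lemma rpowcMn x z k : rpowc x (k%:R * z) = rpowc x z ^+ k.
Proof. by rewrite /rpowc mulrCA cexpMn. Qed.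
Lemma rpowcn x k : 0 < x -> rpowc x k%:R = (x ^+ k)%:C.
Proof.
move=> x0; rewrite /rpowc natC -rmorphM cexp_real mulrC expRM_natl lnK//.
Qed.
Lemma rpowcr x y : rpowc x y%:C = (expR (ln x * y))%:C.
Proof. by rewrite /rpowc -rmorphM cexp_real. Qed.
Lemma rpowc1 x : 0 < x -> rpowc x 1 = x%:C.
Proof. by move=> x0; rewrite (rpowcn 1 x0). Qed.
Lemma normc_rpowc x z : normc (rpowc x z) = expR (ln x * Re z).
Proof. by rewrite /rpowc normc_cexp ReM /= mul0r subr0. Qed.
Lemma rpowc_expR x z : rpowc (expR x) z = cexp (x%:C * z).
Proof. by rewrite /rpowc expRK. Qed.

End ComplexNumbers.

Section ComplexLimits.
Context {R : realType}.
Local Notation C := R[i].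
Implicit Types (u v : nat -> C) (z w : C).

(** Convergence is stated on real and imaginary parts, and not in the topology of [R[i]^o], so that
    the limit theorems for real sequences apply; [ccvg_climn] is the bridge to [climn]. *)
Definition ccvg u z : Prop :=
  (Re (u k) @[k --> \oo] --> Re z) /\ (Im (u k) @[k --> \oo] --> Im z).

Lemma ccvgP u z : ccvg u z <-> normc (u k - z) @[k --> \oo] --> (0 : R).
Proof.
split => [[Hr Hi]|H].
  apply: (@squeeze_cvgr _ _ _ _ (fun=> 0)
    (fun k => `|Re (u k) - Re z| + `|Im (u k) - Im z|)).
  - apply: nearW => k; rewrite normc_ge0/=.
    by rewrite (le_trans (normc_le_ReIm _))// ReD ImD ReN ImN.
  - exact: cvg_cst.
  - rewrite -[0]addr0; apply: cvgD.
      by apply/norm_cvg0P; apply/subr_cvg0.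
    by apply/norm_cvg0P; apply/subr_cvg0.
split.
  apply/subr_cvg0/norm_cvg0P.
  apply: (@squeeze_cvgr _ _ _ _ (fun=> 0) (fun k => normc (u k - z))) => //.
    apply: nearW => k; rewrite normr_ge0/=.
    by have := Re_le_normc (u k - z); rewrite ReD ReN.
  exact: cvg_cst.
apply/subr_cvg0/norm_cvg0P.
apply: (@squeeze_cvgr _ _ _ _ (fun=> 0) (fun k => normc (u k - z))) => //.
  apply: nearW => k; rewrite normr_ge0/=.
  by have := Im_le_normc (u k - z); rewrite ImD ImN.
exact: cvg_cst.
Qed.

Lemma ccvg_climn u z : ccvg u z -> climn u = z.
Proof.
move=> /ccvgP H; apply: (@cvg_lim (R[i]^o)) => //.
apply/cvgrPdist_lt => -[e e'] /=; rewrite ltcE /= => /andP[/eqP -> e0].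
move/cvgrPdist_lt: H => /(_ e e0); apply: filterS => k /=.
rewrite sub0r normrN ger0_norm ?normc_ge0// => He.
by rewrite normc_def -normcE -(normcN (z - u k)) opprB ltcR.
Qed.

Lemma ccvg_cst z : ccvg (fun=> z) z.
Proof. by split; exact: cvg_cst. Qed.

Lemma ccvgD u v z w : ccvg u z -> ccvg v w ->
  ccvg (fun k => u k + v k) (z + w).
Proof.
move=> [u1 u2] [v1 v2]; split.
  by rewrite ReD; under eq_fun do rewrite ReD; exact: cvgD.
by rewrite ImD; under eq_fun do rewrite ImD; exact: cvgD.
Qed.

Lemma ccvgM u v z w : ccvg u z -> ccvg v w ->
  ccvg (fun k => u k * v k) (z * w).
Proof.
move=> [u1 u2] [v1 v2]; split.
  rewrite ReM; under eq_fun do rewrite ReM.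
  by apply: cvgB; exact: cvgM.
rewrite ImM; under eq_fun do rewrite ImM.
by apply: cvgD; exact: cvgM.
Qed.

Lemma ccvg_unique u z w : ccvg u z -> ccvg u w -> z = w.
Proof. by move=> /ccvg_climn <- /ccvg_climn <-. Qed.

Lemma ccvg_real (u : nat -> R) (l : R) : u k @[k --> \oo] --> l ->
  ccvg (fun k => (u k)%:C) l%:C.
Proof. by move=> ul; split => //=; exact: cvg_cst. Qed.

Lemma ccvg_norm u z : ccvg u z -> normc (u k) @[k --> \oo] --> normc z.
Proof.
move=> [u1 u2]; rewrite normcE; under eq_fun do rewrite normcE.
apply: continuous_cvg => /=; first exact: sqrt_continuous.
by apply: cvgD; rewrite !expr2; [under eq_fun do rewrite expr2|
  under eq_fun do rewrite expr2]; exact: cvgM.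
Qed.

Lemma eq_ccvg u v z : (forall k, u k = v k) -> ccvg u z -> ccvg v z.
Proof. by move=> /funext ->. Qed.

Lemma ccvg_prod (F : nat -> nat -> C) (l : nat -> C) m :
  (forall j, (j < m)%N -> ccvg (F j) (l j)) ->
  ccvg (fun k => \prod_(0 <= j < m) F j k) (\prod_(0 <= j < m) l j).
Proof.
elim: m => [|m IH] H.
  rewrite big_geq//; apply: (@eq_ccvg (fun=> 1)); last exact: ccvg_cst.
  by move=> k; rewrite big_geq.
rewrite big_nat_recr//=.
apply: (@eq_ccvg (fun k => (\prod_(0 <= j < m) F j k) * F m k)).
  by move=> k; rewrite big_nat_recr.
by apply: ccvgM; [apply: IH => j jm; apply: H; exact: ltnW | exact: H].
Qed.

Lemma ccvgV u z : z != 0 -> ccvg u z -> ccvg (fun k => (u k)^-1) z^-1.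
Proof.
move=> z0 [u1 u2].
have n0 : Re z ^+ 2 + Im z ^+ 2 != 0.
  by rewrite -normc_sqr sqrf_eq0 normc_eq0.
have nV : (Re (u k) ^+ 2 + Im (u k) ^+ 2)^-1 @[k --> \oo] -->
    (Re z ^+ 2 + Im z ^+ 2)^-1.
  apply: cvgV => //; apply: cvgD; rewrite !expr2;
  [under eq_fun do rewrite expr2| under eq_fun do rewrite expr2]; exact: cvgM.
split.
  by rewrite Re_inv; under eq_fun do rewrite Re_inv; exact: cvgM.
rewrite Im_inv; under eq_fun do rewrite Im_inv.
by apply: cvgN; exact: cvgM.
Qed.

End ComplexLimits.

(** * Complex-valued integrals *)

Section ComplexMeasurability.
Context {R : realType} d (T : measurableType d).
Local Notation C := R[i].
Implicit Types (D : set T) (f g : T -> C).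

Definition cmeas D f : Prop :=
  measurable_fun D (fun x => Re (f x)) /\ measurable_fun D (fun x => Im (f x)).

Lemma cmeas_cst D z : cmeas D (fun=> z).
Proof. by split; exact: measurable_cst. Qed.

Lemma cmeasD D f g : cmeas D f -> cmeas D g -> cmeas D (fun x => f x + g x).
Proof.
move=> [f1 f2] [g1 g2]; split; [under eq_fun do rewrite ReD
  | under eq_fun do rewrite ImD]; exact: measurable_funD.
Qed.

Lemma cmeasM D f g : cmeas D f -> cmeas D g -> cmeas D (fun x => f x * g x).
Proof.
move=> [f1 f2] [g1 g2]; split; [under eq_fun do rewrite ReM
  | under eq_fun do rewrite ImM].
  by apply: measurable_funB; exact: measurable_funM.
by apply: measurable_funD; exact: measurable_funM.
Qed.

Lemma cmeas_sum D (F : nat -> T -> C) m :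
  (forall k, cmeas D (F k)) -> cmeas D (fun x => \sum_(0 <= k < m) F k x).
Proof.
move=> mF; elim: m => [|m IH].
  by under eq_fun do rewrite big_geq//; exact: cmeas_cst.
by under eq_fun do rewrite big_nat_recr//=; exact: cmeasD.
Qed.

Lemma cmeas_real D (h : T -> R) : measurable_fun D h ->
  cmeas D (fun x => (h x)%:C).
Proof. by move=> mh; split => //=; exact: measurable_cst. Qed.

Lemma cmeas_normc D f : cmeas D f -> measurable_fun D (fun x => normc (f x)).
Proof.
move=> [f1 f2]; under eq_fun do rewrite normcE.
apply: (measurableT_comp (f := Num.sqrt : R -> R)).
  by apply: continuous_measurable_fun; exact: sqrt_continuous.
by apply: measurable_funD; apply: measurable_funX.
Qed.

Lemma cmeas_cexp D f : cmeas D f -> cmeas D (fun x => cexp (f x)).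
Proof.
move=> [f1 f2]; rewrite /cexp; split => /=.
  apply: measurable_funM.
    apply: (measurableT_comp (f := @expR R)) => //; exact: measurable_expR.
  apply: (measurableT_comp (f := @cos R)) => //.
  by apply: continuous_measurable_fun; exact: continuous_cos.
apply: measurable_funM.
  apply: (measurableT_comp (f := @expR R)) => //; exact: measurable_expR.
apply: (measurableT_comp (f := @sin R)) => //.
by apply: continuous_measurable_fun; exact: continuous_sin.
Qed.

End ComplexMeasurability.

Section ComplexIntegral.
Context {R : realType}.
Local Notation C := R[i].
Local Notation mu := (@lebesgue_measure R).
Local Notation T := (measurableTypeR R).
Implicit Types (D : set T) (f g : T -> C).

Lemma cintegrable_cmeas D f : cintegrable D f -> cmeas D f.
Proof.
by move=> [/integrableP[/measurable_EFinP f1 _] /integrableP[/measurable_EFinP f2 _]].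
Qed.

Lemma cintegrable_le D f (g : T -> R) : measurable D -> cmeas D f ->
  mu.-integrable D (fun x => (g x)%:E) ->
  (forall x, D x -> normc (f x) <= g x) -> cintegrable D f.
Proof.
move=> mD [f1 f2] ig fg; split.
  apply: (le_integrable mD _ _ ig); first exact/measurable_EFinP.
  move=> x Dx; rewrite /= lee_fin (le_trans (Re_le_normc _))//.
  by rewrite (le_trans (fg x Dx))// ler_norm.
apply: (le_integrable mD _ _ ig); first exact/measurable_EFinP.
move=> x Dx; rewrite /= lee_fin (le_trans (Im_le_normc _))//.
by rewrite (le_trans (fg x Dx))// ler_norm.
Qed.

Lemma integrable_normc D f : measurable D -> cintegrable D f ->
  mu.-integrable D (fun x => (normc (f x))%:E).
Proof.
move=> mD fi; have mf := cintegrable_cmeas fi; case: fi => f1 f2.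
apply: (le_integrable mD _ _ (integrableD mD (integrable_abse f1)
  (integrable_abse f2))).
  exact/measurable_EFinP/cmeas_normc.
move=> x Dx /=; rewrite lee_fin ger0_norm ?normc_ge0//.
by rewrite ger0_norm ?addr_ge0// normc_le_ReIm.
Qed.

Lemma eq_cintegral D f g : {in D, f =1 g} -> cintegral D f = cintegral D g.
Proof.
by move=> fg; rewrite /cintegral; congr (_ +i* _);
  apply: eq_Rintegral => x xD; rewrite fg.
Qed.

Lemma eq_cintegrable D f g : measurable D -> {in D, f =1 g} ->
  cintegrable D f -> cintegrable D g.
Proof.
move=> mD fg [f1 f2]; split.
  by apply: (eq_integrable mD _ _ _ f1) => x xD; rewrite fg.
by apply: (eq_integrable mD _ _ _ f2) => x xD; rewrite fg.
Qed.

Lemma cintegrable_real D (h : T -> R) :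
  mu.-integrable D (fun x => (h x)%:E) -> cintegrable D (fun x => (h x)%:C).
Proof. by move=> hi; split => //=; exact: integrable0. Qed.

Lemma cintegral_real D (h : T -> R) : measurable D ->
  cintegral D (fun x => (h x)%:C) = (\int[mu]_(x in D) h x)%:C.
Proof.
move=> mD; rewrite /cintegral /=; congr (_ +i* _).
by rewrite /Rintegral integral0.
Qed.

Lemma cintegrableZ D z f : measurable D -> cintegrable D f ->
  cintegrable D (fun x => z * f x).
Proof.
move=> mD [f1 f2]; split.
  have := integrableB mD (integrableZl mD (Re z) f1) (integrableZl mD (Im z) f2).
  by apply: eq_integrable => // x _; rewrite ReM EFinB !EFinM.
have := integrableD mD (integrableZl mD (Re z) f2) (integrableZl mD (Im z) f1).
by apply: eq_integrable => // x _; rewrite ImM EFinD !EFinM.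
Qed.

Lemma cintegralZ D z f : measurable D -> cintegrable D f ->
  cintegral D (fun x => z * f x) = z * cintegral D f.
Proof.
move=> mD [f1 f2]; apply: eqC; rewrite ?ReM ?ImM /cintegral /=.
  under eq_Rintegral do rewrite ReM.
  rewrite RintegralB//; [|exact: (integrableZl mD (Re z) f1)
    |exact: (integrableZl mD (Im z) f2)].
  by rewrite !RintegralZl.
under eq_Rintegral do rewrite ImM.
rewrite RintegralD//; [|exact: (integrableZl mD (Re z) f2)
  |exact: (integrableZl mD (Im z) f1)].
by rewrite !RintegralZl.
Qed.

Lemma cintegrableD D f g : measurable D -> cintegrable D f ->
  cintegrable D g -> cintegrable D (fun x => f x + g x).
Proof.
move=> mD [f1 f2] [g1 g2]; split.
  have := integrableD mD f1 g1.
  by apply: eq_integrable => // x _; rewrite ReD EFinD.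
have := integrableD mD f2 g2.
by apply: eq_integrable => // x _; rewrite ImD EFinD.
Qed.

Lemma cintegralD D f g : measurable D -> cintegrable D f ->
  cintegrable D g ->
  cintegral D (fun x => f x + g x) = cintegral D f + cintegral D g.
Proof.
move=> mD [f1 f2] [g1 g2]; apply: eqC; rewrite ?ReD ?ImD /cintegral /=.
  by under eq_Rintegral do rewrite ReD; rewrite RintegralD.
by under eq_Rintegral do rewrite ImD; rewrite RintegralD.
Qed.

Lemma cintegral_sum D (F : nat -> T -> C) m : measurable D ->
  (forall k, cintegrable D (F k)) ->
  cintegrable D (fun x => \sum_(0 <= k < m) F k x) /\
  cintegral D (fun x => \sum_(0 <= k < m) F k x) =
  \sum_(0 <= k < m) cintegral D (F k).
Proof.
move=> mD Fi; elim: m => [|m [IH1 IH2]].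
  rewrite big_geq//; under eq_fun do rewrite big_geq//.
  split; first by split; exact: integrable0.
  by rewrite (cintegral_real (fun=> 0))// /Rintegral integral0.
rewrite big_nat_recr//=; under eq_fun do rewrite big_nat_recr//=.
split; first exact: cintegrableD.
by rewrite cintegralD// IH2.
Qed.

(** Bounding the real and imaginary parts separately costs the factor 2, which only enters the
    constants of later estimates. *)
Lemma normc_cintegral D f : measurable D -> cintegrable D f ->
  normc (cintegral D f) <= 2 * \int[mu]_(x in D) normc (f x).
Proof.
move=> mD fi; have ni := integrable_normc mD fi; case: fi => f1 f2.
rewrite (le_trans (normc_le_ReIm _))// mulr_natl mulr2n /cintegral/= lerD//.
  rewrite (le_trans (le_normr_Rintegral _ _))//.
  apply: le_Rintegral => //; first exact: integrable_abse f1.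
  by move=> x _; exact: Re_le_normc.
rewrite (le_trans (le_normr_Rintegral _ _))//.
apply: le_Rintegral => //; first exact: integrable_abse f2.
by move=> x _; exact: Im_le_normc.
Qed.

Lemma Rdominated_cvg D (F : nat -> T -> R) (f g : T -> R) : measurable D ->
  (forall k, measurable_fun D (F k)) ->
  (forall x, D x -> F k x @[k --> \oo] --> f x) ->
  mu.-integrable D (fun x => (g x)%:E) ->
  (forall k x, D x -> `|F k x| <= g x) ->
  mu.-integrable D (fun x => (f x)%:E) /\
  (\int[mu]_(x in D) F k x @[k --> \oo] --> \int[mu]_(x in D) f x).
Proof.
move=> mD mF Ff ig Fg.
have mf : measurable_fun D f by apply: (measurable_fun_cvg (h := F)).
have [] := @dominated_convergence _ _ _ mu D mD (fun k x => (F k x)%:E)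
  (fun x => (f x)%:E) (fun x => (g x)%:E).
- by move=> k; exact/measurable_EFinP.
- exact/measurable_EFinP.
- apply: aeW => x Dx; apply: cvg_EFin; first exact: nearW.
  exact: Ff.
- exact: ig.
- by apply: aeW => x k Dx; rewrite /= lee_fin; exact: Fg.
move=> fi _ cv; split => //.
apply: fine_cvg; rewrite /Rintegral fineK//.
exact: integrable_fin_num.
Qed.

Lemma cdominated D (F : nat -> T -> C) f (g : T -> R) : measurable D ->
  (forall k, cmeas D (F k)) ->
  (forall x, D x -> ccvg (fun k => F k x) (f x)) ->
  mu.-integrable D (fun x => (g x)%:E) ->
  (forall k x, D x -> normc (F k x) <= g x) ->
  cintegrable D f /\ ccvg (fun k => cintegral D (F k)) (cintegral D f).
Proof.
move=> mD mF Ff ig Fg.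
have [] := @Rdominated_cvg D (fun k x => Re (F k x)) (fun x => Re (f x)) g mD.
- by move=> k; exact: (mF k).1.
- by move=> x Dx; exact: (Ff x Dx).1.
- exact: ig.
- by move=> k x Dx; exact: le_trans (Re_le_normc _) (Fg k x Dx).
move=> i1 c1.
have [] := @Rdominated_cvg D (fun k x => Im (F k x)) (fun x => Im (f x)) g mD.
- by move=> k; exact: (mF k).2.
- by move=> x Dx; exact: (Ff x Dx).2.
- exact: ig.
- by move=> k x Dx; exact: le_trans (Im_le_normc _) (Fg k x Dx).
by move=> i2 c2; split.
Qed.

(** Integrability is asked of every section, not of almost every one, so that the inner extended
    integrals are finite everywhere and agree pointwise with [Rintegral]. *)
Lemma RFubini (f : R * T -> R) :
  measurable_fun setT (f : measurableTypeR R * measurableTypeR T -> R) ->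
  (\int[mu]_x \int[mu]_y `|f (x, y)|%:E < +oo)%E ->
  (forall x, mu.-integrable setT (fun y => (f (x, y))%:E)) ->
  (forall y, mu.-integrable setT (fun x => (f (x, y))%:E)) ->
  mu.-integrable setT (fun x => (\int[mu]_y f (x, y))%:E) /\
  \int[mu]_x \int[mu]_y f (x, y) = \int[mu]_y \int[mu]_x f (x, y).
Proof.
move=> mf fi i1 i2.
have If : (mu \x mu)%E.-integrable setT (EFin \o f).
  by apply/integrable12ltyP => //; exact/measurable_EFinP.
have E1 : fubini_F mu (EFin \o f) = fun x => (\int[mu]_y f (x, y))%:E.
  by apply/funext => x; rewrite /fubini_F /Rintegral fineK//; exact: integrable_fin_num.
have E2 : fubini_G mu (EFin \o f) = fun y => (\int[mu]_x f (x, y))%:E.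
  by apply/funext => y; rewrite /fubini_G /Rintegral fineK//; exact: integrable_fin_num.
split.
  by rewrite -E1; exact: integrable_fubini_F.
rewrite /Rintegral; congr fine.
transitivity (\int[mu]_x (fubini_F mu (EFin \o f)) x)%E; first by rewrite E1.
transitivity (\int[mu]_y (fubini_G mu (EFin \o f)) y)%E; last by rewrite E2.
exact: (Fubini If).
Qed.

Lemma cFubini (f : T * T -> C) : cmeas setT f ->
  (\int[mu]_x \int[mu]_y (normc (f (x, y)))%:E < +oo)%E ->
  (forall x, cintegrable setT (fun y => f (x, y))) ->
  (forall y, cintegrable setT (fun x => f (x, y))) ->
  cintegrable setT (fun x => cintegral setT (fun y => f (x, y))) /\
  cintegral setT (fun x => cintegral setT (fun y => f (x, y))) =
  cintegral setT (fun y => cintegral setT (fun x => f (x, y))).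
Proof.
move=> mf fi i1 i2.
have mn := cmeas_normc mf.
have mn1 x : measurable_fun setT (fun y => (normc (f (x, y)))%:E).
  by apply/measurable_EFinP; apply: cmeas_normc; exact: cintegrable_cmeas.
have bound (h : T * T -> R) : measurable_fun setT h ->
    (forall p, `|h p| <= normc (f p)) ->
    (\int[mu]_x \int[mu]_y `|h (x, y)|%:E < +oo)%E.
  move=> mh hf; apply: le_lt_trans fi.
  apply: ge0_le_integral => //.
  - by move=> x _; apply: integral_ge0 => y _; rewrite lee_fin.
  - apply: (measurable_fun_fubini_tonelli_F (fun p => `|h p|%:E)) => //.
    by apply/measurable_EFinP; exact: measurableT_comp.
  - apply: (measurable_fun_fubini_tonelli_F (fun p => (normc (f p))%:E)).
      exact/measurable_EFinP.
    by move=> p; rewrite lee_fin normc_ge0.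
  - move=> x _; apply: ge0_le_integral => //.
    + apply/measurable_EFinP; apply: measurableT_comp => //.
      exact: (measurableT_comp mh).
    + by move=> y _; rewrite lee_fin.
have [a1 a2] := RFubini mf.1 (bound _ mf.1 (fun p => Re_le_normc _))
  (fun x => (i1 x).1) (fun y => (i2 y).1).
have [b1 b2] := RFubini mf.2 (bound _ mf.2 (fun p => Im_le_normc _))
  (fun x => (i1 x).2) (fun y => (i2 y).2).
split; first by split.
by apply: eqC; [exact: a2|exact: b2].
Qed.

End ComplexIntegral.

(** * The fundamental theorem of calculus and substitution on the line *)

Section LineIntegrals.
Context {R : realType}.
Local Notation mu := (@lebesgue_measure R).

Lemma bigcup_symitv : \bigcup_(k : nat) `[- (k%:R : R), k%:R]%classic = [set: R].
Proof.
apply/seteqP; split => // x _; exists (Num.bound `|x|) => //=.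
rewrite in_itv/= -ler_norml.
by rewrite ltW// archi_boundP.
Qed.

Lemma symitv_nondecreasing :
  nondecreasing_seq (fun k : nat => `[- (k%:R : R), k%:R]%classic).
Proof.
move=> m n mn; rewrite subsetEset; apply: subset_itv; rewrite bnd_simp.
  by rewrite lerN2 ler_nat.
by rewrite ler_nat.
Qed.

Lemma continuous_measurable (f : measurableTypeR R -> R) :
  continuous (f : R -> R) -> measurable_fun setT f.
Proof. exact: continuous_measurable_fun. Qed.

Lemma is_derive_continuous (F f : R -> R) :
  (forall x : R, is_derive x 1 F (f x)) -> continuous F.
Proof.
move=> dF x; have [dFx _] := dF x.
by apply: differentiable_continuous; exact/derivable1_diffP.
Qed.

Definition primitive (F f : R -> R) : Prop :=
  forall x : R, is_derive x 1 F (f x).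

(** The fundamental theorem on [[-k, k]], then dominated convergence with majorant [|f|] as [k]
    grows. *)
Lemma FTC_line (F f : R -> R) (l1 l2 : R) : continuous f ->
  primitive F f ->
  mu.-integrable setT (fun x => (f x)%:E) ->
  F k%:R @[k --> \oo] --> l2 -> F (- k%:R) @[k --> \oo] --> l1 ->
  \int[mu]_x f x = l2 - l1.
Proof.
move=> cf dF fi F2 F1.
have cF := is_derive_continuous dF.
pose g (k : nat) := f \_ `[- k%:R, k%:R].
have gE k : \int[mu]_x g k x = F k%:R - F (- k%:R).
  rewrite -Rintegral_mkcond /Rintegral.
  (* At [k = 0] the interval is a point, whereas the fundamental theorem requires distinct
     endpoints. *)
  case: k => [|k].
    by rewrite oppr0 set_itv1 integral_set1 subrr.
  rewrite (@continuous_FTC2 _ f F)//.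
  - by rewrite (@lt_trans _ _ 0)// ?oppr_lt0 ltr0n.
  - exact: continuous_subspaceT.
  - split; first by move=> x _; have [] := dF x.
    + by apply: cvg_at_right_filter; exact: cF.
    + by apply: cvg_at_left_filter; exact: cF.
  - by move=> x _; have ? := dF x; rewrite derive1E derive_val.
have [] := @Rdominated_cvg R setT g f (fun x => `|f x|) measurableT.
- move=> k; apply/(measurable_restrictT f) => //.
  apply: measurable_funTS; exact: continuous_measurable_fun.
- move=> x _; apply: cvg_near_cst; near=> k.
  rewrite /g patchE mem_set//= in_itv/= -ler_norml.
  near: k; exact: nbhs_infty_ger.
- by have := integrable_abse fi.
- by move=> k x _; rewrite /g patchE; case: ifPn => // _; rewrite normr0.
move=> _; under eq_fun do rewrite gE.
move=> H; apply: (cvg_unique _ H) => //.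
exact: cvgB.
Unshelve. all: by end_near. Qed.

Lemma in_continuous_measurable (A : set (measurableTypeR R))
    (G : measurableTypeR R -> R) : measurable A ->
  (forall x : R, A x -> {for x, continuous (G : R -> R)}) ->
  measurable_fun A G.
Proof.
move=> mA contG.
have := @subspace_continuous_measurable_fun R A G mA; apply.
by apply: continuous_in_subspaceT => x /set_mem; exact: contG.
Qed.

Section substitution.
Variables (F f : R -> R) (D : set (measurableTypeR R)).
Hypothesis F_incr : {homo F : x y / x < y}.
Hypothesis dF : forall x : R, is_derive x 1 F (f x).
Hypothesis cf : continuous f.
Hypothesis f_ge0 : forall x, 0 <= f x.
Hypothesis DE : D = \bigcup_(k : nat) `[F (- k%:R), F k%:R]%classic.

Let mD : measurable D.
Proof. by rewrite DE; apply: bigcup_measurable. Qed.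

Let DF x : D (F x).
Proof.
have : [set: R] x by [].
rewrite -bigcup_symitv => -[k _ /=]; rewrite in_itv/= => /andP[kx xk].
rewrite DE; exists k => //=; rewrite in_itv/=.
by rewrite !(ltW_homo F_incr).
Qed.

Let cF := is_derive_continuous dF.

Let F'E : derive1 F = f.
Proof. by apply/funext => y; rewrite derive1E derive_val. Qed.

(** Substitution on compact intervals, with monotone convergence on both sides. Describing [D] as
    the union of the images of [[-k, k]] lets one lemma serve for exponentials onto the half-line
    and for affine maps onto the line. *)
Lemma ge0_substitution (G : R -> R) : (forall x, D x -> {for x, continuous G}) ->
  (forall x, D x -> 0 <= G x) ->
  (\int[mu]_(x in D) (G x)%:E = \int[mu]_x (G (F x) * f x)%:E)%E.
Proof.
move=> contG G0.
have cGF : continuous (fun x => G (F x) * f x).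
  move=> x; apply: cvgM; last exact: cf.
  apply: continuous_comp; first exact: cF.
  exact/contG/DF.
have subD (k : nat) : `[F (- k%:R), F k%:R]%classic `<=` D.
  by rewrite DE => x ?; exists k.
have H1 : (\int[mu]_(x in `[F (- k%:R), F k%:R]) (G x)%:E)%E @[k --> \oo] -->
    (\int[mu]_(x in D) (G x)%:E)%E.
  rewrite [X in (\int[mu]_(x in X) _)%E]DE.
  apply: ge0_nondecreasing_set_cvg_integral => //.
  - move=> m n mn; rewrite subsetEset; apply: subset_itv; rewrite bnd_simp;
      apply: (ltW_homo F_incr); by rewrite ?lerN2 ler_nat.
  - move=> k; apply/measurable_EFinP; apply: in_continuous_measurable => //.
    by move=> x /subD; exact: contG.
  - by move=> k x /subD ?; rewrite lee_fin G0.
have H2 : (\int[mu]_(x in `[(- k%:R)%R, k%:R%R]) (G (F x) * f x)%:E)%E @[k --> \oo] -->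
    (\int[mu]_x (G (F x) * f x)%:E)%E.
  rewrite -bigcup_symitv.
  apply: ge0_nondecreasing_set_cvg_integral => //.
  - exact: symitv_nondecreasing.
  - move=> k; apply/measurable_EFinP/measurable_funTS.
    exact: continuous_measurable_fun.
  - by move=> k x _; rewrite lee_fin mulr_ge0// G0.
apply: (cvg_unique _ H1) => //.
apply: cvg_trans H2; apply: near_eq_cvg; apply: nearW => k /=.
rewrite integration_by_substitution_increasing.
- by apply: eq_integral => x _; rewrite F'E.
- by rewrite (@le_trans _ _ 0)// oppr_le0.
- by move=> x y _ _; exact: F_incr.
- move=> x _; rewrite F'E; exact: cf.
- apply: cvgP; rewrite F'E.
  by apply: cvg_at_right_filter; exact: cf.
- apply: cvgP; rewrite F'E.
  by apply: cvg_at_left_filter; exact: cf.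
- split => //.
  + by apply: cvg_at_right_filter; exact: cF.
  + by apply: cvg_at_left_filter; exact: cF.
- by apply: continuous_in_subspaceT => x /set_mem /subD; exact: contG.
Qed.

(** The positive and negative parts are substituted separately; the nonnegative factor [f] passes
    through the maximum with 0. *)
Lemma integral_substitution (G : R -> R) :
  (forall x, D x -> {for x, continuous G}) ->
  (\int[mu]_(x in D) (G x)%:E = \int[mu]_x (G (F x) * f x)%:E)%E.
Proof.
move=> contG; rewrite integralE [RHS]integralE; congr (_ - _)%E.
  under eq_integral do rewrite funeposE -EFin_max.
  rewrite (ge0_substitution (G := fun x => Num.max (G x) 0)); last 2 first.
  - move=> x /contG cGx; apply: (@continuous_max _ _ (G : R -> R^o) (fun=> 0)) => //.
    exact: cst_continuous.
  - by move=> x _; rewrite le_max lexx orbT.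
  by apply: eq_integral => x _; rewrite funeposE -EFin_max maxr_pMl// mul0r.
under eq_integral do rewrite funenegE -EFinN -EFin_max.
rewrite (ge0_substitution (G := fun x => Num.max (- G x) 0)); last 2 first.
- move=> x /contG cGx.
  apply: (@continuous_max _ _ ((fun x => - G x) : R -> R^o) (fun=> 0)).
    exact: continuousN.
  exact: cst_continuous.
- by move=> x _; rewrite le_max lexx orbT.
by apply: eq_integral => x _; rewrite funenegE -EFinN -EFin_max maxr_pMl// mul0r mulNr.
Qed.

Lemma integrable_substitution (G : R -> R) :
  (forall x, D x -> {for x, continuous G}) ->
  mu.-integrable setT (fun x => (G (F x) * f x)%:E) ->
  mu.-integrable D (fun x => (G x)%:E).
Proof.
move=> contG /integrableP[_ fi].
have mG : measurable_fun D G.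
  rewrite DE; apply/measurable_fun_bigcup => // k.
  apply: in_continuous_measurable => // x xk; apply: contG.
  by rewrite DE; exists k.
apply/integrableP; split; first exact/measurable_EFinP.
move: fi; under eq_integral do rewrite /= normrM (ger0_norm (f_ge0 _)).
rewrite -(ge0_substitution (G := fun x => `|G x|))//.
by move=> x Dx; apply: continuous_comp; [exact: contG|exact: norm_continuous].
Qed.

End substitution.

End LineIntegrals.

(** * The Abel kernel *)

Section AbelKernel.
Context {R : realType}.
Local Notation mu := (@lebesgue_measure R).

Lemma is_derive_expRM (a t : R) :
  is_derive t 1 (fun t => expR (a * t)) (a * expR (a * t)).
Proof.
have d1 : is_derive t 1 (fun t : R => a * t) a.
  by apply: is_derive_eq; rewrite /GRing.scale /= mulr1.
have := @is_derive1_comp R (@expR R) (fun t => a * t) t _ _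
  (is_derive_expR (a * t)) d1.
by rewrite /GRing.scale/= mulrC.
Qed.

Lemma is_derive_cosM (a t : R) :
  is_derive t 1 (fun t => cos (a * t)) (- (a * sin (a * t))).
Proof.
have d1 : is_derive t 1 (fun t : R => a * t) a.
  by apply: is_derive_eq; rewrite /GRing.scale /= mulr1.
have := @is_derive1_comp R (@cos R) (fun t => a * t) t _ _
  (is_derive_cos (a * t)) d1.
by rewrite /GRing.scale/= mulrC mulrN.
Qed.

Lemma is_derive_sinM (a t : R) :
  is_derive t 1 (fun t => sin (a * t)) (a * cos (a * t)).
Proof.
have d1 : is_derive t 1 (fun t : R => a * t) a.
  by apply: is_derive_eq; rewrite /GRing.scale /= mulr1.
have := @is_derive1_comp R (@sin R) (fun t => a * t) t _ _
  (is_derive_sin (a * t)) d1.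
by rewrite /GRing.scale/= mulrC.
Qed.

Lemma cvg_expRMNy (e : R) : 0 < e -> expR (- e * x) @[x --> +oo%R] --> (0 : R).
Proof.
move=> e0; have : (e * x) @[x --> +oo%R] --> +oo%R.
  by apply: gt0_cvgMry => //; exact: cvg_id.
move=> H; under eq_fun do rewrite mulNr.
exact: (cvg_comp _ _ H (@cvgr_expR R)).
Qed.

(** An antiderivative is asked for on the half-line only, because the integrands below involve [|t|]
    and have a simple one only there. *)
Lemma even_integral (f F : R -> R) (l : R) : (forall x, 0 <= f x) ->
  continuous f -> (forall x, f (- x) = f x) ->
  (forall x : R, 0 <= x -> derivable F x 1 /\ derive1 F x = f x) ->
  F x @[x --> +oo%R] --> l ->
  (\int[mu]_x (f x)%:E = (2 * (l - F 0))%:E)%E.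
Proof.
move=> f0 cf fe dF Fl.
rewrite ge0_symfun_integralT//; last by move=> x; rewrite /= fe.
rewrite (_ : [set x : R | 0 <= x] = `[0, +oo[%classic); last first.
  by rewrite set_itvcy.
have cF (x : R) : 0 <= x -> {for x, continuous F}.
  move=> x0; have [dFx _] := dF x x0.
  by apply: differentiable_continuous; exact/derivable1_diffP.
rewrite (@ge0_continuous_FTC2y _ f F 0 l) ?EFinM ?EFinB//.
- exact: continuous_subspaceT.
- by move=> x x0; have [] := dF x (ltW x0).
- by apply: cvg_at_right_filter; exact: cF.
- move=> x; rewrite in_itv/= andbT => x0.
  by have [] := dF x (ltW x0).
Qed.

Lemma continuous_expRabs (e : R) : continuous (fun t : R => expR (- e * `|t|)).
Proof.
move=> t; apply: continuous_comp; last exact: continuous_expR.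
by apply: cvgM; [exact: cvg_cst|exact: norm_continuous].
Qed.

Lemma is_derive_congr_ge0 (F f g : R -> R) :
  (forall x, 0 <= x -> f x = g x) -> (forall x : R, is_derive x 1 F (f x)) ->
  forall x : R, 0 <= x -> derivable F x 1 /\ derive1 F x = g x.
Proof.
move=> fg dF x x0; have dFx := dF x.
by split; [case: dFx|rewrite derive1E derive_val fg].
Qed.

Lemma integral_expabs (e : R) : 0 < e ->
  (\int[mu]_t (expR (- e * `|t|))%:E = (2 / e)%:E)%E.
Proof.
move=> e0.
have e1 : e != 0 by rewrite gt_eqF.
rewrite (@even_integral _ (fun t => - e^-1 * expR (- e * t)) 0).
- by rewrite mulr0 expR0 mulr1 sub0r opprK.
- by move=> t; exact: expR_ge0.
- exact: continuous_expRabs.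
- by move=> t; rewrite normrN.
- apply: (@is_derive_congr_ge0 _ (fun t => expR (- e * t))).
    by move=> t t0; rewrite ger0_norm.
  move=> t; have d1 := is_derive_expRM (- e) t.
  apply: is_derive_eq; rewrite /GRing.scale/= mulrA mulrNN mulVf// mul1r//.
- rewrite -(mulr0 (- e^-1)); apply: cvgM; first exact: cvg_cst.
  exact: cvg_expRMNy.
Qed.

Lemma integrable_expabs (e : R) : 0 < e ->
  mu.-integrable setT (fun t => (expR (- e * `|t|))%:E).
Proof.
move=> e0; apply/integrableP; split.
  apply/measurable_EFinP; apply: continuous_measurable.
  exact: continuous_expRabs.
under eq_integral do rewrite gee0_abs ?lee_fin ?expR_ge0//.
by rewrite integral_expabs// ltry.
Qed.

(** Adding 1 to the cosine keeps the integrand nonnegative, as [even_integral] requires;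
    [cintegral_abel] subtracts the extra term again. *)
Lemma integral_expabs_1cos (e y : R) : 0 < e ->
  (\int[mu]_t (expR (- e * `|t|) * (1 + cos (y * t)))%:E =
    (2 / e + 2 * e / (e ^+ 2 + y ^+ 2))%:E)%E.
Proof.
move=> e0.
have e1 : e != 0 by rewrite gt_eqF.
have e2 : e ^+ 2 + y ^+ 2 != 0 by rewrite gt_eqF// ltr_pwDl ?sqr_ge0 ?exprn_gt0.
pose F (t : R) := - e^-1 * expR (- e * t) +
  expR (- e * t) * ((- e * cos (y * t) + y * sin (y * t)) / (e ^+ 2 + y ^+ 2)).
rewrite (@even_integral _ F 0).
- by congr EFin; rewrite /F !mulr0 expR0 cos0 sin0 !mulr0; field; rewrite e1 e2.
- move=> t; apply: mulr_ge0; first exact: expR_ge0.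
  by have := cos_geN1 (y * t); lra.
- move=> t; apply: cvgM; first exact: continuous_expRabs.
  apply: cvgD; first exact: cvg_cst.
  apply: continuous_comp; last exact: continuous_cos.
  by apply: cvgM; [exact: cvg_cst|exact: cvg_id].
- by move=> t; rewrite normrN mulrN cosN.
- apply: (@is_derive_congr_ge0 _ (fun t => expR (- e * t) * (1 + cos (y * t)))).
    by move=> t t0; rewrite ger0_norm.
  move=> t; have d1 := is_derive_expRM (- e) t.
  have d2 := is_derive_cosM y t; have d3 := is_derive_sinM y t.
  rewrite /F; apply: is_derive_eq; rewrite /GRing.scale/=.
  by field; rewrite e1 e2.
- apply: (@squeeze_cvgr _ _ _ _
    (fun t => - ((e^-1 + (e + `|y|) / (e ^+ 2 + y ^+ 2)) * expR (- e * t)))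
    (fun t => (e^-1 + (e + `|y|) / (e ^+ 2 + y ^+ 2)) * expR (- e * t))).
  + apply: nearW => t; rewrite -ler_norml /F mulrC -mulrDr normrM mulrC.
    rewrite (ger0_norm (expR_ge0 _)) ler_wpM2r ?expR_ge0//.
    rewrite (le_trans (ler_normD _ _))// lerD//.
      by rewrite normrN gtr0_norm ?invr_gt0.
    rewrite normrM (ger0_norm (x := _^-1)); last first.
      by rewrite invr_ge0 addr_ge0 ?sqr_ge0.
    rewrite ler_wpM2r//; first by rewrite invr_ge0 addr_ge0 ?sqr_ge0.
    rewrite (le_trans (ler_normD _ _))// lerD//.
      have := ler_wpM2l (ltW e0) (cos_max (y * t)).
      by rewrite mulr1 normrM normrN (gtr0_norm e0).
    rewrite normrM; have := ler_wpM2l (normr_ge0 y) (sin_max (y * t)).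
    by rewrite mulr1.
  + rewrite -oppr0; apply: cvgN; rewrite -[X in _ --> X](mulr0 (e^-1 + (e + `|y|) / (e ^+ 2 + y ^+ 2))).
    by apply: cvgM; [exact: cvg_cst|exact: cvg_expRMNy].
  + rewrite -[X in _ --> X](mulr0 (e^-1 + (e + `|y|) / (e ^+ 2 + y ^+ 2))).
    by apply: cvgM; [exact: cvg_cst|exact: cvg_expRMNy].
Qed.

Lemma Rintegral_opp (f : measurableTypeR R -> R) :
  measurable_fun setT f ->
  mu.-integrable setT (fun x => (f (- x))%:E) ->
  \int[mu]_x f (- x) = \int[mu]_x f x.
Proof.
move=> mf fi; rewrite /Rintegral; congr fine.
have mN : measurable_fun [set: measurableTypeR R]
    (-%R : measurableTypeR R -> measurableTypeR R).
  exact: oppr_measurable.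
have := @integral_pushforward _ _ _ _ R _ mN mu setT (EFin \o f).
rewrite preimage_setT => <- //; last exact/measurable_EFinP.
by apply: eq_measure_integral => //= A mA AS; rewrite lebesgue_measureN.
Qed.

Lemma integral_oneDsqrV :
  (\int[mu]_x ((1 + x ^+ 2)^-1)%:E = pi%:E)%E.
Proof.
rewrite (@even_integral _ (@atan R) (pi / 2)).
- by rewrite atan0 subr0 mulrC divfK.
- by move=> x; rewrite invr_ge0 addr_ge0 ?sqr_ge0.
- move=> x; apply: cvgV; first by rewrite gt_eqF// ltr_pwDl ?sqr_ge0.
  apply: cvgD; first exact: cvg_cst.
  exact: exprn_continuous.
- by move=> x; rewrite sqrrN.
- by move=> x _; split; [exact: derivable_atan|exact: derive1_atan].
- exact: cvgy_atan.
Qed.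

Lemma integrable_oneDsqrV :
  mu.-integrable setT (fun x => ((1 + x ^+ 2)^-1)%:E).
Proof.
apply/integrableP; split.
  apply/measurable_EFinP; apply: continuous_measurable => x.
  apply: cvgV; first by rewrite gt_eqF// ltr_pwDl ?sqr_ge0.
  by apply: cvgD; [exact: cvg_cst|exact: exprn_continuous].
under eq_integral.
  move=> x _; rewrite gee0_abs; last by rewrite lee_fin invr_ge0 addr_ge0 ?sqr_ge0.
  over.
by rewrite integral_oneDsqrV ltry.
Qed.

Lemma Rintegral_odd (f : measurableTypeR R -> R) :
  mu.-integrable setT (fun x => (f x)%:E) -> (forall x, f (- x) = - f x) ->
  \int[mu]_x f x = 0.
Proof.
move=> fi fo.
have mf : measurable_fun setT f by case/integrableP: fi => /measurable_EFinP.
have i' : mu.-integrable setT (fun x => (f (- x))%:E).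
  apply: (@eq_integrable _ _ _ _ _ measurableT (fun x => (-1)%:E * (f x)%:E)%E).
    by move=> x _; rewrite fo -EFinM mulN1r.
  exact: integrableZl.
have := Rintegral_opp mf i'.
have -> : \int[mu]_x f (- x) = \int[mu]_x (-1 * f x).
  by apply: eq_Rintegral => x _; rewrite fo mulN1r.
by rewrite RintegralZl// mulN1r; lra.
Qed.

Definition cis (x : R) : R[i] := cexp (0 +i* x).

Lemma normc_cis x : normc (cis x) = 1.
Proof. by rewrite normc_cexp expR0. Qed.

Lemma cisD x y : cis (x + y) = cis x * cis y.
Proof. by rewrite /cis -cexpD; congr cexp; apply: eqC; rewrite ?ReD ?ImD/= ?addr0. Qed.

Lemma ReIm_cis x : (Re (cis x) = cos x) * (Im (cis x) = sin x).
Proof. by rewrite /cis /cexp /= expR0 !mul1r. Qed.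

Lemma cmeas_cis d (T : measurableType d) (D : set T) (f : T -> R) :
  measurable_fun D f -> cmeas D (fun x => cis (f x)).
Proof.
move=> mf; apply: cmeas_cexp; split => //=; exact: measurable_cst.
Qed.

Lemma measurable_expabs (e : R) : measurable_fun setT (fun t : measurableTypeR R => expR (- e * `|t|)).
Proof. by apply: continuous_measurable; exact: continuous_expRabs. Qed.

Lemma cintegrable_abel (e y : R) : 0 < e ->
  cintegrable setT (fun t => (expR (- e * `|t|))%:C * cis (y * t)).
Proof.
move=> e0; apply: (cintegrable_le measurableT _ (integrable_expabs e0)).
  apply: cmeasM; first by apply: cmeas_real; exact: measurable_expabs.
  by apply: cmeas_cis; apply: measurable_funM => //; exact: measurable_cst.
move=> t _; rewrite Normc.normcM normc_cis mulr1 normc_real.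
by rewrite ger0_norm ?expR_ge0.
Qed.

(** The right-hand side is the Poisson kernel of mass [2 pi]; its positivity and integrability are
    what make the Abel kernel a summability kernel. The imaginary part vanishes by oddness. *)
Lemma cintegral_abel (e y : R) : 0 < e ->
  cintegral setT (fun t => (expR (- e * `|t|))%:C * cis (y * t)) =
  (2 * e / (e ^+ 2 + y ^+ 2))%:C.
Proof.
move=> e0; have [i1 i2] := cintegrable_abel y e0.
apply: eqC; rewrite /cintegral /=.
  have := integral_expabs_1cos y e0.
  have i3 := integrable_expabs e0.
  move=> H; apply: (addrI (2 / e)); rewrite -[RHS]/(fine (_%:E)) -H.
  rewrite -[2 / e]/(fine (_%:E)) -integral_expabs// -RintegralD//.
  apply: eq_Rintegral => t _.
  by rewrite expR0 mul1r mul0r subr0 mulrDr mulr1.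
apply: Rintegral_odd => // t.
by rewrite normrN !mul0r !addr0 mulrN sinN !mulrN.
Qed.

End AbelKernel.

(** * Euler's integral *)

Section GammaKernel.
Context {R : realType}.
Local Notation C := R[i].
Local Notation mu := (@lebesgue_measure R).
Local Notation T := (measurableTypeR R).

Definition eulerk (a x : R) : R := expR (a * x - expR x).

(* Euler's integrand for [Gamma s] after the substitution [t = exp x]. *)
Definition ceulerk (s : C) (x : R) : C := cexp (s * x%:C) * (expR (- expR x))%:C.

Lemma eulerk_ge0 a x : 0 <= eulerk a x. Proof. exact: expR_ge0. Qed.

Lemma normc_ceulerk s x : normc (ceulerk s x) = eulerk (Re s) x.
Proof.
rewrite /ceulerk Normc.normcM normc_cexp normc_real (ger0_norm (expR_ge0 _)).
by rewrite -expRD ReM /= mulr0 subr0.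
Qed.

Lemma ceulerk_real a x : ceulerk a%:C x = (eulerk a x)%:C.
Proof. by rewrite /ceulerk -rmorphM cexp_real -rmorphM -expRD. Qed.

Lemma ceulerkE s x : ceulerk s x = (eulerk (Re s) x)%:C * cis (Im s * x).
Proof.
rewrite /ceulerk /cis /eulerk -!cexp_real -!cexpD.
by congr cexp; apply: eqC; rewrite ?(ReD, ImD, ReM, ImM) /=; ring.
Qed.

Lemma eulerkD a b x : eulerk (a + b) x = expR (a * x) * eulerk b x.
Proof. by rewrite /eulerk -expRD mulrDl addrA. Qed.

Lemma ceulerkD s z x : ceulerk (s + z) x = cexp (s * x%:C) * ceulerk z x.
Proof. by rewrite /ceulerk mulrDl cexpD mulrA. Qed.

(** For [x >= 0] the tangent of [exp] at [ln (a + 1)] gives [exp x >= (a + 1) (1 + x - ln (a + 1))],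
    which leaves a decay [exp (- x)]; for [x < 0] the factor [exp (a x)] decays by itself. The rate
    [min a 1] covers both sides. *)
Lemma eulerk_le a x : 0 < a -> eulerk a x <=
  expR ((a + 1) * ln (a + 1)) * expR (- Num.min a 1 * `|x|).
Proof.
move=> a0; rewrite /eulerk -expRD ler_expR.
have a1 : 0 < a + 1 by rewrite addr_gt0.
have l0 : 0 <= (a + 1) * ln (a + 1) by rewrite mulr_ge0 ?(ltW a1)// ln_ge0// lerDr ltW.
have [x0|x0] := leP 0 x.
  rewrite ger0_norm//.
  have := expR_ge1Dx (x - ln (a + 1)).
  rewrite expRD expRN lnK ?posrE// => H.
  have {}H : (a + 1) * (1 + (x - ln (a + 1))) <= expR x.
    by rewrite mulrC -ler_pdivlMr.
  have : Num.min a 1 * x <= x by rewrite ler_piMl// ge_min lexx orbT.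
  lra.
rewrite ltr0_norm//.
have : Num.min a 1 * - x <= a * - x.
  by apply: ler_wpM2r; [rewrite oppr_ge0 ltW|rewrite ge_min lexx].
have := expR_gt0 x; lra.
Qed.

Lemma continuous_eulerk a : continuous (eulerk a).
Proof.
move=> x; apply: continuous_comp; last exact: continuous_expR.
apply: cvgB; last exact: continuous_expR.
by apply: cvgM; [exact: cvg_cst|exact: cvg_id].
Qed.

Lemma measurable_eulerk a : measurable_fun setT (eulerk a : T -> R).
Proof. by apply: continuous_measurable; exact: continuous_eulerk. Qed.

Lemma integrable_eulerk a : 0 < a -> mu.-integrable setT (fun x => (eulerk a x)%:E).
Proof.
move=> a0; have m0 : 0 < Num.min a 1 by rewrite lt_min a0 ltr01.
apply: (le_integrable measurableT _ _ (integrableZl measurableT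
  (expR ((a + 1) * ln (a + 1))) (integrable_expabs m0))).
  by apply/measurable_EFinP; exact: measurable_eulerk.
move=> x _; rewrite /= !lee_fin ger0_norm ?eulerk_ge0//.
by rewrite (le_trans (eulerk_le x a0))// ler_norm.
Qed.

Lemma cmeas_ceulerk s : cmeas setT (ceulerk s : T -> C).
Proof.
have -> : ceulerk s = fun x => (eulerk (Re s) x)%:C * cis (Im s * x).
  by apply/funext => x; rewrite ceulerkE.
apply: cmeasM; first by apply: cmeas_real; exact: measurable_eulerk.
by apply: cmeas_cis; apply: measurable_funM => //; exact: measurable_cst.
Qed.

Lemma cintegrable_ceulerk s : 0 < Re s -> cintegrable setT (ceulerk s).
Proof.
move=> s0; apply: (cintegrable_le measurableT _ (integrable_eulerk s0)).
  exact: cmeas_ceulerk.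
by move=> x _; rewrite normc_ceulerk.
Qed.

Definition eulerG (a : R) : R := \int[mu]_x eulerk a x.
Definition ceulerG (s : C) : C := cintegral setT (ceulerk s).

Lemma ceulerG_real a : ceulerG a%:C = (eulerG a)%:C.
Proof.
rewrite /ceulerG -(cintegral_real (eulerk a) measurableT).
by apply: eq_cintegral => x _; rewrite ceulerk_real.
Qed.

Lemma eulerG_ge0 a : 0 <= eulerG a.
Proof. by apply: Rintegral_ge0 => x _; exact: eulerk_ge0. Qed.

Lemma integral_eulerk a : 0 < a -> (\int[mu]_x (eulerk a x)%:E = (eulerG a)%:E)%E.
Proof.
by move=> a0; rewrite /eulerG /Rintegral fineK//; apply: integrable_fin_num => //;
  exact: integrable_eulerk.
Qed.

Lemma normc_ceulerG s : 0 < Re s -> normc (ceulerG s) <= 2 * eulerG (Re s).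
Proof.
move=> s0; rewrite (le_trans (normc_cintegral measurableT (cintegrable_ceulerk s0)))//.
by under eq_Rintegral do rewrite normc_ceulerk.
Qed.

Lemma cvg_eulerk_nat a : 0 < a ->
  (eulerk a k%:R @[k --> \oo] --> 0) /\ (eulerk a (- k%:R) @[k --> \oo] --> 0).
Proof.
move=> a0; set K := expR ((a + 1) * ln (a + 1)).
have m0 : 0 < Num.min a 1 by rewrite lt_min a0 ltr01.
have H : K * expR (- Num.min a 1 * k%:R) @[k --> \oo] --> (0 : R).
  rewrite -[X in _ --> X](mulr0 K); apply: cvgM; first exact: cvg_cst.
  exact: (cvg_comp _ _ (@cvgr_idn R) (cvg_expRMNy m0)).
split; apply: (@squeeze_cvgr _ _ _ _ (fun=> 0) (fun k =>
    K * expR (- Num.min a 1 * k%:R))) => //; try exact: cvg_cst.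
  apply: nearW => k; rewrite eulerk_ge0/= (le_trans (eulerk_le _ a0))//.
  by rewrite ger0_norm.
apply: nearW => k; rewrite eulerk_ge0/= (le_trans (eulerk_le _ a0))//.
by rewrite normrN ger0_norm.
Qed.

Lemma is_derive_eulerk (a x : R) :
  is_derive x 1 (eulerk a) (a * eulerk a x - eulerk (a + 1) x).
Proof.
have d1 : is_derive x 1 (fun x : R => a * x - expR x) (a - expR x).
  by apply: is_derive_eq; rewrite /GRing.scale /= mulr1.
have := @is_derive1_comp R (@expR R) (fun x => a * x - expR x) x _ _
  (is_derive_expR _) d1.
suff -> : a * eulerk a x - eulerk (a + 1) x = expR (a * x - expR x) * (a - expR x) by [].
by rewrite (addrC a 1) eulerkD mul1r -mulrBl mulrC.
Qed.

(** Integration by parts: [s * ceulerk s - ceulerk (s + 1)] is the derivative of [ceulerk s], which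
    vanishes at both ends of the line. Real and imaginary parts are integrated separately. *)
Lemma ceulerG_succ s : 0 < Re s -> ceulerG (s + 1) = s * ceulerG s.
Proof.
move=> s0.
have s1 : 0 < Re (s + 1) by rewrite ReD /= addr_gt0.
pose D x := s * ceulerk s x + (-1) * ceulerk (s + 1) x.
have iD : cintegrable setT D.
  by apply: cintegrableD => //; apply: cintegrableZ => //; exact: cintegrable_ceulerk.
suff D0 : cintegral setT D = 0.
  move: D0; rewrite cintegralD//; [|by apply: cintegrableZ => //;
    exact: cintegrable_ceulerk..].
  rewrite !cintegralZ//; [|exact: cintegrable_ceulerk..].
  by rewrite mulN1r => /eqP; rewrite subr_eq0 => /eqP.
have [c1 c2] := cvg_eulerk_nat s0.
have lim0 (h : R -> R) (u : nat -> R) : (forall x, `|h x| <= 1) ->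
    eulerk (Re s) (u k) @[k --> \oo] --> 0 ->
    eulerk (Re s) (u k) * h (u k) @[k --> \oo] --> 0.
  move=> h1 ul; apply/norm_cvg0P; apply: (@squeeze_cvgr _ _ _ _ (fun=> 0) _ _ _ _ _ ul).
    apply: nearW => k; rewrite normr_ge0 /= normrM (ger0_norm (eulerk_ge0 _ _)).
    by rewrite ler_piMr// eulerk_ge0.
  exact: cvg_cst.
have DE x : (Re (D x) = (Re s * eulerk (Re s) x - eulerk (Re s + 1) x) * cos (Im s * x) -
    eulerk (Re s) x * (Im s * sin (Im s * x))) *
   (Im (D x) = (Re s * eulerk (Re s) x - eulerk (Re s + 1) x) * sin (Im s * x) +
    eulerk (Re s) x * (Im s * cos (Im s * x))).
  by rewrite /D !ceulerkE; split; rewrite ?(ReD, ImD, ReM, ImM, ReIm_cis)/= addr0; ring.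
have c0 (a : R) : continuous (fun x => cos (a * x)).
  exact: (is_derive_continuous (is_derive_cosM a)).
have s00 (a : R) : continuous (fun x => sin (a * x)).
  exact: (is_derive_continuous (is_derive_sinM a)).
have cD a : continuous (fun x => a * eulerk a x - eulerk (a + 1) x).
  move=> x; apply: cvgB; last exact: continuous_eulerk.
  by apply: cvgM; [exact: cvg_cst|exact: continuous_eulerk].
apply: eqC; rewrite /cintegral /=.
  under eq_Rintegral do rewrite DE.
  rewrite (@FTC_line R (fun x => eulerk (Re s) x * cos (Im s * x)) _ 0 0) ?subrr//.
  - move=> x; apply: cvgB; first by apply: cvgM; [exact: cD|exact: c0].
    apply: cvgM; first exact: continuous_eulerk.
    by apply: cvgM; [exact: cvg_cst|exact: s00].
  - move=> x; have d1 := is_derive_eulerk (Re s) x; have d2 := is_derive_cosM (Im s) x.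
    by apply: is_derive_eq; rewrite /GRing.scale /=; ring.
  - by apply: eq_integrable iD.1 => // x _; rewrite DE.
  - by apply: (lim0 (fun x => cos (Im s * x))) => // x; exact: cos_max.
  - by apply: (lim0 (fun x => cos (Im s * x))) => // x; exact: cos_max.
under eq_Rintegral do rewrite DE.
rewrite (@FTC_line R (fun x => eulerk (Re s) x * sin (Im s * x)) _ 0 0) ?subrr//.
- move=> x; apply: cvgD; first by apply: cvgM; [exact: cD|exact: s00].
  apply: cvgM; first exact: continuous_eulerk.
  by apply: cvgM; [exact: cvg_cst|exact: c0].
- move=> x; have d1 := is_derive_eulerk (Re s) x; have d2 := is_derive_sinM (Im s) x.
  by apply: is_derive_eq; rewrite /GRing.scale /=; ring.
- by apply: eq_integrable iD.2 => // x _; rewrite DE.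
- by apply: (lim0 (fun x => sin (Im s * x))) => // x; exact: sin_max.
- by apply: (lim0 (fun x => sin (Im s * x))) => // x; exact: sin_max.
Qed.

Lemma eulerG_succ a : 0 < a -> eulerG (a + 1) = a * eulerG a.
Proof.
move=> a0; apply: complexI; rewrite rmorphM /= -!ceulerG_real -ceulerG_succ//.
by rewrite rmorphD.
Qed.

Lemma eulerG1 : eulerG 1 = 1.
Proof.
rewrite /eulerG (@FTC_line R (fun x => - eulerk 0 x) _ (-1) 0).
- by rewrite opprK add0r.
- exact: continuous_eulerk.
- move=> x; have d1 := is_derive_eulerk 0 x; apply: is_derive_eq.
  by rewrite mul0r add0r opprK add0r.
- exact: integrable_eulerk.
- have -> : (fun k : nat => - eulerk 0 k%:R) = (fun k => - (expR (- expR k%:R) : R)).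
    by apply/funext => k; rewrite /eulerk mul0r add0r.
  rewrite -oppr0; apply: cvgN.
  apply: (@squeeze_cvgr _ _ _ _ (fun=> 0) (fun k : nat => expR (- k%:R))).
  + apply: nearW => k; rewrite expR_ge0 ler_expR lerN2.
    by rewrite (le_trans _ (expR_ge1Dx _))// lerDr.
  + exact: cvg_cst.
  + exact: cvgn_expR.
- have -> : (fun k : nat => - eulerk 0 (- k%:R)) = (fun k => - (expR (- expR (- k%:R)) : R)).
    by apply/funext => k; rewrite /eulerk mul0r add0r.
  apply: cvgN.
  rewrite -[X in _ --> X]expR0 -[X in _ --> expR X]oppr0.
  apply: continuous_cvg; first exact: continuous_expR.
  by apply: cvgN; exact: cvgn_expR.
Qed.

Lemma eulerG_nat k : eulerG k.+1%:R = k`!%:R.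
Proof.
elim: k => [|k IH]; first by rewrite eulerG1.
by rewrite -natr1 eulerG_succ ?ltr0n// IH factS natrM.
Qed.

Lemma ceulerG_prod s m : 0 < Re s ->
  (\prod_(0 <= k < m) (s + k%:R)) * ceulerG s = ceulerG (s + m%:R).
Proof.
move=> s0; elim: m => [|m IH]; first by rewrite big_geq// mul1r addr0.
rewrite big_nat_recr//= mulrAC IH mulrC -ceulerG_succ ?ReD ?Re_nat ?ltr_wpDr//.
by rewrite -natr1 addrA.
Qed.

End GammaKernel.

(** * Gauss's limit *)

Section GaussLimit.
Context {R : realType}.
Local Notation C := R[i].
Local Notation mu := (@lebesgue_measure R).
Local Notation T := (measurableTypeR R).

Definition gaussq (m : nat) (z : C) : C :=
  (\prod_(0 <= k < m.+1) (z + k%:R)) / ((m`!)%:R * rpowc m%:R z).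

Lemma normr_sin_le (x : R) : `|sin x| <= `|x|.
Proof.
wlog x0 : x / 0 <= x.
  move=> H; have [/H//|x0] := leP 0 x.
  by have := H (- x); rewrite sinN !normrN; apply; rewrite oppr_ge0 ltW.
have [c _] := @MVT_segment R (@sin R) (@cos R) 0 x x0 (fun y _ => is_derive_sin y)
  (continuous_subspaceT (@continuous_sin R)).
 rewrite sin0 !subr0 => ->; rewrite normrM ler_piMl//.
exact: cos_max.
Qed.

Lemma normr_1cos_le (x : R) : `|cos x - 1| <= `|x|.
Proof.
wlog x0 : x / 0 <= x.
  move=> H; have [/H//|x0] := leP 0 x.
  by have := H (- x); rewrite cosN normrN; apply; rewrite oppr_ge0 ltW.
have [c _] := @MVT_segment R (@cos R) (fun x => - sin x) 0 x x0
  (fun y _ => is_derive_cos y) (continuous_subspaceT (@continuous_cos R)).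
 rewrite cos0 subr0 => ->; rewrite normrM normrN ler_piMl//.
exact: sin_max.
Qed.

Lemma normc_cis_sub1 (x : R) : normc (cis x - 1) <= 2 * `|x|.
Proof.
rewrite (le_trans (normc_le_ReIm _))// ReD ImD !ReIm_cis /= subr0.
by rewrite mulr_natl mulr2n lerD ?normr_sin_le ?normr_1cos_le.
Qed.

(** Each of the [N] powers in the geometric sum for [(r ^ N - 1) / (r - 1)] is at most [1 + r ^ N],
    whether [r] is below or above 1. *)
Lemma normr_expRX_sub1 (N : nat) (r : R) : 0 <= r ->
  `|r ^+ N - 1| <= N%:R * (`|r - 1| * (1 + r ^+ N)).
Proof.
move=> r0; rewrite subrX1 normrM mulrCA ler_wpM2l//.
rewrite ger0_norm; last by apply: sumr_ge0 => i _; exact: exprn_ge0.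
rewrite [X in _ <= X](_ : _ = \sum_(i < N) (1 + r ^+ N)); last first.
  by rewrite sumr_const card_ord mulr_natl.
apply: ler_sum => i _; have [r1|r1] := leP r 1.
  by rewrite ler_wpDr ?exprn_ge0// exprn_ile1.
by rewrite ler_wpDl// ler_weXn2l ?(ltW r1)// ltnW.
Qed.

(* The bound is a polynomial in [exp y] up to the absolute value, so that its square has an
   expectation under the Gamma distribution computable from integer moments. *)
Lemma normc_cexp_sub1 (s : C) (N : nat) (y : R) : 1 <= Re s -> Re s <= N%:R ->
  normc (cexp (s * y%:C) - 1) <=
  (2 * `|Im s| + N%:R) * (`|expR y - 1| * (1 + expR y ^+ N)).
Proof.
move=> s1 sN; set r := expR y.
have r0 : 0 <= r by exact: expR_ge0.
have rN : r ^+ N = expR (N%:R * y) by rewrite expRM_natl.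
have -> : cexp (s * y%:C) = (expR (Re s * y))%:C * cis (Im s * y).
  rewrite /cis -cexp_real -cexpD; congr cexp.
  by apply: eqC; rewrite ?(ReD, ImD, ReM, ImM) /=; ring.
have -> : forall a b : C, a * b - 1 = a * (b - 1) + (a - 1).
  by move=> a b; ring.
rewrite (le_trans (le_normcD _ _))// mulrDl lerD//.
  rewrite Normc.normcM normc_real (ger0_norm (expR_ge0 _)).
  rewrite (le_trans (ler_wpM2l (expR_ge0 _) (normc_cis_sub1 _)))//.
  rewrite normrM mulrCA -!mulrA ler_wpM2l// mulrCA ler_wpM2l//.
  have [y0|y0] := leP 0 y.
    rewrite ger0_norm// mulrC; apply: ler_pM => //.
    - by rewrite (le_trans _ (ler_norm _))// lerBrDl expR_ge1Dx.
    - by rewrite rN ler_wpDl// ler_expR ler_wpM2r.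
  rewrite (@le_trans _ _ `|r - 1|)//; last first.
    by rewrite ler_peMr// lerDl exprn_ge0.
  rewrite ltr0_norm// (@le_trans _ _ (r * - y))//.
    apply: ler_wpM2r; first by rewrite oppr_ge0 ltW.
    rewrite ler_expR -[leRHS]mul1r.
    by rewrite ler_wnM2r// ltW.
  rewrite -normrN (le_trans _ (ler_norm _))// opprB.
  have := expR_ge1Dx (- y); rewrite expRN => H.
  rewrite mulrC -ler_pdivlMr ?expR_gt0// mulrBl mul1r divff ?expR_eq0//; lra.
apply: le_trans (normr_expRX_sub1 N r0).
have -> : (expR (Re s * y))%:C - 1 = (expR (Re s * y) - 1)%:C by rewrite rmorphB.
have s0 : 0 <= Re s by rewrite (le_trans _ s1).
have mono a : 0 <= a -> (0 <= y -> 1 <= expR (a * y)) * (y < 0 -> expR (a * y) <= 1).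
  move=> a0; rewrite -expR0 !ler_expR; split => y0; first exact: mulr_ge0.
  by rewrite mulr_ge0_le0// ltW.
rewrite normc_real rN; have [y0|y0] := leP 0 y.
  rewrite !ger0_norm ?subr_ge0 ?(mono _ _).1//.
  by rewrite lerD2r ler_expR ler_wpM2r.
rewrite !ler0_norm ?subr_le0 ?(mono _ _).2//.
by rewrite lerN2 lerD2r ler_expR ler_wnM2r// ltW.
Qed.

Lemma Rintegral_eulerk_comb (a c : R) (g : T -> R) : 0 < a ->
  mu.-integrable setT (fun x => (g x)%:E) ->
  mu.-integrable setT (fun x => (c * eulerk a x + g x)%:E) /\
  \int[mu]_x (c * eulerk a x + g x) = c * eulerG a + \int[mu]_x g x.
Proof.
move=> a0 gi; have ri := integrable_eulerk a0.
have cri : mu.-integrable setT (fun x => (c * eulerk a x)%:E).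
  exact: (integrableZl measurableT c ri).
split; first exact: (integrableD measurableT cri gi).
by rewrite RintegralD// RintegralZl.
Qed.

(** Each of the [j] extra factors is at most [m + j <= (1 + j) m]; only the order [m ^ j]
    matters. *)
Lemma fact_ratio_le (m j : nat) : (0 < m)%N ->
  ((m + j)`!%:R : R) <= m`!%:R * ((1 + j)%:R * m%:R) ^+ j.
Proof.
move=> m0; rewrite -natrM -natrX -natrM ler_nat.
have H k : (k <= j)%N -> ((m + k)`! <= m`! * ((1 + j) * m) ^ k)%N.
  elim: k => [|k IH] kj; first by rewrite addn0 expn0 muln1.
  rewrite addnS factS expnS mulnCA leq_mul//; last exact/IH/ltnW.
  rewrite -addnS mulnDl mul1n leq_add2l (leq_trans kj)//.
  by rewrite leq_pmulr.
exact: H.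
Qed.

(** By the recurrence, [gaussq m s * ceulerG s] is the expectation of [(X / m) ^ s] for [X] with the
    Gamma distribution of parameter [m + 1]; [W] is the density of [ln X]. As [X / m] deviates from
    1 by about [1 / sqrt m] in mean square, the expectation is that close to 1. *)
Lemma gaussq_ceulerG_sub1_le (s : C) (N m : nat) : 1 <= Re s -> Re s <= N%:R ->
  (0 < m)%N ->
  normc (gaussq m s * ceulerG s - 1) <=
  (2 * `|Im s| + N%:R) * (5 + 2 * (1 + 2 * N)%:R ^+ (2 * N)) / Num.sqrt m%:R.
Proof.
move=> s1 sN m0; set K := 2 * `|Im s| + N%:R.
have K0 : 0 <= K by rewrite addr_ge0// mulr_ge0.
have s0 : 0 < Re s by rewrite (lt_le_trans _ s1).
have mR : 0 < (m%:R : R) by rewrite ltr0n.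
set t := Num.sqrt (m%:R : R).
have t0 : 0 < t by rewrite sqrtr_gt0.
have tt : t ^+ 2 = m%:R by rewrite sqr_sqrtr// ltW.
have f0 : 0 < (m`!%:R : R) by rewrite ltr0n fact_gt0.
pose W (x : R) := eulerk m.+1%:R x / m`!%:R.
have W0 x : 0 <= W x by rewrite divr_ge0 ?eulerk_ge0// ltW.
have WE x : W x = (m`!%:R)^-1 * eulerk m.+1%:R x by rewrite mulrC.
have Wi : mu.-integrable setT (fun x => (W x)%:E).
  have := integrableZl measurableT (m`!%:R)^-1 (@integrable_eulerk R m.+1%:R (ltr0Sn _ _)).
  by apply: eq_integrable => // x _; rewrite -EFinM WE.
have W1 : \int[mu]_x W x = 1.
  under eq_Rintegral do rewrite WE.
  rewrite RintegralZl//; last exact: integrable_eulerk.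
  by rewrite -/(eulerG _) eulerG_nat mulVf// gt_eqF.
pose F (x : R) := cexp (s * (x - ln m%:R)%:C) * (W x)%:C.
have FE x : F x = ((m`!)%:R * rpowc m%:R s)^-1 * ceulerk (s + m.+1%:R) x.
  rewrite /F ceulerkD !natC ceulerk_real rmorphB mulrBr cexpD cexpN /rpowc.
  by rewrite [s * (ln _)%:C]mulrC invfM -fmorphV WE rmorphM /=; ring.
have sm : 0 < Re (s + m.+1%:R) by rewrite ReD Re_nat addr_gt0.
have Fi : cintegrable setT F.
  have H := cintegrableZ ((m`!)%:R * rpowc m%:R s)^-1 measurableT
    (cintegrable_ceulerk sm).
  by apply: (eq_cintegrable measurableT _ H) => x _; rewrite FE.
have -> : gaussq m s * ceulerG s = cintegral setT F.
  rewrite (eq_cintegral (fun x _ => FE x)) cintegralZ//; last exact: cintegrable_ceulerk.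
  by rewrite -/(ceulerG _) -ceulerG_prod// /gaussq; ring.
have -> : cintegral setT F - 1 = cintegral setT (fun x => F x + (-1) * (W x)%:C).
  have Wc := cintegrable_real Wi.
  rewrite cintegralD//; last exact: cintegrableZ.
  by rewrite cintegralZ// cintegral_real// W1 mulN1r.
have Di : cintegrable setT (fun x => F x + (-1) * (W x)%:C).
  by apply: cintegrableD => //; apply: cintegrableZ => //; exact: cintegrable_real.
rewrite (le_trans (normc_cintegral measurableT Di))//.
pose c := K / (2 * m`!%:R).
(* [B] is [K / 2 * (t (r - 1)^2 + 2 / t * (1 + r^(2 N))) * W] with [r = exp x / m], expanded into
   kernels [eulerk] at integers, so that its integral is a combination of factorials. *)
pose B (x : R) := c * (t / m%:R ^+ 2) * eulerk m.+3%:R x + (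
  c * (- 2 * t / m%:R) * eulerk m.+2%:R x + (
  c * (2 / t / m%:R ^+ (2 * N)) * eulerk (m + 2 * N).+1%:R x +
  c * (t + 2 / t) * eulerk m.+1%:R x)).
have [i4 e4] : mu.-integrable setT (fun x => (c * (t + 2 / t) * eulerk m.+1%:R x)%:E)
    /\ \int[mu]_x (c * (t + 2 / t) * eulerk m.+1%:R x) = c * (t + 2 / t) * m`!%:R.
  have ri := @integrable_eulerk R m.+1%:R (ltr0Sn _ _).
  split; first exact: (integrableZl measurableT (c * (t + 2 / t)) ri).
  by rewrite RintegralZl// -/(eulerG _) eulerG_nat.
have [i3 e3] := Rintegral_eulerk_comb (c * (2 / t / m%:R ^+ (2 * N)))
  (ltr0Sn R (m + 2 * N)) i4.
have [i2 e2] := Rintegral_eulerk_comb (c * (- 2 * t / m%:R)) (ltr0Sn R m.+1) i3.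
have [i1 e1] := Rintegral_eulerk_comb (c * (t / m%:R ^+ 2)) (ltr0Sn R m.+2) i2.
apply: (@le_trans _ _ (2 * \int[mu]_x B x)).
  rewrite ler_pM2l//; apply: le_Rintegral => //; first exact: integrable_normc.
  move=> x _; set y := x - ln m%:R; set r := expR y.
  have r0 : 0 <= r by exact: expR_ge0.
  have rj j : r ^+ j * eulerk m.+1%:R x = eulerk (m + j).+1%:R x / m%:R ^+ j.
    rewrite -addSn natrD addrC eulerkD expRM_natl /r /y expRD expRN lnK ?posrE//.
    by rewrite exprMn exprVn; ring.
  have -> : F x + (-1) * (W x)%:C = (cexp (s * y%:C) - 1) * (W x)%:C.
    by rewrite /F -/y; ring.
  rewrite Normc.normcM normc_real (ger0_norm (W0 x)).
  apply: (@le_trans _ _ (K * (`|r - 1| * (1 + r ^+ N)) * W x)).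
    by rewrite ler_wpM2r//; exact: normc_cexp_sub1.
  (* Weighted arithmetic-geometric mean. The weight [t = sqrt m] balances a second moment of order
     [1 / m] against a bounded one; the difference of the two sides is a sum of two squares over
     [2 t]. *)
  have H : `|r - 1| * (1 + r ^+ N) <= 2^-1 * (t * (r - 1) ^+ 2 + 2 / t * (1 + r ^+ (2 * N))).
    have a0 := normr_ge0 (r - 1); have -> : (r - 1) ^+ 2 = `|r - 1| ^+ 2.
      by rewrite real_normK// num_real.
    move: (`|r - 1|) a0 => a a0; rewrite mulnC exprM; move: (r ^+ N) => b.
    rewrite -subr_ge0.
    have -> : 2^-1 * (t * a ^+ 2 + 2 / t * (1 + b ^+ 2)) - a * (1 + b) =
        ((t * a - (1 + b)) ^+ 2 + (1 - b) ^+ 2) / (2 * t).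
      by field; rewrite gt_eqF.
    by rewrite divr_ge0 ?addr_ge0 ?sqr_ge0// mulr_ge0// ltW.
  apply: (@le_trans _ _ (K * (2^-1 * (t * (r - 1) ^+ 2 + 2 / t * (1 + r ^+ (2 * N)))) * W x)).
    by rewrite ler_wpM2r// ler_wpM2l.
  rewrite le_eqVlt; apply/orP; left; apply/eqP.
  have := rj 2; have := rj 1%N; have := rj (2 * N)%N; rewrite expr1 addn2 addn1.
  rewrite /B /c /W => q1 q2 q3.
  transitivity (K / (2 * m`!%:R) * (t * (r ^+ 2 * eulerk m.+1%:R x
     - 2 * (r * eulerk m.+1%:R x) + eulerk m.+1%:R x) +
     2 / t * (eulerk m.+1%:R x + r ^+ (2 * N) * eulerk m.+1%:R x))).
    by field; rewrite !gt_eqF.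
  by rewrite q1 q2 q3; field; rewrite !gt_eqF// exprn_gt0.
rewrite e1 e2 e3 e4 !eulerG_nat.
have h1 := fact_ratio_le (2 * N) m0.
have P0 : 0 < (m%:R : R) ^+ (2 * N) by rewrite exprn_gt0.
have h2 : (m + 2 * N)`!%:R / m%:R ^+ (2 * N) <= m`!%:R * (1 + 2 * N)%:R ^+ (2 * N) :> R.
  by rewrite ler_pdivrMr// -mulrA -exprMn.
have -> : m.+2`!%:R = (m%:R + 2) * (m%:R + 1) * m`!%:R :> R.
  by rewrite !factS !natrM -!natr1; ring.
have -> : m.+1`!%:R = (m%:R + 1) * m`!%:R :> R.
  by rewrite !factS !natrM -!natr1; ring.
set X := (1 + 2 * N)%:R ^+ (2 * N) in h2 *.
set Y := (m + 2 * N)`!%:R / _ in h2.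
rewrite /c.
(* The leading terms cancel here: the second moment of [r - 1] is exactly [(m + 2) / m^2]. *)
have -> : 2 * (K / (2 * m`!%:R) * (t / m%:R ^+ 2) * ((m%:R + 2) * (m%:R + 1) * m`!%:R) +
   (K / (2 * m`!%:R) * (- 2 * t / m%:R) * ((m%:R + 1) * m`!%:R) +
   (K / (2 * m`!%:R) * (2 / t / m%:R ^+ (2 * N)) * (m + 2 * N)`!%:R +
    K / (2 * m`!%:R) * (t + 2 / t) * m`!%:R))) =
   K * (t * ((m%:R + 2) / m%:R ^+ 2) + 2 / t * (1 + Y / m`!%:R)).
  by rewrite /Y; field; rewrite !gt_eqF.
rewrite -[leRHS]mulrA ler_wpM2l//.
have -> : t * ((m%:R + 2) / m%:R ^+ 2) = (1 + 2 / m%:R) / t.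
  by rewrite -tt; field; rewrite gt_eqF.
have -> : (1 + 2 / m%:R) / t + 2 / t * (1 + Y / m`!%:R) =
  (1 + 2 / m%:R + 2 * (1 + Y / m`!%:R)) / t by field; rewrite !gt_eqF.
rewrite ler_wpM2r ?invr_ge0 ?(ltW t0)//.
have : Y / m`!%:R <= X by rewrite ler_pdivrMr// mulrC.
have : (m%:R : R)^-1 <= 1 by rewrite invf_le1// ler1n.
lra.
Qed.

End GaussLimit.

(** * Convergence of Gauss's limit in the whole plane, and its agreement with Euler's integral *)

Section GaussLimitTheorem.
Context {R : realType}.
Local Notation C := R[i].

Lemma near_ccvg (u v : nat -> C) z : (\forall k \near \oo, u k = v k) ->
  ccvg u z -> ccvg v z.
Proof.
move=> uv [u1 u2]; split.
  apply: cvg_trans u1; apply: near_eq_cvg.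
  by apply: filterS uv => k /= ->.
apply: cvg_trans u2; apply: near_eq_cvg.
by apply: filterS uv => k /= ->.
Qed.

Lemma cvg_inv_nat : (k%:R : R)^-1 @[k --> \oo] --> (0 : R).
Proof. by apply/gtr0_cvgV0; [near do rewrite ltr0n; exists 1%N|exact: cvgr_idn]. Unshelve. all: by end_near. Qed.

Lemma ccvg_gaussq_ceulerG (s : C) : 1 <= Re s ->
  ccvg (fun m => gaussq m s * ceulerG s) 1.
Proof.
move=> s1; apply/ccvgP.
pose N := Num.bound (Re s).
have sN : Re s <= N%:R by rewrite ltW// archi_boundP// (le_trans _ s1).
pose K := (2 * `|Im s| + N%:R) * (5 + 2 * (1 + 2 * N)%:R ^+ (2 * N)).
apply: (@squeeze_cvgr _ _ _ _ (fun=> 0) (fun m => K * Num.sqrt (m%:R^-1))).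
- near=> m; rewrite normc_ge0/= sqrtrV// gaussq_ceulerG_sub1_le//.
  by near: m; exists 1%N.
- exact: cvg_cst.
- rewrite -[X in _ --> X](mulr0 K); apply: cvgM; first exact: cvg_cst.
  rewrite -[X in _ --> X](@sqrtr0 R).
  by apply: continuous_cvg; [exact: sqrt_continuous|exact: cvg_inv_nat].
Unshelve. all: by end_near. Qed.

(** Its products with Gauss's sequence tend to 1, so the constant factor cannot be 0. *)
Lemma ceulerG_neq0_ge1 (s : C) : 1 <= Re s -> ceulerG s != 0.
Proof.
move=> s1; apply/eqP => s0; have := ccvg_gaussq_ceulerG s1.
rewrite s0 => H; have := @ccvg_unique _ _ 1 0 H.
suff : ccvg (fun m => gaussq m s * 0) 0.
  by move=> H0 /(_ H0) /eqP; rewrite oner_eq0.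
by apply: eq_ccvg (ccvg_cst 0) => k; rewrite mulr0.
Qed.

(** The products for [z] and [z + 1] share all but their end factors [z] and [z + m + 1], and the
    latter over [m] is [1 + (z + 1) / m], which tends to 1. *)
Lemma gaussq_succ (z : C) (m : nat) : (0 < m)%N ->
  (1 + (z + 1) / m%:R) * gaussq m z = z * gaussq m (z + 1).
Proof.
move=> m0; have mC : (m%:R : C) != 0 by rewrite pnatr_eq0 -lt0n.
have mR : 0 < (m%:R : R) by rewrite ltr0n.
have fC : (m`!%:R : C) != 0 by rewrite pnatr_eq0 -lt0n fact_gt0.
rewrite /gaussq rpowcD rpowc1// -natC.
have -> : \prod_(0 <= k < m.+1) (z + 1 + k%:R) =
    (\prod_(1 <= k < m.+1) (z + k%:R)) * (z + m.+1%:R).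
  rewrite -big_nat_recr//= big_add1/=.
  by apply: eq_bigr => k _; rewrite -[k.+1%:R]natr1; ring.
rewrite big_nat_recl// addr0 big_add1/= -[m.+1%:R]natr1.
by field; rewrite mC fC rpowc_neq0.
Qed.

Lemma ccvg_gaussq_pred (z l : C) : ccvg (gaussq ^~ (z + 1)) l ->
  ccvg (gaussq ^~ z) (z * l).
Proof.
move=> H.
have H1 : ccvg (fun m => 1 + (z + 1) * (m%:R^-1)%:C) (1 + (z + 1) * 0%:C).
  apply: ccvgD; first exact: ccvg_cst.
  by apply: ccvgM; [exact: ccvg_cst|apply: ccvg_real; exact: cvg_inv_nat].
rewrite mulr0 addr0 in H1.
have H2 := ccvgV (oner_neq0 _) H1.
have := ccvgM H2 (ccvgM (ccvg_cst z) H).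
rewrite invr1 mul1r; apply: near_ccvg.
(* Beyond [M] the factor [1 + (z + 1) / m] has positive real part, so it may be divided out. *)
pose M := Num.bound `|Re z|.
near=> m.
have m0 : (0 < m)%N by near: m; exists 1%N.
have mM : (M <= m)%N by near: m; exists M.
rewrite -gaussq_succ// natC fmorphV mulKf//.
apply/eqP => /(congr1 (fun w => Re w)); rewrite -fmorphV /= ReD ReM /= mulr0 subr0 ReD /=.
have : 0 < 1 + (Re z + 1) / m%:R.
  have mR : 0 < (m%:R : R) by rewrite ltr0n.
  rewrite -[X in X + _](divff (x := m%:R)) ?gt_eqF// -mulrDl divr_gt0//.
  have := archi_boundP (normr_ge0 (Re z)); rewrite -/M => H3.
  have := ler_norm (- Re z); rewrite normrN.
  have : (M%:R : R) <= m%:R by rewrite ler_nat.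
  lra.
by move=> /[swap] ->; rewrite ltxx.
Unshelve. all: by end_near. Qed.

Lemma ccvg_gaussq_ge1 (s : C) : 1 <= Re s -> ccvg (gaussq ^~ s) (ceulerG s)^-1.
Proof.
move=> s1; have := ccvgM (ccvg_gaussq_ceulerG s1) (ccvg_cst (ceulerG s)^-1).
by rewrite mul1r; apply: eq_ccvg => k; rewrite mulfK// ceulerG_neq0_ge1.
Qed.

(** Convergence is carried to the left from [1 <= Re z] by induction on the number of unit shifts.
    Poles of Gamma cause no trouble, since each shift multiplies the limit by [z]. *)
Lemma ccvg_gaussq (z : C) : ccvg (gaussq ^~ z) (rGamma z).
Proof.
suff [l H] : exists l, ccvg (gaussq ^~ z) l by have -> : rGamma z = l := ccvg_climn H.
have [N zN] : exists N : nat, 1 <= Re z + N%:R.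
  exists (Num.bound `|Re z|).+1; have := archi_boundP (normr_ge0 (Re z)).
  by have := ler_norm (- Re z); rewrite normrN -natr1; lra.
elim: N z zN => [|N IH] z zN.
  by exists (ceulerG z)^-1; apply: ccvg_gaussq_ge1; rewrite addr0 in zN.
have [|l] := IH (z + 1); first by rewrite ReD /= -addrA (addrC 1) natr1.
by move=> H; exists (z * l); exact: ccvg_gaussq_pred.
Qed.

Lemma rGamma_succ (z : C) : rGamma z = z * rGamma (z + 1).
Proof.
apply: (ccvg_unique (ccvg_gaussq z)).
exact/ccvg_gaussq_pred/ccvg_gaussq.
Qed.

(** Both recurrences carry the identity one step down, from [1 <= Re s] to [0 < Re s]. *)
Lemma rGamma_ceulerG (s : C) : 0 < Re s -> rGamma s = (ceulerG s)^-1 /\ ceulerG s != 0.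
Proof.
move=> s0; have s1 : 1 <= Re (s + 1) by rewrite ReD /= lerDr ltW.
have sN0 : s != 0 by apply/eqP => sE; rewrite sE /= ltxx in s0.
have E := ceulerG_succ s0; have N1 := ceulerG_neq0_ge1 s1.
have N0 : ceulerG s != 0 by move: N1; rewrite E mulf_eq0 negb_or => /andP[].
split => //; rewrite rGamma_succ.
rewrite -(ccvg_unique (ccvg_gaussq_ge1 s1) (ccvg_gaussq (s + 1))) E invfM.
by rewrite mulVKf.
Qed.

Lemma Gamma_ceulerG (s : C) : 0 < Re s -> Gamma s = ceulerG s.
Proof. by move=> s0; rewrite /Gamma (rGamma_ceulerG s0).1 invrK. Qed.

Lemma eulerG_gt0 (a : R) : 0 < a -> 0 < eulerG a.
Proof.
move=> a0; rewrite lt_neqAle eulerG_ge0 andbT eq_sym.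
have [_] := @rGamma_ceulerG a%:C a0; rewrite ceulerG_real.
by apply: contra => /eqP ->.
Qed.

Lemma rGamma_real (a : R) : 0 < a -> rGamma a%:C = ((eulerG a)^-1)%:C.
Proof. by move=> a0; rewrite (@rGamma_ceulerG a%:C a0).1 ceulerG_real fmorphV. Qed.

End GaussLimitTheorem.

(** * Bounds for the Gamma function *)

Section GammaBounds.
Context {R : realType}.
Local Notation C := R[i].
Local Notation mu := (@lebesgue_measure R).

(** Telescoping, by [1 / (y + 1)^2 <= 1 / y - 1 / (y + 1)]. *)
Lemma sum_inv_sqr_le (x : R) (m : nat) : 0 < x ->
  \sum_(0 <= k < m.+1) ((x + k%:R) ^+ 2)^-1 <= (x ^+ 2)^-1 + x^-1 - (x + m%:R)^-1.
Proof.
move=> x0; elim: m => [|m IH]; first by rewrite big_nat1 addr0 addrK.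
rewrite big_nat_recr//= (le_trans (lerD IH (lexx _)))//.
have y0 : 0 < x + m%:R by rewrite ltr_wpDr.
rewrite -[m.+1%:R]natr1 addrA; move: (x + m%:R) y0 => y y0.
have y1 : 0 < y + 1 by rewrite addr_gt0.
suff : ((y + 1) ^+ 2)^-1 <= y^-1 - (y + 1)^-1 by lra.
have -> : y^-1 - (y + 1)^-1 = (y * (y + 1))^-1 by field; rewrite !gt_eqF.
by rewrite lef_pV2 ?posrE ?exprn_gt0 ?mulr_gt0// expr2 ler_wpM2r ?ltW// ltrDl.
Qed.

(** Crude, but quadratic in [y / x]: over the factors [x + k] of Gauss's product the exponents form
    a convergent series. *)
Lemma normc_le_expR (x y : R) : 0 < x ->
  normc (x +i* y) <= x * expR (y ^+ 2 * (x ^+ 2)^-1).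
Proof.
move=> x0; rewrite (@le_trans _ _ (x * (1 + y ^+ 2 / x ^+ 2)))//; last first.
  by rewrite ler_wpM2l ?expR_ge1Dx ?ltW.
have r0 : 0 <= y ^+ 2 / x ^+ 2 by rewrite divr_ge0 ?sqr_ge0.
rewrite -(ler_pXn2r (n := 2))// ?nnegrE ?normc_ge0//; last first.
  by rewrite mulr_ge0 ?addr_ge0 ?(ltW x0).
have xr : x ^+ 2 * (y ^+ 2 / x ^+ 2) = y ^+ 2 by field; rewrite gt_eqF.
move: (y ^+ 2 / x ^+ 2) r0 xr => r r0 xr.
have -> : (x * (1 + r)) ^+ 2 = x ^+ 2 + 2 * (x ^+ 2 * r) + x ^+ 2 * r ^+ 2 by ring.
rewrite normc_sqr /= xr; have := sqr_ge0 y.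
have : 0 <= x ^+ 2 * r ^+ 2 by rewrite mulr_ge0 ?sqr_ge0.
lra.
Qed.

(** Leaving the real axis costs each factor at most [exp (y^2 / (x + k)^2)], where [z = x + i y],
    and these exponents add up to at most [2 y^2 / x <= 2 M^2 x], uniformly in [m]. *)
Lemma normc_gaussq_le (z : C) (M : R) (m : nat) : 1 <= Re z ->
  `|Im z| <= M * Re z ->
  normc (gaussq m z) <= expR (2 * M ^+ 2 * Re z) * normc (gaussq m (Re z)%:C).
Proof.
move=> z1 zM; have z0 : 0 < Re z by rewrite (lt_le_trans _ z1).
rewrite /gaussq !Normc.normcM !Normc.normcV !Normc.normcM !normc_rpowc /= mulrA.
rewrite ler_wpM2r ?invr_ge0 ?mulr_ge0 ?normc_ge0 ?expR_ge0//.
rewrite !normc_prod.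
have pos k : 0 < Re z + k%:R by rewrite ltr_wpDr.
apply: (@le_trans _ _ (\prod_(0 <= k < m.+1)
  ((Re z + k%:R) * expR (Im z ^+ 2 * ((Re z + k%:R) ^+ 2)^-1)))).
  apply: ler_prod => k _; rewrite normc_ge0/=.
  have -> : z + k%:R = (Re z + k%:R) +i* Im z.
    by apply: eqC; rewrite ?ReD ?ImD ?Re_nat ?Im_nat ?addr0.
  exact: normc_le_expR.
rewrite big_split/= mulrC.
have -> : \prod_(0 <= i < m.+1) (Re z + i%:R) =
    \prod_(0 <= j < m.+1) normc ((Re z)%:C + j%:R).
  apply: eq_bigr => k _; rewrite natC -rmorphD normc_real gtr0_norm//.
rewrite ler_wpM2r ?prodr_ge0//; first by move=> k _; exact: normc_ge0.
rewrite -expR_sum ler_expR -mulr_sumr.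
apply: (@le_trans _ _ ((M * Re z) ^+ 2 * (2 / Re z))); last first.
  by rewrite le_eqVlt; apply/orP; left; apply/eqP; field; rewrite gt_eqF.
apply: ler_pM => //; first exact: sqr_ge0.
- by apply: sumr_ge0 => k _; rewrite invr_ge0 sqr_ge0.
- by rewrite -[Im z ^+ 2]real_normK ?num_real// lerXn2r// nnegrE// (le_trans _ zM).
- rewrite (le_trans (sum_inv_sqr_le m z0))//.
  have : 0 <= (Re z + m%:R)^-1 by rewrite invr_ge0 ltW.
  have : (Re z ^+ 2)^-1 <= (Re z)^-1.
    by rewrite lef_pV2 ?posrE ?exprn_gt0// expr2 ler_peMl// ltW.
  lra.
Qed.

Lemma normc_rGamma_le (z : C) (M : R) : 1 <= Re z -> `|Im z| <= M * Re z ->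
  normc (rGamma z) <= expR (2 * M ^+ 2 * Re z) / eulerG (Re z).
Proof.
move=> z1 zM; have z0 : 0 < Re z by rewrite (lt_le_trans _ z1).
have -> : (eulerG (Re z))^-1 = normc (rGamma (Re z)%:C).
  by rewrite rGamma_real// normc_real ger0_norm// invr_ge0 eulerG_ge0.
apply: (ler_cvg_to (ccvg_norm (ccvg_gaussq z))
  (cvgM (cvg_cst (expR (2 * M ^+ 2 * Re z))) (ccvg_norm (ccvg_gaussq (Re z)%:C)))).
by apply: nearW => m; exact: normc_gaussq_le.
Qed.

(** Only the part of the integral over [[L, L + 1]] is kept. As [L] is free, [eulerG] outgrows every
    exponential [exp (a L)]. *)
Lemma eulerG_ge (a L : R) : 0 < a -> expR (a * L - expR (L + 1)) <= eulerG a.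
Proof.
move=> a0; rewrite -lee_fin -integral_eulerk//.
have mI : measurable (`[L, L + 1]%classic : set (measurableTypeR R)) by [].
apply: (@le_trans _ _ (\int[mu]_(x in `[L, (L + 1)%R]) (eulerk a x)%:E)%E); last first.
  apply: ge0_subset_integral => //.
  - by apply/measurable_EFinP; exact: measurable_eulerk.
  - by move=> x _; rewrite lee_fin eulerk_ge0.
have <- : (\int[mu]_(x in `[L, (L + 1)%R]) (expR (a * L - expR (L + 1)))%:E =
    (expR (a * L - expR (L + 1)))%:E)%E.
  have mI1 : mu (`[L, L + 1]%classic) = 1%:E.
    rewrite (@lebesgue_measure_itv R `[L, L + 1]) /= lte_fin ltrDl ltr01.
    by rewrite -EFinD addrAC subrr add0r.
  rewrite integral_cst//.
  by rewrite -[RHS]mule1; congr (_ * _)%E; exact: mI1.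
apply: ge0_le_integral => //.
- by apply/measurable_EFinP; apply: measurable_funTS; exact: measurable_eulerk.
- move=> x /=; rewrite in_itv/= => /andP[x1 x2]; rewrite lee_fin /eulerk ler_expR lerB//.
    by rewrite ler_wpM2l// ltW.
  by rewrite ler_expR.
Qed.

End GammaBounds.

(** * Stirling's formula and the multiplication formula *)

Section Stirling.
Context {R : realType}.

Lemma ge0_derive_le (f f' : R -> R) (y : R) : 0 <= y ->
  (forall x : R, is_derive x 1 f (f' x)) -> (forall x, 0 <= x -> 0 <= f' x) ->
  f 0 <= f y.
Proof.
move=> y0 df f0; have cf := is_derive_continuous df.
have [c cy] := @MVT_segment R f f' 0 y y0 (fun x _ => df x) (continuous_subspaceT cf).
rewrite -subr_ge0 => ->; rewrite subr0 mulr_ge0// f0//.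
by move: cy; rewrite in_itv/= => /andP[].
Qed.

(** This is [tanh (y / 2) <= y / 2]; at [y = ln ((m + 1) / m)] it makes [stirl] nonincreasing. *)
Lemma expR_pade_le (y : R) : 0 <= y -> 2 * (expR y - 1) <= y * (expR y + 1).
Proof.
move=> y0; rewrite -subr_ge0.
pose f (x : R) := x * (expR x + 1) - 2 * (expR x - 1).
have -> : 0 = f 0 by rewrite /f expR0 subrr mulr0 mul0r subrr.
apply: (@ge0_derive_le f (fun x => 1 + (x - 1) * expR x)) => // [x|x x0].
  by apply: is_derive_eq; rewrite /GRing.scale/=; ring.
have := expR_ge1Dx (- x); rewrite expRN => H.
have e0 := expR_gt0 x.
have : (1 + - x) * expR x <= 1 by rewrite -ler_pdivlMr// div1r.
lra.
Qed.

(** This is [y <= sinh y]; at [y = ln ((m + 1) / m)] it bounds the decrements of [stirl] by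
    telescoping ones. *)
Lemma expR_sinh_ge (y : R) : 0 <= y -> 2 * y <= expR y - expR (- y).
Proof.
move=> y0; rewrite -subr_ge0.
pose f (x : R) := expR x - expR (- x) - 2 * x.
have -> : 0 = f 0 by rewrite /f oppr0 expR0 subrr mulr0 subrr.
apply: (@ge0_derive_le f (fun x => expR x + expR (- x) - 2)) => // [x|x x0].
  have d1 := is_derive_expRM (-1) x.
  have fE : f = fun x => expR x - expR (-1 * x) - 2 * x.
    by apply/funext => z; rewrite /f mulN1r.
  rewrite fE; apply: is_derive_eq; rewrite /GRing.scale/= !mulN1r; ring.
by have := expR_ge1Dx x; have := expR_ge1Dx (- x); lra.
Qed.

(** The logarithm of the Stirling quotient [m! / (m^(m + 1/2) exp (- m))], for positive [m]. *)
Definition stirl (m : nat) : R :=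
  ln m`!%:R - (m%:R + 2^-1) * ln m%:R + m%:R.

Lemma stirl_step (m : nat) : (0 < m)%N ->
  0 <= stirl m - stirl m.+1 <= 4^-1 * (m%:R^-1 - m.+1%:R^-1).
Proof.
move=> m0; have mR : 0 < (m%:R : R) by rewrite ltr0n.
have m1R : 0 < (m.+1%:R : R) by rewrite ltr0n.
pose y := ln (m.+1%:R : R) - ln m%:R.
have ey : expR y = m.+1%:R / m%:R by rewrite expRB !lnK ?posrE.
have y0 : 0 <= y by rewrite subr_ge0 ler_ln ?posrE// ler_nat.
have -> : stirl m - stirl m.+1 = (m%:R + 2^-1) * y - 1.
  rewrite /stirl factS natrM lnM ?posrE ?ltr0n ?fact_gt0// /y -natr1; ring.
have h1 := expR_pade_le y0; have h2 := expR_sinh_ge y0.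
rewrite expRN ey in h1 h2.
move: m1R h1 h2; rewrite -[m.+1%:R]natr1; move: (m%:R : R) mR => x x0 x1 h1 h2.
apply/andP; split.
  have : 2 * ((x + 1) / x - 1) * x <= y * ((x + 1) / x + 1) * x by rewrite ler_pM2r.
  have -> : 2 * ((x + 1) / x - 1) * x = 2 by field; rewrite gt_eqF.
  have -> : y * ((x + 1) / x + 1) * x = y * (2 * x + 1) by field; rewrite gt_eqF.
  by move=> ?; lra.
have : (x + 2^-1) * (2 * y) <= (x + 2^-1) * ((x + 1) / x - ((x + 1) / x)^-1).
  by rewrite ler_wpM2l// addr_ge0// ltW.
have -> : (x + 2^-1) * ((x + 1) / x - ((x + 1) / x)^-1) =
   2 + 2^-1 * (x^-1 - (x + 1)^-1) by field; rewrite !gt_eqF.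
lra.
Qed.

(** Monotone convergence: the telescoping bounds on the decrements keep the sequence above
    [stirl 1 - 1/4]. The index is shifted because [stirl_step] starts at 1. *)
Lemma cvg_stirl : exists l : R, stirl k @[k --> \oo] --> l.
Proof.
have dec : nonincreasing_seq (fun k => stirl k.+1).
  apply/nonincreasing_seqP => k; rewrite -subr_ge0.
  by have /andP[] := @stirl_step k.+1 (ltn0Sn _).
have bnd k : stirl 1 - 4^-1 * (1 - k.+1%:R^-1) <= stirl k.+1.
  elim: k => [|k IH]; first by rewrite invr1 subrr mulr0 subr0.
  have /andP[_] := @stirl_step k.+1 (ltn0Sn _).
  move: (k.+1%:R^-1) (k.+2%:R^-1) (stirl k.+1) (stirl k.+2) IH => a b c d.
  lra.
exists (limn (fun k => stirl k.+1)).
rewrite -(cvg_shiftn 1); under eq_fun do rewrite addn1.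
apply: nonincreasing_is_cvgn => //; exists (stirl 1 - 4^-1) => _ [k _ <-].
rewrite (le_trans _ (bnd k))//.
have : 0 <= (k.+1%:R : R)^-1 by rewrite invr_ge0.
by move: (k.+1%:R^-1) => a; lra.
Qed.

End Stirling.

(** * The multiplication formula for Gauss's products of finite order, and the value of Gamma at
    1/2 *)

Section Multiplication.
Context {R : realType}.
Local Notation C := R[i].
Local Notation mu := (@lebesgue_measure R).

(** Multiplied by [n], the numbers [z + j / n + k] become the single progression [n z + l] with
    [l = j + n k]. *)
Lemma prod_arith (n m : nat) (z : C) : (0 < n)%N ->
  (\prod_(0 <= j < n) \prod_(0 <= k < m) (z + j%:R / n%:R + k%:R)) *
    n%:R ^+ (n * m) = \prod_(0 <= l < n * m) (n%:R * z + l%:R).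
Proof.
move=> n0; have nC : (n%:R : C) != 0 by rewrite pnatr_eq0 -lt0n.
elim: m => [|m IH].
  rewrite muln0 expr0 mulr1 [RHS]big_geq//.
  by rewrite big1// => j _; rewrite big_geq.
rewrite mulnS addnC [RHS](@big_cat_nat _ _ _ (n * m))/= ?leq_addr//.
have -> : \prod_(n * m <= i < n * m + n) (n%:R * z + i%:R) =
    \prod_(0 <= j < n) (n%:R * z + (j + n * m)%:R).
  by rewrite -{1}[(n * m)%N]add0n (addnC (n * m)%N n) big_addn addnK.
rewrite -IH exprD.
under eq_bigr do rewrite big_nat_recr//=.
rewrite big_split/= mulrACA; congr (_ * _).
rewrite -[in n%:R ^+ n](subn0 n) -prodr_const_nat -big_split/=.
apply: eq_bigr => j _.
by rewrite subn0 natrD natrM; field.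
Qed.

Lemma expR_stirl (k : nat) :
  expR (stirl k) = k`!%:R * expR (k%:R - (k%:R + 2^-1) * ln k%:R) :> R.
Proof.
have f0 : 0 < (k`!%:R : R) by rewrite ltr0n fact_gt0.
rewrite -[X in X * _](@lnK R) ?posrE// -expRD; congr expR.
by rewrite /stirl; ring.
Qed.

(** Comparing [(n m)!] with [m! ^ n] through [stirl] leaves powers of [n] and [m] and the convergent
    factor [exp (stirl (n m) - n stirl m)], from which the constant of the multiplication formula
    arises. *)
Lemma stirl_ratio (n m : nat) : (0 < n)%N -> (0 < m)%N ->
  expR (stirl (n * m) - n%:R * stirl m) / Num.sqrt n%:R * m`!%:R ^+ n *
    n%:R ^+ (n * m.+1) * expR (ln m%:R * (2^-1 * (n%:R - 1))) =
  (n * m)`!%:R * (n%:R * m%:R) ^+ n.-1 :> R.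
Proof.
move=> n0 m0; have nR : 0 < (n%:R : R) by rewrite ltr0n.
have mR : 0 < (m%:R : R) by rewrite ltr0n.
have f0 : 0 < (m`!%:R : R) by rewrite ltr0n fact_gt0.
have eN : n%:R ^+ (n * m.+1) = expR (n%:R * (m%:R + 1) * ln n%:R) :> R.
  by rewrite -{1}[n%:R](@lnK R) ?posrE// -expRM_natl natrM -natr1.
have eS : (Num.sqrt n%:R)^-1 = expR (- (2^-1 * ln n%:R)) :> R.
  rewrite expRN; congr (_^-1).
  apply: (@pexpIrn R 2); rewrite ?nnegrE ?sqrtr_ge0 ?expR_ge0//.
  rewrite sqr_sqrtr ?ltW// -expRM_natl mulrA mulfV ?mul1r// lnK//.
have eP : (n%:R * m%:R) ^+ n.-1 = expR ((n%:R - 1) * (ln n%:R + ln m%:R)) :> R.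
  rewrite -lnM ?posrE// -[X in X ^+ _](@lnK R) ?posrE ?mulr_gt0//.
  have -> : n%:R - 1 = n.-1%:R :> R by rewrite -subn1 natrB.
  by rewrite -expRM_natl.
rewrite expRD expRN expRM_natl !expR_stirl exprMn -expRM_natl natrM lnM ?posrE//.
rewrite eN eS eP.
rewrite invfM -expRN.
have -> : forall a b c d e f g : R, a * b * (c^-1 * d) * e * c * f * g =
   a * (b * d * e * f * g) * (c^-1 * c) by move=> *; ring.
rewrite mulVf ?expf_neq0 ?gt_eqF// mulr1 -!expRD; congr (_ * expR _).
by field.
Qed.

Lemma sum_nat_half (n : nat) : \sum_(0 <= j < n) (j%:R : C) = 2^-1 * (n%:R * (n%:R - 1)).
Proof.
elim: n => [|n IH]; first by rewrite big_geq// mul0r mulr0.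
by rewrite big_nat_recr//= IH -[n.+1%:R]natr1; field.
Qed.

Lemma rpowc_sum (x : R) (f : nat -> C) (n : nat) :
  \prod_(0 <= j < n) rpowc x (f j) = rpowc x (\sum_(0 <= j < n) f j).
Proof.
elim: n => [|n IH]; first by rewrite !big_geq// rpowc0.
by rewrite !big_nat_recr//= IH rpowcD.
Qed.

(** Of the [n m + n] factors of the merged progression, the first [n m + 1] form Gauss's product of
    order [n m]; the other [n - 1], each divided by [n m], are the factors that tend to 1. *)
Lemma gaussq_prod (n m : nat) (z : C) : (0 < n)%N -> (0 < m)%N ->
  \prod_(0 <= j < n) gaussq m (z + j%:R / n%:R) =
  (expR (stirl (n * m) - n%:R * stirl m) / Num.sqrt n%:R)%:C *
  rpowc n%:R (n%:R * z) *
  (\prod_(1 <= l < n) (1 + (n%:R * z + l%:R) * (n%:R^-1 * m%:R^-1)%:C)) *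
  gaussq (n * m) (n%:R * z).
Proof.
move=> n0 m0.
have nR : 0 < (n%:R : R) by rewrite ltr0n.
have mR : 0 < (m%:R : R) by rewrite ltr0n.
have nC : (n%:R : C) != 0 by rewrite pnatr_eq0 -lt0n.
have mC : (m%:R : C) != 0 by rewrite pnatr_eq0 -lt0n.
have fC k : (k`!%:R : C) != 0 by rewrite pnatr_eq0 -lt0n fact_gt0.
rewrite /gaussq prodf_div big_split/= prodr_const_nat subn0 rpowc_sum.
have -> : \sum_(0 <= j < n) (z + j%:R / n%:R) = n%:R * z + (2^-1 * (n%:R - 1))%:C.
  rewrite big_split/= sumr_const_nat subn0 -mulr_suml sum_nat_half.
  rewrite [n%:R * z]mulr_natl; congr (_ + _).
  rewrite rmorphM rmorphB /= fmorphV !rmorph_nat rmorph1.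
  by field.
have e1 : (n * m.+1 = n * m + n)%N by rewrite mulnS addnC.
have := prod_arith m.+1 z n0.
rewrite [in X in _ = X -> _]e1.
rewrite [X in _ = X -> _](@big_cat_nat _ _ _ (n * m).+1)//=; last first.
  by rewrite -addn1 leq_add2l.
have -> : \prod_((n * m).+1 <= i < n * m + n) (n%:R * z + i%:R) =
    (n%:R * m%:R) ^+ n.-1 *
    \prod_(1 <= l < n) (1 + (n%:R * z + l%:R) * (n%:R^-1 * m%:R^-1)%:C).
  rewrite -{1}[(n * m).+1]add1n (addnC (n * m)%N n) big_addn addnK.
  rewrite -subn1 -prodr_const_nat -big_split/=; apply: eq_bigr => l _.
  by rewrite rmorphM /= !fmorphV !rmorph_nat natrD natrM; field; rewrite nC mC.
move=> H.
have {H} -> : \prod_(0 <= i < n) \prod_(0 <= k < m.+1) (z + i%:R / n%:R + k%:R) =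
  (\prod_(0 <= i < (n * m).+1) (n%:R * z + i%:R) *
    ((n%:R * m%:R) ^+ n.-1 *
     \prod_(1 <= l < n) (1 + (n%:R * z + l%:R) * (n%:R^-1 * m%:R^-1)%:C))) /
  n%:R ^+ (n * m.+1).
  by rewrite -H mulfK// expf_neq0.
rewrite natrM rpowcMl// rpowcD rpowcr.
have := congr1 (fun x => x%:C) (stirl_ratio n0 m0).
rewrite /= !rmorphM !rmorphXn /= !rmorphM /= !rmorph_nat => E.
set P1 := \prod_(0 <= i < _) _; set P2 := \prod_(1 <= l < n) _.
set A := (expR (stirl _ - _))%:C in E *.
set S := ((Num.sqrt n%:R)^-1)%:C in E *.
set B := (expR (ln _ * _))%:C in E *.
have B0 : B != 0 by rewrite -normc_eq0 normc_real normr_eq0 expR_eq0.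
have -> : P1 * ((n%:R * m%:R) ^+ n.-1 * P2) / n%:R ^+ (n * m.+1) =
   ((n * m)`!%:R * (n%:R * m%:R) ^+ n.-1) * P1 * P2 / n%:R ^+ (n * m.+1) / (n * m)`!%:R.
  by field; rewrite fC expf_neq0.
rewrite -E.
field; rewrite ?fC ?expf_neq0 ?fC ?nC ?rpowc_neq0 ?B0 //=.
by rewrite andbT -normc_eq0 normc_real normr_eq0 sqrtr_eq0 -ltNge.
Qed.

(** The substitution [t = exp (x / 2)] turns the Gaussian integral over the half-line into half of
    Euler's integral at 1/2. *)
Lemma eulerG_half : eulerG (2^-1 : R) = Num.sqrt pi.
Proof.
pose F (x : R) := expR (2^-1 * x).
have H : (\int[mu]_(x in `]0%R, +oo[) (gauss_fun x)%:E =
    \int[mu]_x (gauss_fun (F x) * (2^-1 * F x))%:E)%E.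
  apply: ge0_substitution.
  - by move=> x y xy; rewrite ltr_expR ltr_pM2l.
  - by move=> x; exact: is_derive_expRM.
  - move=> x; apply: cvgM; first exact: cvg_cst.
    exact: (is_derive_continuous (is_derive_expRM 2^-1)).
  - by move=> x; rewrite mulr_ge0 ?expR_ge0.
  - apply/seteqP; split => x /=; rewrite in_itv/= andbT.
      move=> x0; exists (Num.bound `|2 * ln x|) => //=; rewrite in_itv/=.
      have := archi_boundP (normr_ge0 (2 * ln x)) => /ltW; rewrite ler_norml.
      move=> /andP[h1 h2]; rewrite /F -{2 3}[x]lnK ?posrE// !ler_expR.
      by apply/andP; split; lra.
    move=> [k _ /=]; rewrite in_itv/= => /andP[h _].
    by rewrite (lt_le_trans _ h)// expR_gt0.
  - by move=> x _; exact: continuous_gauss_fun.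
  - by move=> x _; exact: gauss_fun_ge0.
have := @integral0y_gauss R; rewrite -integral_itv_obnd_cbnd; last first.
  apply/measurable_EFinP; apply: measurable_funTS; exact: measurable_gauss_fun.
rewrite H => /(congr1 fine)/= E.
have E2 : \int[mu]_x (gauss_fun (F x) * (2^-1 * F x)) = Num.sqrt pi / 2 by exact: E.
have : \int[mu]_x (2^-1 * eulerk 2^-1 x) = Num.sqrt pi / 2.
  rewrite -E2; apply: eq_Rintegral => x _; rewrite /gauss_fun /F /eulerk.
  rewrite [RHS]mulrCA -expRD; congr (_ * expR _); rewrite -expRM_natl mulrA.
  by rewrite mulfV// mul1r addrC.
rewrite RintegralZl//; last by apply: integrable_eulerk.
by rewrite -/(eulerG _); lra.
Qed.

End Multiplication.

(** * Gauss's multiplication formula and the constant of Stirling's formula *)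

Section MultiplicationFormula.
Context {R : realType}.
Local Notation C := R[i].

(** The limit [l] of [stirl] stays a parameter, because an instance of this very formula determines
    it. *)
Lemma rGamma_mult_lambda (l : R) (n : nat) (z : C) :
  stirl k @[k --> \oo] --> l -> (0 < n)%N ->
  \prod_(0 <= j < n) rGamma (z + j%:R / n%:R) =
  (expR (l - n%:R * l) / Num.sqrt n%:R)%:C * rpowc n%:R (n%:R * z) *
    rGamma (n%:R * z).
Proof.
move=> hl n0.
have nm : (n * m)%N @[m --> \oo] --> \oo.
  apply/cvgnyPge => A; exists A => //= m Am.
  by rewrite (leq_trans Am)// leq_pmull.
have H1 : ccvg (fun m => \prod_(0 <= j < n) gaussq m (z + j%:R / n%:R))
    (\prod_(0 <= j < n) rGamma (z + j%:R / n%:R)).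
  by apply: ccvg_prod => j _; exact: ccvg_gaussq.
apply: (ccvg_unique H1).
have E1 : ccvg (fun m => (expR (stirl (n * m) - n%:R * stirl m) / Num.sqrt n%:R)%:C)
    (expR (l - n%:R * l) / Num.sqrt n%:R)%:C.
  apply: ccvg_real; apply: cvgM; last exact: cvg_cst.
  apply: continuous_cvg; first exact: continuous_expR.
  apply: cvgB; first exact: (cvg_comp _ _ nm hl).
  by apply: cvgM; [exact: cvg_cst|exact: hl].
have E2 : ccvg (fun m => \prod_(1 <= k < n) (1 + (n%:R * z + k%:R) * (n%:R^-1 * m%:R^-1)%:C)) 1.
  have : ccvg (fun m => \prod_(0 <= k < n.-1)
      (1 + (n%:R * z + k.+1%:R) * (n%:R^-1 * m%:R^-1)%:C))
      (\prod_(0 <= k < n.-1) (1 + (n%:R * z + k.+1%:R) * (n%:R^-1 * 0)%:C)).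
    apply: ccvg_prod => j _; apply: ccvgD; first exact: ccvg_cst.
    apply: ccvgM; first exact: ccvg_cst.
    apply: ccvg_real; apply: cvgM; first exact: cvg_cst.
    exact: cvg_inv_nat.
  rewrite [X in ccvg _ X]big1; last by move=> k _; rewrite !mulr0 addr0.
  by apply: eq_ccvg => m; rewrite [RHS]big_add1.
have E3 : ccvg (fun m => gaussq (n * m) (n%:R * z)) (rGamma (n%:R * z)).
  have [h1 h2] := ccvg_gaussq (n%:R * z).
  split; first exact: (cvg_comp _ _ nm h1).
  exact: (cvg_comp _ _ nm h2).
have := ccvgM (ccvgM (ccvgM E1 (ccvg_cst (rpowc n%:R (n%:R * z)))) E2) E3.
rewrite mulr1; apply: near_ccvg; near=> m; rewrite gaussq_prod//.
by near: m; exists 1%N.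
Unshelve. all: by end_near. Qed.

Lemma rGamma1 : rGamma (1 : C) = 1.
Proof.
by have := @rGamma_real R 1 ltr01; rewrite eulerG1 invr1.
Qed.

Lemma stirl_limit : stirl k @[k --> \oo] --> 2^-1 * ln (2 * pi : R).
Proof.
have [l hl] := @cvg_stirl R.
suff <- : l = 2^-1 * ln (2 * pi) by [].
have := @rGamma_mult_lambda l 2 2^-1 hl isT.
have v2 : (2^-1 : C) = (2^-1)%:C by rewrite fmorphV /= rmorph_nat.
have C2 : (2 : C) != 0 by rewrite pnatr_eq0.
rewrite 2?big_nat_recr//= big_geq// mul1r mul0r addr0 mul1r.
have -> : 2^-1 + 2^-1 = 1 :> C by field.
rewrite mulfV// rGamma1 !mulr1 rpowc1// v2 rGamma_real ?invr_gt0// eulerG_half.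
rewrite -rmorphM => /complexI H.
have s2 : 0 < Num.sqrt (2 : R) by rewrite sqrtr_gt0.
have ss : Num.sqrt 2 * Num.sqrt 2 = 2 :> R by rewrite -expr2 sqr_sqrtr.
have {}H : (Num.sqrt pi)^-1 = expR (- l) * Num.sqrt 2 :> R.
  have s2' : (Num.sqrt 2)^-1 * 2 = Num.sqrt 2 :> R.
    by apply: (mulfI (lt0r_neq0 s2)); rewrite mulVKf ?gt_eqF.
  by rewrite H -mulrA s2'; congr (expR _ * _); ring.
apply: (@expR_inj R).
have -> : expR l = Num.sqrt 2 * Num.sqrt pi.
  rewrite -[Num.sqrt pi]invrK H expRN invfM invrK mulrCA mulfV ?mulr1//.
rewrite -sqrtrM// -[2 * pi as X in Num.sqrt X](@lnK R) ?posrE ?mulr_gt0 ?pi_gt0//.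
apply: (@pexpIrn R 2); rewrite ?nnegrE ?sqrtr_ge0 ?expR_ge0//.
by rewrite sqr_sqrtr ?expR_ge0// -expRM_natl mulrA mulfV ?mul1r.
Qed.

(* Gauss's multiplication formula, inverted so that it has no poles. *)
Lemma rGamma_mult (n : nat) (z : C) : (0 < n)%N ->
  \prod_(0 <= j < n) rGamma (z + j%:R / n%:R) =
  rpowc (2 * pi) (2^-1 * (1 - n%:R)) * rpowc n%:R (n%:R * z - 2^-1) *
    rGamma (n%:R * z).
Proof.
move=> n0; rewrite (rGamma_mult_lambda z stirl_limit n0).
have nR : 0 < (n%:R : R) by rewrite ltr0n.
congr (_ * _); rewrite rpowcD [RHS]mulrCA mulrC; congr (_ * _).
have v2 : (2^-1 : C) = (2^-1)%:C by rewrite fmorphV /= rmorph_nat.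
have -> : 2^-1 * (1 - n%:R) = (2^-1 * (1 - n%:R))%:C :> C.
  by rewrite v2 natC rmorphM rmorphB.
rewrite v2 -rmorphN !rpowcr -rmorphM; congr (_%:C); congr (expR _ * _).
  by ring.
rewrite mulrN expRN; congr (_^-1).
apply: (@pexpIrn R 2); rewrite ?nnegrE ?sqrtr_ge0 ?expR_ge0//.
by rewrite sqr_sqrtr ?ltW// -expRM_natl mulrCA mulfV// mulr1 lnK.
Qed.

(** The factor [j = 0] is the one kept on the left. The others have [0 < Re (s + j / n)], so that
    Euler's integral inverts them; the bound on [Re s] is the one that [j = 1] imposes. *)
Lemma rGamma_mult_ceulerG (n : nat) (s : C) : (0 < n)%N -> - n%:R^-1 < Re s ->
  rGamma s = rpowc (2 * pi) (2^-1 * (1 - n%:R)) * rpowc n%:R (n%:R * s - 2^-1) *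
    (rGamma (n%:R * s) * \prod_(1 <= j < n) ceulerG (s + j%:R / n%:R)).
Proof.
move=> n0 sn; rewrite mulrA -rGamma_mult// big_ltn//= mul0r addr0 -mulrA.
rewrite -big_split/= big_nat_cond big1 ?mulr1// => j /andP[/andP[j1 jn] _].
have h : 0 < Re (s + j%:R / n%:R).
  rewrite ReD !natC -fmorphV -rmorphM /=.
  have : n%:R^-1 <= j%:R / n%:R :> R by rewrite ler_peMl ?invr_ge0// ler1n.
  lra.
by have [-> h2] := rGamma_ceulerG h; rewrite mulVf.
Qed.

Lemma big_nat_pred_recr (F : nat -> C) (n : nat) : (0 < n)%N ->
  \prod_(0 <= j < n) F j = (\prod_(0 <= j < n.-1) F j) * F n.-1.
Proof. by case: n => // n _; rewrite big_nat_recr. Qed.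

(** For nonzero [w] this is the preceding identity divided by [w]. At [w = 0], which occurs in the
    formula for [b = 1] at [k = 0], both sides of that identity vanish; the multiplication formula
    at [1 / n], where the factors move up by one place and the last one is 1, replaces it. *)
Lemma rGamma_mult_ceulerG_succ (n : nat) (w : C) : (0 < n)%N -> - n%:R^-1 < Re w ->
  rGamma (w + 1) = rpowc (2 * pi) (2^-1 * (1 - n%:R)) * rpowc n%:R (n%:R * w + 2^-1) *
    (rGamma (n%:R * w + 1) * \prod_(1 <= j < n) ceulerG (w + j%:R / n%:R)).
Proof.
move=> n0 wn; have nR : 0 < (n%:R : R) by rewrite ltr0n.
have nC : (n%:R : C) != 0 by rewrite pnatr_eq0 -lt0n.
have [->|w0] := eqVneq w 0.
  rewrite add0r mulr0 add0r add0r rGamma1 mul1r.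
  have := rGamma_mult (n%:R^-1) n0; rewrite mulfV// rGamma1 mulr1.
  have -> : 1 - 2^-1 = 2^-1 :> C by field.
  move=> <-; rewrite big_nat_pred_recr//=.
  have -> : n%:R^-1 + n.-1%:R / n%:R = 1 :> C.
    by rewrite -subn1 natrB//; field.
  rewrite rGamma1 mulr1 [X in _ = _ * X]big_add1/=.
  rewrite -big_split/= big1// => j _; rewrite add0r.
  have -> : n%:R^-1 + j%:R / n%:R = j.+1%:R / n%:R :> C.
    by rewrite -natr1; field.
  have h : 0 < Re (j.+1%:R / n%:R : C).
    by rewrite !natC -fmorphV -rmorphM /= divr_gt0// ltr0n.
  by have [-> h2] := rGamma_ceulerG h; rewrite mulVf.
apply: (mulfI w0); rewrite -rGamma_succ (rGamma_mult_ceulerG n0 wn) rGamma_succ.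
have -> : n%:R * w + 2^-1 = n%:R * w - 2^-1 + 1 by field.
rewrite (rpowcD _ (n%:R * w - 2^-1) 1) rpowc1// -natC.
by ring.
Qed.

End MultiplicationFormula.

(** * Fourier inversion *)

Section FourierTransform.
Context {R : realType}.
Local Notation C := R[i].
Local Notation mu := (@lebesgue_measure R).
Local Notation T := (measurableTypeR R).

Definition ft (f : T -> C) (t : R) : C :=
  cintegral setT (fun x => f x * cis (t * x)).

Lemma cmeas_ft_kernel (f : T -> C) t : cmeas setT f ->
  cmeas setT (fun x : T => f x * cis (t * x)).
Proof.
move=> mf; apply: cmeasM => //; apply: cmeas_cis.
by apply: measurable_funM => //; exact: measurable_cst.
Qed.

Lemma cintegrable_ft (f : T -> C) t : cintegrable setT f ->
  cintegrable setT (fun x => f x * cis (t * x)).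
Proof.
move=> fi; apply: (cintegrable_le measurableT _ (integrable_normc measurableT fi)).
  by apply: cmeas_ft_kernel; exact: cintegrable_cmeas.
by move=> x _; rewrite Normc.normcM normc_cis mulr1.
Qed.

Lemma continuous_ccvg (u : nat -> R) (l : R) : u k @[k --> \oo] --> l ->
  ccvg (fun k => cis (u k)) (cis l).
Proof.
move=> ul; split; rewrite ?ReIm_cis.
  under eq_fun do rewrite ReIm_cis.
  by apply: continuous_cvg => //; exact: continuous_cos.
under eq_fun do rewrite ReIm_cis.
by apply: continuous_cvg => //; exact: continuous_sin.
Qed.

Lemma ft_seq (f : T -> C) (u : nat -> R) (l : R) : cintegrable setT f ->
  u k @[k --> \oo] --> l -> ccvg (fun k => ft f (u k)) (ft f l).
Proof.
move=> fi ul; have mf := cintegrable_cmeas fi.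
have [||||_] := @cdominated R setT (fun k x => f x * cis (u k * x))
  (fun x => f x * cis (l * x)) (fun x => normc (f x)) measurableT.
- by move=> k; exact: cmeas_ft_kernel.
- move=> x _; apply: ccvgM; first exact: ccvg_cst.
  by apply: continuous_ccvg; apply: cvgM => //; exact: cvg_cst.
- exact: integrable_normc.
- by move=> k x _; rewrite Normc.normcM normc_cis mulr1.
by [].
Qed.

Lemma continuous_ft (f : T -> C) : cintegrable setT f ->
  continuous (fun t : R => Re (ft f t)) /\ continuous (fun t : R => Im (ft f t)).
Proof.
move=> fi; split => a; apply/(@cvg_nbhsP _ R^o) => w wa;
by have [h1 h2] := ft_seq fi wa.
Qed.

Lemma cmeas_ft (f : T -> C) : cintegrable setT f -> cmeas setT (ft f : T -> C).
Proof.
move=> fi; have [c1 c2] := continuous_ft fi.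
by split; exact: continuous_measurable.
Qed.

Lemma ceulerG_ft (a t : R) : ceulerG (a +i* t) = ft (fun x => (eulerk a x)%:C) t.
Proof. by apply: eq_cintegral => x _; rewrite ceulerkE. Qed.

Lemma cintegrable_eulerk (a : R) : 0 < a ->
  cintegrable setT (fun x : T => (eulerk a x)%:C).
Proof. by move=> a0; apply: cintegrable_real; exact: integrable_eulerk. Qed.

Lemma cmeas_ceulerG_line (a : R) : 0 < a ->
  cmeas setT (fun t : T => ceulerG (a +i* t)).
Proof.
move=> a0; under eq_fun do rewrite ceulerG_ft.
by apply: cmeas_ft; exact: cintegrable_eulerk.
Qed.

(** Two steps of the recurrence divide the bounded quantity [ceulerG (s + 2)] by [s (s + 1)];
    quadratic decay is enough for integrability along the line. *)
Lemma normc_ceulerG_line (a t : R) : 0 < a ->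
  normc (ceulerG (a +i* t)) <= 2 * eulerG (a + 2) / Num.min (a ^+ 2) 1 * (1 + t ^+ 2)^-1.
Proof.
move=> a0; set s := a +i* t.
have s0 : 0 < Re s by [].
have s1 : 0 < Re (s + 1) by rewrite ReD /= addr_gt0.
have s2 : Re (s + 2) = a + 2 by rewrite ReD Re_nat.
have E : ceulerG (s + 2) = (s + 1) * s * ceulerG s.
  by rewrite -mulrA -ceulerG_succ// -ceulerG_succ// -addrA.
have H : normc (s + 1) * normc s * normc (ceulerG s) <= 2 * eulerG (a + 2).
  by rewrite -!Normc.normcM -E -s2 normc_ceulerG// s2 addr_gt0.
set m := Num.min (a ^+ 2) 1.
have m0 : 0 < m by rewrite lt_min exprn_gt0// ltr01.
have t0 : 0 < 1 + t ^+ 2 by rewrite ltr_pwDl// sqr_ge0.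
rewrite ler_pdivlMr// ler_pdivlMr//.
have -> : normc (ceulerG s) * (1 + t ^+ 2) * m = (1 + t ^+ 2) * m * normc (ceulerG s) by ring.
apply: le_trans H; rewrite ler_wpM2r ?normc_ge0//.
have n1 : normc s <= normc (s + 1).
  rewrite !normcE; apply: ler_wsqrtr; rewrite /s /= addr0 lerD2r.
  by rewrite ler_pXn2r ?nnegrE// ?lerDl// ?addr_ge0// ltW.
apply: (@le_trans _ _ (normc s * normc s)); last by rewrite ler_wpM2r ?normc_ge0.
rewrite -expr2 normc_sqr /= mulrDl mul1r lerD//.
  by rewrite ge_min lexx.
by rewrite ler_piMr ?sqr_ge0// ge_min lexx orbT.
Qed.

Lemma integrable_ZoneDsqrV (K : R) :
  mu.-integrable setT (fun t => (K * (1 + t ^+ 2)^-1)%:E).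
Proof.
have := integrableZl measurableT K integrable_oneDsqrV.
by apply: eq_integrable => // x _; rewrite EFinM.
Qed.

Lemma cintegrable_ceulerG_line (a : R) : 0 < a ->
  cintegrable setT (fun t : T => ceulerG (a +i* t)).
Proof.
move=> a0; apply: (cintegrable_le measurableT _ (integrable_ZoneDsqrV _)).
  exact: cmeas_ceulerG_line.
by move=> t _; exact: normc_ceulerG_line.
Qed.

Lemma bigcup_affine (F : R -> R) (e y : R) : 0 < e -> (forall r, F r = y + e * r) ->
  [set: R] = \bigcup_(k : nat) `[F (- k%:R), F k%:R]%classic.
Proof.
move=> e0 FE; apply/seteqP; split => // x _.
have [k _ /=] : (\bigcup_(k : nat) `[- (k%:R : R), k%:R]%classic) ((x - y) / e).
  by rewrite bigcup_symitv.
rewrite in_itv/= ler_pdivlMr// ler_pdivrMr// => /andP[h1 h2].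
by exists k => //=; rewrite in_itv/= !FE; apply/andP; split; lra.
Qed.

Lemma integral_affine (G : R -> R) (e y : R) : 0 < e -> continuous G ->
  (\int[mu]_x (G x)%:E = \int[mu]_x (G (y + e * x) * e)%:E)%E.
Proof.
move=> e0 contG; apply: (@integral_substitution R (fun r => y + e * r) (fun=> e)) => //.
- by move=> r r' rr; rewrite ltrD2l ltr_pM2l.
- move=> x; apply: is_derive_eq; rewrite /GRing.scale/= ?mulr1 ?addr0 ?add0r ?mul1r//.
- exact: cst_continuous.
- by move=> _; exact: ltW.
- exact: (@bigcup_affine (fun r => y + e * r) e y e0).
- by move=> x _; exact: contG.
Qed.

Lemma measurable_snd2 : measurable_fun setT (snd : T * T -> T).
Proof. exact: measurable_snd. Qed.

(** Once Gamma is written as an integral, Fubini's theorem lets the Abel kernel be transformed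
    first, into a Poisson kernel centred at [y]; the change of variable [z = y + e r] moves all
    dependence on [e] into the argument of [eulerk]. *)
Lemma ft_inversion_abel (a e y : R) : 0 < a -> 0 < e ->
  cintegral setT (fun t : T => (expR (- e * `|t|))%:C *
    (ceulerG (a +i* t) * cis (- y * t))) =
  (\int[mu]_r (eulerk a (y + e * r) * (2 * (1 + r ^+ 2)^-1)))%:C.
Proof.
move=> a0 e0.
pose g (x z : R) : C := (expR (- e * `|x|))%:C *
  ((eulerk a z)%:C * cis (x * z) * cis (- y * x)).
pose f (p : T * T) : C := g p.1 p.2.
have mf : cmeas setT f.
  apply: cmeasM.
    apply: cmeas_real; apply: (measurableT_comp (f := fun t : T => expR (- e * `|t|))) => //.
    exact: measurable_expabs.
  apply: cmeasM; first apply: cmeasM.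
  - apply: cmeas_real; apply: (measurableT_comp (f := eulerk a : T -> R)) => //.
    exact: measurable_eulerk.
  - apply: cmeas_cis; apply: measurable_funM => //.
  - apply: cmeas_cis; apply: measurable_funM => //; exact: measurable_cst.
have nf x z : normc (f (x, z)) = expR (- e * `|x|) * eulerk a z.
  rewrite /f /g !Normc.normcM !normc_cis !mulr1 !normc_real.
  by rewrite /= (ger0_norm (expR_ge0 _)) (ger0_norm (eulerk_ge0 _ _)).
have i0 x : cintegrable setT (fun z : T => (eulerk a z)%:C * cis (x * z)).
  by apply: cintegrable_ft; exact: cintegrable_eulerk.
have gE x : g x = fun z => ((expR (- e * `|x|))%:C * cis (- y * x)) *
    ((eulerk a z)%:C * cis (x * z)).
  by apply/funext => z; rewrite /g; ring.
have i1 x : cintegrable setT (fun z : T => f (x, z)).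
  change (cintegrable setT (g x)); rewrite gE.
  by apply: cintegrableZ => //; exact: i0.
have fE z : (fun x : T => f (x, z)) = (fun x : T => (eulerk a z)%:C *
    ((expR (- e * `|x|))%:C * cis ((z - y) * x))).
  apply/funext => x; change (f (x, z)) with (g x z); rewrite /g mulrBl -mulNr cisD (mulrC z x); ring.
have i2 z : cintegrable setT (fun x : T => f (x, z)).
  by rewrite fE; apply: cintegrableZ => //; exact: cintegrable_abel.
have fin : (\int[mu]_x \int[mu]_z (normc (f (x, z)))%:E < +oo)%E.
  have inner x : (\int[mu]_z (normc (f (x, z)))%:E =
      (eulerG a)%:E * (expR (- e * `|x|))%:E)%E.
    rewrite -integral_eulerk// muleC -ge0_integralZl_EFin ?expR_ge0//.
    - by apply: eq_integral => z _; rewrite nf EFinM.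
    - by move=> z _; rewrite lee_fin eulerk_ge0.
    - by apply/measurable_EFinP; exact: measurable_eulerk.
  under eq_integral do rewrite inner.
  rewrite ge0_integralZl_EFin ?eulerG_ge0//.
  - by rewrite integral_expabs// -EFinM ltry.
  - by apply/measurable_EFinP; exact: measurable_expabs.
have [_ E] := cFubini mf fin i1 i2; clear fin mf nf i1 i2.
transitivity (cintegral setT (fun x : T => cintegral setT (fun z : T => f (x, z)))).
  congr (cintegral setT _); apply/funext => x.
  change (fun z : T => f (x, z)) with (g x).
  by rewrite gE (cintegralZ _ measurableT (i0 x)) ceulerG_ft /ft; ring.
rewrite E {E i0 gE}.
have -> : (fun z : T => cintegral setT (fun x : T => f (x, z))) =
    (fun z : T => (eulerk a z * (2 * e / (e ^+ 2 + (z - y) ^+ 2)))%:C).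
  apply/funext => z; rewrite fE.
  rewrite (cintegralZ _ measurableT (cintegrable_abel (z - y) e0)).
  rewrite (cintegral_abel _ e0); symmetry.
  exact: (rmorphM (real_complex R)).
rewrite (cintegral_real (fun z => eulerk a z * (2 * e / (e ^+ 2 + (z - y) ^+ 2)))
  measurableT).
apply: (congr1 (real_complex R)); rewrite /Rintegral; apply: (congr1 fine).
rewrite (@integral_affine _ e y e0); last first.
  move=> z; apply: cvgM; first exact: continuous_eulerk.
  apply: cvgM; first exact: cvg_cst.
  have h : e ^+ 2 + (z - y) ^+ 2 != 0 by rewrite gt_eqF// ltr_pwDl ?sqr_ge0 ?exprn_gt0.
  apply: cvgV => //; apply: cvgD; first exact: cvg_cst.
  rewrite expr2; under eq_fun do rewrite expr2.
  by apply: cvgM; (apply: cvgB; [exact: cvg_id|exact: cvg_cst]).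
apply: eq_integral => r _; congr EFin; rewrite -mulrA; congr (_ * _).
have h : 1 + r ^+ 2 != 0 by rewrite gt_eqF// ltr_pwDl ?sqr_ge0.
have -> : e ^+ 2 + (y + e * r - y) ^+ 2 = e ^+ 2 * (1 + r ^+ 2) by ring.
by field; rewrite h gt_eqF.
Qed.

Lemma eulerk_bounded (a : R) : 0 < a ->
  forall x, eulerk a x <= expR ((a + 1) * ln (a + 1)).
Proof.
move=> a0 x; rewrite (le_trans (eulerk_le x a0))// ler_piMr ?expR_ge0//.
rewrite -expR0 ler_expR mulNr oppr_le0 mulr_ge0//.
by rewrite le_min (ltW a0) /=.
Qed.

(** Both sides of the regularised identity converge by dominated convergence, the left under
    [|Gamma|] on the line, the right because [eulerk] is bounded; [2 pi] is the mass of
    [2 / (1 + r^2)]. *)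
Lemma ft_inversion (a y : R) : 0 < a ->
  ft (fun t => ceulerG (a +i* t)) (- y) = (2 * pi * eulerk a y)%:C.
Proof.
move=> a0.
pose e (k : nat) : R := k.+1%:R^-1.
have e0 k : 0 < e k by rewrite invr_gt0 ltr0n.
have el : e k @[k --> \oo] --> 0.
  rewrite /e; have := @cvg_inv_nat R; rewrite -(cvg_shiftn 1).
  by under eq_fun do rewrite addn1.
have iG := cintegrable_ceulerG_line a0.
have [||||_ L1] := @cdominated R setT (fun k (t : T) =>
    (expR (- e k * `|t|))%:C * (ceulerG (a +i* t) * cis (- y * t)))
  (fun t : T => ceulerG (a +i* t) * cis (- y * t)) (fun t => normc (ceulerG (a +i* t)))
  measurableT.
- move=> k; apply: cmeasM; first by apply: cmeas_real; exact: measurable_expabs.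
  by apply: cmeas_ft_kernel; exact: cmeas_ceulerG_line.
- move=> t _; rewrite -[X in ccvg _ X]mul1r; apply: ccvgM; last exact: ccvg_cst.
  rewrite -[1]/(1%:C) -(@expR0 R); apply: ccvg_real.
  apply: continuous_cvg; first exact: continuous_expR.
  have : - e k * `|t| @[k --> \oo] --> - 0 * `|t|.
    by apply: cvgM; [exact: cvgN|exact: cvg_cst].
  by rewrite oppr0 mul0r.
- exact: integrable_normc.
- move=> k t _; rewrite !Normc.normcM normc_cis mulr1 normc_real.
  rewrite (ger0_norm (expR_ge0 _)) ler_piMl ?normc_ge0//.
  by rewrite -expR0 ler_expR mulNr oppr_le0 mulr_ge0// ltW.
apply: (ccvg_unique L1).
apply: (@eq_ccvg _ (fun k => (\int[mu]_r (eulerk a (y + e k * r) * (2 * (1 + r ^+ 2)^-1)))%:C)).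
  by move=> k; rewrite ft_inversion_abel.
apply: ccvg_real.
have [||||_ L2] := @Rdominated_cvg R setT
  (fun k r => eulerk a (y + e k * r) * (2 * (1 + r ^+ 2)^-1))
  (fun r => eulerk a y * (2 * (1 + r ^+ 2)^-1))
  (fun r => expR ((a + 1) * ln (a + 1)) * 2 * (1 + r ^+ 2)^-1) measurableT.
- move=> k; apply: measurable_funM.
    apply: continuous_measurable => r; apply: continuous_comp; last exact: continuous_eulerk.
    by apply: cvgD; [exact: cvg_cst|apply: cvgM; [exact: cvg_cst|exact: cvg_id]].
  have /integrableP[/measurable_EFinP] := integrable_ZoneDsqrV 2.
  by [].
- move=> r _; apply: cvgM; last exact: cvg_cst.
  apply: continuous_cvg; first exact: continuous_eulerk.
  have : y + e k * r @[k --> \oo] --> y + 0 * r.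
    by apply: cvgD; [exact: cvg_cst|apply: cvgM; [exact: el|exact: cvg_cst]].
  by rewrite mul0r addr0.
- exact: integrable_ZoneDsqrV.
- move=> k r _.
  have h : 0 <= 2 * (1 + r ^+ 2)^-1 by rewrite mulr_ge0// invr_ge0 addr_ge0 ?sqr_ge0.
  rewrite (ger0_norm (mulr_ge0 (eulerk_ge0 _ _) h)) -[leRHS]mulrA.
  exact: (ler_wpM2r h (eulerk_bounded a0 _)).
suff <- : \int[mu]_r (eulerk a y * (2 * (1 + r ^+ 2)^-1)) = 2 * pi * eulerk a y by [].
rewrite RintegralZl//; last exact: integrable_ZoneDsqrV.
rewrite mulrC RintegralZl//; last exact: integrable_oneDsqrV.
by rewrite /Rintegral integral_oneDsqrV.
Qed.

End FourierTransform.

(** * Laplace transforms and convolutions *)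

Section LaplacePairs.
Context {R : realType}.
Local Notation C := R[i].
Local Notation mu := (@lebesgue_measure R).
Local Notation T := (measurableTypeR R).

Definition ccontinuous (g : R -> C) : Prop :=
  continuous (fun x : R => Re (g x)) /\ continuous (fun x : R => Im (g x)).

Lemma ccontinuousM (f g : R -> C) : ccontinuous f -> ccontinuous g ->
  ccontinuous (fun x => f x * g x).
Proof.
move=> [f1 f2] [g1 g2]; split => x.
  under eq_fun do rewrite ReM.
  by apply: cvgB; apply: cvgM; [exact: f1|exact: g1|exact: f2|exact: g2].
under eq_fun do rewrite ImM.
by apply: cvgD; apply: cvgM; [exact: f1|exact: g2|exact: f2|exact: g1].
Qed.

Lemma ccontinuous_real (h : R -> R) : continuous h -> ccontinuous (fun x => (h x)%:C).
Proof. by move=> ch; split => //=; exact: cst_continuous. Qed.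

Lemma ccontinuous_cexp (w : C) : ccontinuous (fun x => cexp (w * x%:C)).
Proof.
have E x : cexp (w * x%:C) = (expR (Re w * x))%:C * cis (Im w * x).
  rewrite -cexp_real -cexpD; congr cexp.
  by apply: eqC; rewrite ?(ReD, ImD, ReM, ImM) /=; ring.
rewrite (_ : (fun x => _) = (fun x => (expR (Re w * x))%:C * cis (Im w * x))); last first.
  by apply/funext => x.
apply: ccontinuousM.
  by apply: ccontinuous_real; exact: (is_derive_continuous (is_derive_expRM (Re w))).
split => x; under eq_fun do rewrite ReIm_cis.
  exact: (is_derive_continuous (is_derive_cosM (Im w))).
exact: (is_derive_continuous (is_derive_sinM (Im w))).
Qed.

Lemma ccontinuous_cmeas (g : R -> C) : ccontinuous g -> cmeas setT (g : T -> C).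
Proof. by move=> [g1 g2]; split; exact: continuous_measurable. Qed.

Lemma cintegral_translate (g : R -> C) (y : R) : ccontinuous g ->
  cintegrable setT (g : T -> C) ->
  cintegrable setT (fun x : T => g (x - y)) /\
  cintegral setT (fun x : T => g (x - y)) = cintegral setT (g : T -> C).
Proof.
move=> [g1 g2] [i1 i2].
have tr (h : R -> R) : continuous h -> mu.-integrable setT (fun x => (h x)%:E) ->
    mu.-integrable setT (fun x => (h (x - y))%:E) /\
    \int[mu]_x h (x - y) = \int[mu]_x h x.
  move=> ch ih.
  have ch' : continuous (fun x => h (x - y)).
    move=> x; apply: continuous_comp; last exact: ch.
    by apply: cvgB; [exact: cvg_id|exact: cvg_cst].
  split; last first.
    rewrite /Rintegral (integral_affine y ltr01 ch').
    by congr fine; apply: eq_integral => x _; rewrite mulr1 mul1r addrAC subrr add0r.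
  have mh : measurable_fun setT (fun x : T => h (x - y)) by exact: continuous_measurable.
  apply/integrableP; split; first exact/measurable_EFinP.
  have := (integrableP _ _ _ ih).2.
  rewrite (@integral_affine _ (fun x => `|h (x - y)|) 1 y ltr01); last first.
    by move=> x; apply: continuous_comp; [exact: ch'|exact: norm_continuous].
  rewrite (_ : (\int[mu]_x `|(h x)%:E| = \int[mu]_x (`|h (y + 1 * x - y)%R|%R * 1)%:E)%E)//.
  by apply: eq_integral => x _; rewrite mulr1 mul1r addrAC subrr add0r.
have [a1 b1] := tr _ g1 i1; have [a2 b2] := tr _ g2 i2.
by split => //; rewrite /cintegral b1 b2.
Qed.

(** [M] is the two-sided Laplace transform of [k] on the half-plane [- A < Re w]. Nonnegativity and
    continuity are carried along because the convolution step uses them again. *)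
Definition laplace_pair (k : R -> R) (A : R) (M : C -> C) : Prop :=
  [/\ forall x, 0 <= k x, continuous k & forall w, - A < Re w ->
    cintegrable setT (fun x : T => cexp (w * x%:C) * (k x)%:C) /\
    cintegral setT (fun x : T => cexp (w * x%:C) * (k x)%:C) = M w].

Lemma laplace_pair_integrable k A M : 0 < A -> laplace_pair k A M ->
  mu.-integrable setT (fun x => (k x)%:E).
Proof.
move=> A0 [_ _ /(_ 0)]; rewrite /= oppr_lt0 => /(_ A0)[[i1 _] _].
by apply: eq_integrable i1 => // x _; rewrite mul0r cexp0 mul1r.
Qed.

Lemma laplace_pair_eulerk (b : R) : 0 < b ->
  laplace_pair (eulerk b) b (fun w => ceulerG (b%:C + w)).
Proof.
move=> b0; split; [exact: eulerk_ge0|exact: continuous_eulerk|move=> w wb].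
have -> : (fun x : T => cexp (w * x%:C) * (eulerk b x)%:C) = ceulerk (b%:C + w).
  by apply/funext => x; rewrite addrC ceulerkD ceulerk_real.
split => //; apply: cintegrable_ceulerk; rewrite ReD /=; lra.
Qed.

Lemma laplace_pair_le k A A' M : A' <= A -> laplace_pair k A M -> laplace_pair k A' M.
Proof.
move=> AA [k0 ck H]; split => // w wA; apply: H.
by rewrite (le_lt_trans _ wA)// lerN2.
Qed.

(** Since [exp (w x) = exp (w y) exp (w (x - y))], Fubini's theorem and translation invariance split
    the double integral. The bound [B] makes the convolution converge at every [x]; continuity of
    [k] is a hypothesis, which the application gets from a Fourier transform. *)
Lemma laplace_pair_conv (k1 k2 k : R -> R) (A B : R) (M1 M2 : C -> C) :
  0 < A -> laplace_pair k1 A M1 -> laplace_pair k2 A M2 ->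
  (forall x, k2 x <= B) -> continuous k ->
  (forall x, k x = \int[mu]_y (k1 y * k2 (x - y))) ->
  laplace_pair k A (fun w => M1 w * M2 w).
Proof.
move=> A0 L1 L2 k2B ck kE; have ik1 := laplace_pair_integrable A0 L1.
have [k10 ck1 H1] := L1; have [k20 ck2 H2] := L2.
split => [x||w wA].
- by rewrite kE; apply: Rintegral_ge0 => y _; rewrite mulr_ge0.
- exact: ck.
have [j1 e1] := H1 w wA; have [j2 e2] := H2 w wA.
pose c2 (u : R) := cexp (w * u%:C) * (k2 u)%:C.
have cc2 : ccontinuous c2.
  by apply: ccontinuousM; [exact: ccontinuous_cexp|exact: ccontinuous_real].
pose g (x y : R) : C := cexp (w * x%:C) * (k1 y * k2 (x - y))%:C.
have gE2 y : (fun x : T => g x y) = (fun x : T => (cexp (w * y%:C) * (k1 y)%:C) * c2 (x - y)).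
  apply/funext => x; rewrite /g /c2 rmorphM mulrACA -cexpD; congr (cexp _ * _).
  by rewrite -mulrDr -rmorphD addrC subrK.
have gE1 x : g x = (fun y : T => cexp (w * x%:C) * (k1 y * k2 (x - y))%:C) by [].
have ck2s x : continuous (fun y => k2 (x - y)).
  move=> y; apply: continuous_comp; last exact: ck2.
  by apply: cvgB; [exact: cvg_cst|exact: cvg_id].
have ik12 x : mu.-integrable setT (fun y => (k1 y * k2 (x - y))%:E).
  apply: (le_integrable measurableT _ _ (integrableZl measurableT B ik1)).
    apply/measurable_EFinP; apply: measurable_funM.
      exact: (continuous_measurable ck1).
    exact: (continuous_measurable (ck2s x)).
  move=> y _; rewrite /= lee_fin (ger0_norm (mulr_ge0 (k10 _) (k20 _))).
  by rewrite mulrC (le_trans _ (ler_norm _))// ler_wpM2r.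
have i1 x : cintegrable setT (g x : T -> C).
  by rewrite gE1; apply: (cintegrableZ _ measurableT); exact: cintegrable_real.
have i2 y : cintegrable setT (fun x : T => g x y).
  rewrite gE2; apply: (cintegrableZ _ measurableT).
  exact: (cintegral_translate y cc2 j2).1.
have mg : cmeas setT (fun p : T * T => g p.1 p.2).
  rewrite /g; apply: cmeasM.
    have := ccontinuous_cmeas (ccontinuous_cexp w) => -[m1 m2].
    by split; [apply: (measurableT_comp m1)|apply: (measurableT_comp m2)].
  apply: cmeas_real; apply: measurable_funM.
    by apply: (measurableT_comp (continuous_measurable ck1)).
  apply: (measurableT_comp (continuous_measurable ck2)).
  by apply: measurable_funB.
have nE y : (\int[mu]_x (normc (g x y))%:E =
   (\int[mu]_x normc (c2 x))%:E * (normc (cexp (w * y%:C) * (k1 y)%:C))%:E)%E.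
  have := (cintegral_translate y cc2 j2).1 => jy.
  have nc : continuous (fun x => normc (c2 x)).
    have E x : normc (c2 x) = expR (Re w * x) * k2 x.
      rewrite /c2 Normc.normcM normc_cexp normc_real ger0_norm// ReM /=.
      by rewrite mulr0 subr0.
    move=> x; under eq_fun do rewrite E; apply: cvgM; last exact: ck2.
    exact: (is_derive_continuous (is_derive_expRM (Re w))).
  have -> : (\int[mu]_x (normc (g x y))%:E =
     \int[mu]_x ((normc (cexp (w * y%:C) * (k1 y)%:C))%:E * (normc (c2 (x - y)))%:E))%E.
    by apply: eq_integral => x _; rewrite (congr1 (fun h => h x) (gE2 y)) Normc.normcM.
  rewrite ge0_integralZl_EFin ?normc_ge0//; last 2 first.
  - by move=> x _; rewrite lee_fin normc_ge0.
  - by apply/measurable_EFinP; apply: cmeas_normc; exact: cintegrable_cmeas.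
  rewrite muleC; congr (_ * _)%E.
  rewrite /Rintegral fineK; last first.
    by apply: integrable_fin_num => //; exact: integrable_normc.
  rewrite (@integral_affine _ (fun x => normc (c2 (x - y))) 1 y ltr01).
    by apply: eq_integral => x _; rewrite mulr1 mul1r addrAC subrr add0r.
  move=> x; apply: (@continuous_comp _ _ _ (fun x : R => x - y)
    (fun x => normc (c2 x))); last exact: nc.
  by apply: cvgB; [exact: cvg_id|exact: cvg_cst].
have fin : (\int[mu]_x \int[mu]_y (normc (g x y))%:E < +oo)%E.
  (* Integrated first in [x], the modulus depends on [y] only through the integrand of [k1]. *)
  rewrite (@fubini_tonelli _ _ _ _ R mu mu (fun p : T * T => (normc (g p.1 p.2))%:E)).
  - under eq_integral do rewrite nE.
    rewrite ge0_integralZl_EFin ?Rintegral_ge0//.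
    + have lty := integrable_lty measurableT (integrable_normc measurableT j1).
      rewrite lte_mul_pinfty// lee_fin Rintegral_ge0// => x _.
      exact: normc_ge0.
    + by move=> x _; rewrite lee_fin normc_ge0.
    + by apply/measurable_EFinP; apply: cmeas_normc; exact: cintegrable_cmeas.
    + by move=> x _; exact: normc_ge0.
  - by apply/measurable_EFinP; exact: cmeas_normc.
  - by move=> p; rewrite lee_fin normc_ge0.
have [Ii E] := cFubini mg fin i1 i2.
clear fin mg nE.
have E1 : (fun x : T => cintegral setT (g x : T -> C)) =
    (fun x : T => cexp (w * x%:C) * (k x)%:C).
  apply/funext => x; rewrite gE1.
  rewrite (cintegralZ _ measurableT (cintegrable_real (ik12 x))).
  by rewrite (cintegral_real (fun y => k1 y * k2 (x - y)) measurableT) kE.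
have E2 : (fun y : T => cintegral setT (fun x : T => g x y)) =
    (fun y : T => M2 w * (cexp (w * y%:C) * (k1 y)%:C)).
  apply/funext => y; rewrite gE2.
  have [t1 t2] := cintegral_translate y cc2 j2.
  by rewrite (cintegralZ _ measurableT t1) t2 -e2 mulrC.
rewrite -E1; split; first exact: Ii.
rewrite [LHS]E E2 (cintegralZ _ measurableT j1) e1.
exact: mulrC.
Qed.

(** The Gamma factor is expanded as the Fourier integral of [eulerk b] and the order of integration
    exchanged, so the new factor needs no inversion of its own. *)
Lemma ft_conv (P : T -> C) (b x : R) : 0 < b -> cintegrable setT P ->
  ft (fun t => P t * ceulerG (b +i* t)) (- x) =
  cintegral setT (fun y : T => (eulerk b y)%:C * ft P (- (x - y))).
Proof.
move=> b0 iP.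
pose g (t y : R) : C := P t * cis (- x * t) * ((eulerk b y)%:C * cis (t * y)).
have irb := @cintegrable_eulerk R b b0.
have i1 t : cintegrable setT (g t : T -> C).
  apply: (cintegrableZ _ measurableT); exact: cintegrable_ft.
have gE y : (fun t : T => g t y) = (fun t : T => (eulerk b y)%:C * (P t * cis (- (x - y) * t))).
  apply/funext => t; rewrite /g opprB addrC mulrDl cisD (mulrC y t); ring.
have i2 y : cintegrable setT (fun t : T => g t y).
  rewrite gE; apply: (cintegrableZ _ measurableT); exact: cintegrable_ft.
have mP := cintegrable_cmeas iP.
have mg : cmeas setT (fun p : T * T => g p.1 p.2).
  rewrite /g; apply: cmeasM.
    apply: cmeasM.
      by case: mP => m1 m2; split; [apply: (measurableT_comp m1)|apply: (measurableT_comp m2)].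
    by apply: cmeas_cis; apply: measurable_funM => //; exact: measurable_cst.
  apply: cmeasM.
    apply: cmeas_real; apply: (measurableT_comp (measurable_eulerk b)).
    exact: measurable_snd2.
  by apply: cmeas_cis; apply: measurable_funM.
have fin : (\int[mu]_t \int[mu]_y (normc (g t y))%:E < +oo)%E.
  have inner t : (\int[mu]_y (normc (g t y))%:E = (eulerG b)%:E * (normc (P t))%:E)%E.
    rewrite -integral_eulerk// muleC -ge0_integralZl_EFin ?normc_ge0//.
    - apply: eq_integral => y _; rewrite /g !Normc.normcM !normc_cis !mulr1 normc_real.
      by rewrite (ger0_norm (eulerk_ge0 _ _)) EFinM.
    - by move=> y _; rewrite lee_fin eulerk_ge0.
    - by apply/measurable_EFinP; exact: measurable_eulerk.
  under eq_integral do rewrite inner.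
  rewrite ge0_integralZl_EFin ?eulerG_ge0//.
  - have lty := integrable_lty measurableT (integrable_normc measurableT iP).
    by rewrite lte_mul_pinfty// lee_fin eulerG_ge0.
  - by move=> t _; rewrite lee_fin normc_ge0.
  - by apply/measurable_EFinP; exact: cmeas_normc.
have [_ E] := cFubini mg fin i1 i2; clear fin mg.
transitivity (cintegral setT (fun t : T => cintegral setT (g t : T -> C))).
  congr (cintegral setT _); apply/funext => t; rewrite /g.
  rewrite (cintegralZ _ measurableT (cintegrable_ft t irb)) ceulerG_ft.
  by rewrite /ft; ring.
rewrite [LHS]E; congr (cintegral setT _); apply/funext => y; rewrite gE.
by rewrite (cintegralZ _ measurableT (cintegrable_ft _ iP)).
Qed.

End LaplacePairs.

(** * The inverse Mellin transform *)

Section InverseMellin.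
Context {R : realType}.
Local Notation C := R[i].
Local Notation mu := (@lebesgue_measure R).
Local Notation T := (measurableTypeR R).

Section kernels.
Variables (n : nat) (c : R).
Hypothesis c_gt0 : 0 < c.

Let b (j : nat) : R := c + j%:R / n%:R.

Let b_gt0 j : 0 < b j.
Proof. by rewrite ltr_wpDr// divr_ge0. Qed.

(** [m] is separate from [n], so that factors can be added one at a time while the shifts [j / n]
    stay fixed. *)
Definition Gamma_line_prod (m : nat) (t : R) : C :=
  \prod_(1 <= j < m) ceulerG (b j +i* t).

(* [hfun] in the variable [x = ln u], up to the factor [exp (c x)]. *)
Definition hker (m : nat) (x : R) : R :=
  (2 * pi)^-1 * Re (ft (Gamma_line_prod m) (- x)).

Let pi2_gt0 : 0 < 2 * pi :> R.
Proof. by rewrite mulr_gt0// pi_gt0. Qed.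

(** Induction on the number of factors: inversion gives the kernel of the first, convolution with
    [eulerk] adds each further one, and Gamma being bounded on vertical lines keeps the product
    integrable. The transforms share the half-plane of the smallest shift, [j = 1]. *)
Lemma hker_props (m : nat) : (2 <= m)%N ->
  [/\ cintegrable setT (Gamma_line_prod m : T -> C),
    forall x, ft (Gamma_line_prod m) (- x) = (2 * pi * hker m x)%:C &
    laplace_pair (hker m) (c + n%:R^-1)
      (fun w => \prod_(1 <= j < m) ceulerG (w + (b j)%:C))].
Proof.
have A0 : 0 < c + n%:R^-1 by rewrite ltr_wpDr// invr_ge0.
have bA j : (0 < j)%N -> c + n%:R^-1 <= b j.
  by move=> j0; rewrite lerD2l ler_peMl ?invr_ge0// ler1n.
case: m => [//|[//|m]] _; elim: m => [|m [IH1 IH2 IH3]].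
  have PE : Gamma_line_prod 2 = fun t => ceulerG (b 1 +i* t).
    by apply/funext => t; rewrite /Gamma_line_prod big_nat1.
  have FE x : ft (Gamma_line_prod 2) (- x) = (2 * pi * eulerk (b 1) x)%:C.
    by rewrite PE ft_inversion.
  have KE : hker 2 = eulerk (b 1).
    by apply/funext => x; rewrite /hker FE /= mulKf// gt_eqF.
  split.
  - by rewrite PE; exact: cintegrable_ceulerG_line.
  - by move=> x; rewrite FE KE.
  - rewrite KE (_ : (fun w => _) = (fun w => ceulerG ((b 1)%:C + w))); last first.
      by apply/funext => w; rewrite big_nat1 addrC.
    by apply: laplace_pair_le (laplace_pair_eulerk (b_gt0 1)); exact: bA.
set P := Gamma_line_prod m.+2 in IH1 IH2 *.
set M := (fun w : C => \prod_(1 <= j < m.+2) ceulerG (w + (b j)%:C)) in IH3.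
have PE : Gamma_line_prod m.+3 = fun t => P t * ceulerG (b m.+2 +i* t).
  by apply/funext => t; rewrite /P /Gamma_line_prod big_nat_recr.
have iP : cintegrable setT (Gamma_line_prod m.+3 : T -> C).
  rewrite PE.
  have ni := integrableZl measurableT (2 * eulerG (b m.+2)) (integrable_normc measurableT IH1).
  apply: (cintegrable_le measurableT _ ni).
    by apply: cmeasM; [exact: cintegrable_cmeas|exact: cmeas_ceulerG_line].
  move=> t _; rewrite Normc.normcM mulrC; apply: ler_wpM2r; first exact: normc_ge0.
  exact: (@normc_ceulerG R (b m.+2 +i* t) (b_gt0 _)).
have [k0 ck _] := IH3.
(* The Fourier transform of an integrable function is bounded, as the convolution lemma asks of its
   second kernel. *)
have bd z : hker m.+2 z <= (2 * pi)^-1 * (2 * \int[mu]_t normc (P t)).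
  rewrite /hker ler_wpM2l ?invr_ge0 ?(ltW pi2_gt0)//.
  rewrite (le_trans (ler_norm _))// (le_trans (Re_le_normc _))//.
  rewrite (le_trans (normc_cintegral measurableT (cintegrable_ft (- z) IH1)))//.
  rewrite le_eqVlt; apply/orP; left; apply/eqP; congr (2 * _).
  by apply: eq_Rintegral => t _; rewrite Normc.normcM normc_cis mulr1.
have FE x : ft (Gamma_line_prod m.+3) (- x) =
    (2 * pi * \int[mu]_y (eulerk (b m.+2) y * hker m.+2 (x - y)))%:C.
  rewrite PE (ft_conv x (b_gt0 _) IH1).
  have -> : (fun y : T => (eulerk (b m.+2) y)%:C * ft P (- (x - y))) =
     (fun y : T => (2 * pi)%:C * (eulerk (b m.+2) y * hker m.+2 (x - y))%:C).
    apply/funext => y; rewrite IH2 -!rmorphM; congr (_%:C); ring.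
  have ii : mu.-integrable setT (fun y => (eulerk (b m.+2) y * hker m.+2 (x - y))%:E).
    apply: (le_integrable measurableT _ _ (integrableZl measurableT
      ((2 * pi)^-1 * (2 * \int[mu]_t normc (P t))) (integrable_eulerk (b_gt0 m.+2)))).
      apply/measurable_EFinP; apply: measurable_funM; first exact: measurable_eulerk.
      apply: continuous_measurable => y.
      apply: (@continuous_comp _ _ _ (fun y : R => x - y) (hker m.+2)); last exact: ck.
      by apply: cvgB; [exact: cvg_cst|exact: cvg_id].
    move=> y _; rewrite /= lee_fin (ger0_norm (mulr_ge0 (eulerk_ge0 _ _) (k0 _))).
    rewrite mulrC (le_trans _ (ler_norm _))// ler_wpM2r ?eulerk_ge0//.
  rewrite (cintegralZ _ measurableT (cintegrable_real ii)).
  rewrite (cintegral_real (fun y => eulerk (b m.+2) y * hker m.+2 (x - y)) measurableT).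
  by rewrite -rmorphM.
have KE x : hker m.+3 x = \int[mu]_y (eulerk (b m.+2) y * hker m.+2 (x - y)).
  by rewrite /hker FE /= mulKf// gt_eqF.
have cK : continuous (hker m.+3).
  move=> x; apply: cvgM; first exact: cvg_cst.
  have [h _] := continuous_ft iP.
  by apply: (@continuous_comp _ _ _ (-%R : R -> R) (fun t => Re (ft (Gamma_line_prod m.+3) t)));
    [exact: opp_continuous|exact: h].
split => //.
- by move=> x; rewrite FE KE.
- rewrite (_ : (fun w => _) = (fun w => ceulerG ((b m.+2)%:C + w) * M w)); last first.
    by apply/funext => w; rewrite big_nat_recr//= mulrC addrC.
  apply: (laplace_pair_conv A0 _ IH3 bd cK KE).
  by apply: laplace_pair_le (laplace_pair_eulerk (b_gt0 _)); exact: bA.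
Qed.

(** At [u = exp x] the power [u ^ (- s)] on the line splits into [exp (- c x)] and a character, and
    the [i] of [ds] cancels that of [2 pi i]. *)
Lemma hfun_expR (x : R) : (2 <= n)%N ->
  hfun n c (expR x) = (expR (- c * x) * hker n x)%:C.
Proof.
move=> n2; have [iP FE _] := hker_props n2.
rewrite /hfun /vline_integral.
have -> : (fun t : R => \prod_(1 <= j < n) Gamma (c +i* t + j%:R / n%:R) *
     rpowc (expR x) (- (c +i* t))) =
  (fun t : R => (expR (- c * x))%:C * (Gamma_line_prod n t * cis (- x * t))).
  apply/funext => t; rewrite mulrCA; congr (_ * _).
    apply: eq_bigr => j _.
    have -> : c +i* t + j%:R / n%:R = b j +i* t.
      rewrite !natC -fmorphV -rmorphM; apply: eqC; rewrite ?ReD ?ImD/= ?addr0//.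
    by rewrite Gamma_ceulerG//; exact: b_gt0.
  rewrite rpowc_expR -cexp_real -cexpD; congr cexp.
  by apply: eqC; rewrite ?(ReD, ImD, ReM, ImM, ReN, ImN) /=; ring.
rewrite (cintegralZ _ measurableT (cintegrable_ft (- x) iP)).
rewrite -/(ft (Gamma_line_prod n) (- x)) FE.
have -> : (2 * pi * hker n x)%:C = 2 * pi%:C * (hker n x)%:C.
  by rewrite !(rmorphM (real_complex R)) /= rmorph_nat.
rewrite [RHS](rmorphM (real_complex R)) /=.
set E := (expR _)%:C; set K := (hker n x)%:C.
have i0 : (0 +i* 1 : C) != 0.
  by apply/eqP => /(congr1 (fun z => Im z)) /= /eqP; rewrite oner_eq0.
have p0 : (pi%:C : C) != 0.
  by rewrite -normc_eq0 normc_real normr_eq0 gt_eqF ?pi_gt0.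
move: (pi%:C) p0 (0 +i* 1 : C) i0 E K => p p0 i i0 E K.
by field; rewrite i0 p0.
Qed.

End kernels.

(** [g] is given only through its values at [exp x], because [hfun] and [rpowc] are meaningful only
    for positive arguments. *)
Lemma exp_substitution (g G : R -> C) : ccontinuous G ->
  (forall x, g (expR x) = G x) ->
  cintegrable setT (fun x : T => G x * (expR x)%:C) ->
  cintegrable `]0, +oo[ g /\
  cintegral `]0, +oo[ g = cintegral setT (fun x : T => G x * (expR x)%:C).
Proof.
move=> [G1 G2] gE [i1 i2].
have DE : `]0, +oo[%classic = \bigcup_(k : nat) `[expR (- k%:R), expR k%:R : R]%classic.
  apply/seteqP; split => x /=; rewrite in_itv/= andbT.
    move=> x0; exists (Num.bound `|ln x|) => //=; rewrite in_itv/=.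
    have := archi_boundP (normr_ge0 (ln x)) => /ltW; rewrite ler_norml.
    by move=> /andP[h1 h2]; rewrite -{2 3}[x]lnK ?posrE// !ler_expR h1 h2.
  move=> [k _ /=]; rewrite in_itv/= => /andP[h _].
  by rewrite (lt_le_trans _ h)// expR_gt0.
have tr (h : R -> R) : continuous h ->
    mu.-integrable setT (fun x => (h x * expR x)%:E) ->
    mu.-integrable `]0, +oo[ (fun u => (h (ln u))%:E) /\
    \int[mu]_(u in `]0, +oo[) h (ln u) = \int[mu]_x (h x * expR x).
  move=> ch ih.
  have cl (u : R) : `]0, +oo[%classic u -> {for u, continuous (fun u => h (ln u))}.
    rewrite /= in_itv/= andbT => u0.
    by apply: continuous_comp; [exact: continuous_ln|exact: ch].
  have dE : forall x : R, is_derive x 1 expR (expR x) by move=> x; exact: is_derive_expR.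
  have mE : {homo (@expR R) : x y / x < y} by move=> x y xy; rewrite ltr_expR.
  split.
    apply: (integrable_substitution mE dE (@continuous_expR R) (@expR_ge0 R) DE cl).
    by apply: eq_integrable ih => // x _; rewrite expRK.
  rewrite /Rintegral (integral_substitution mE dE (@continuous_expR R) (@expR_ge0 R) DE cl).
  by congr fine; apply: eq_integral => x _; rewrite expRK.
have gl (u : R) : u \in `]0, +oo[%classic -> g u = G (ln u).
  by move=> /set_mem; rewrite /= in_itv/= andbT => u0; rewrite -gE lnK.
have RE x : Re (G x * (expR x)%:C) = Re (G x) * expR x.
  by rewrite ReM /= mulr0 subr0.
have IE x : Im (G x * (expR x)%:C) = Im (G x) * expR x.
  by rewrite ImM /= mulr0 add0r.
have j1 : mu.-integrable setT (fun x => (Re (G x) * expR x)%:E).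
  by apply: eq_integrable i1 => // x _; rewrite RE.
have j2 : mu.-integrable setT (fun x => (Im (G x) * expR x)%:E).
  by apply: eq_integrable i2 => // x _; rewrite IE.
have [a1 b1] := tr _ G1 j1; have [a2 b2] := tr _ G2 j2.
split.
  split.
    by apply: eq_integrable a1 => // u ud; rewrite gl.
  by apply: eq_integrable a2 => // u ud; rewrite gl.
apply: eqC; rewrite /cintegral.
  transitivity (\int[mu]_(u in `]0, +oo[) Re (G (ln u))).
    by apply: eq_Rintegral => u ud; rewrite gl.
  by rewrite b1; apply: eq_Rintegral => x _; rewrite RE.
transitivity (\int[mu]_(u in `]0, +oo[) Im (G (ln u))).
  by apply: eq_Rintegral => u ud; rewrite gl.
by rewrite b2; apply: eq_Rintegral => x _; rewrite IE.
Qed.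

(** The Laplace pair is taken at [w = s - c]: the abscissa [- (c + 1/n)] becomes [- 1/n], and
    neither the domain nor the value depends on [c] any more. *)
Lemma mellin_hfun (n : nat) (c : R) (s : C) : (2 <= n)%N -> 0 < c ->
  - n%:R^-1 < Re s ->
  cintegrable `]0, +oo[ (fun u => hfun n c u * rpowc u (s - 1)) /\
  cintegral `]0, +oo[ (fun u => hfun n c u * rpowc u (s - 1)) =
    \prod_(1 <= j < n) ceulerG (s + j%:R / n%:R).
Proof.
move=> n2 c0 sn; have n0 : (0 < n)%N by rewrite (leq_trans _ n2).
have [_ _ [k0 ck H]] := hker_props n c0 n2.
have [|i e] := H (s - c%:C); first by rewrite ReD ReN /=; lra.
pose G (x : R) : C := (expR (- c * x) * hker n c n x)%:C * cexp ((s - 1) * x%:C).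
have E x : G x * (expR x)%:C = cexp ((s - c%:C) * x%:C) * (hker n c n x)%:C.
  rewrite /G (rmorphM (real_complex R)).
  have -> : (s - c%:C) * x%:C = (- c * x)%:C + (s - 1) * x%:C + x%:C.
    by apply: eqC; rewrite ?(ReD, ImD, ReM, ImM, ReN, ImN) /=; ring.
  by rewrite !cexpD !cexp_real; ring.
have cGc : ccontinuous G.
  apply: ccontinuousM; last exact: ccontinuous_cexp.
  apply: ccontinuous_real => x; apply: cvgM; last exact: ck.
  exact: (is_derive_continuous (is_derive_expRM (- c))).
have gE x : hfun n c (expR x) * rpowc (expR x) (s - 1) = G x.
  by rewrite (hfun_expR c0 _ n2) rpowc_expR /G [x%:C * _]mulrC.
have iG : cintegrable setT (fun x : T => G x * (expR x)%:C).
  by rewrite (funext E).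
have [h1 h2] := @exp_substitution (fun u => hfun n c u * rpowc u (s - 1)) G cGc gE iG.
split; first exact: h1.
rewrite h2 (funext E) e; apply: eq_bigr => j _; congr ceulerG.
rewrite (rmorphD (real_complex R)) (rmorphM (real_complex R)) /= fmorphV.
by rewrite !rmorph_nat; ring.
Qed.

Lemma hfun_real_ge0 (n : nat) (c u : R) : (2 <= n)%N -> 0 < c -> 0 < u ->
  exists2 r : R, 0 <= r & hfun n c u = r%:C.
Proof.
move=> n2 c0 u0; have [_ _ [k0 _ _]] := hker_props n c0 n2.
exists (expR (- c * ln u) * hker n c n (ln u)); first by rewrite mulr_ge0 ?expR_ge0.
by rewrite -(hfun_expR c0 _ n2) lnK.
Qed.

(** As [h_n] is nonnegative, the absolute integral at [s] is the Mellin integral at [Re s], so it is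
    known exactly. *)
Lemma mellin_hfun_norm (n : nat) (c : R) (s : C) : (2 <= n)%N -> 0 < c ->
  - n%:R^-1 < Re s ->
  \int[mu]_(u in `]0, +oo[) normc (hfun n c u * rpowc u (s - 1)) =
    \prod_(1 <= j < n) eulerG (Re s + j%:R / n%:R).
Proof.
move=> n2 c0 sn; have [_ e] := @mellin_hfun n c (Re s)%:C n2 c0 sn.
transitivity (Re (\prod_(1 <= j < n) ceulerG ((Re s)%:C + j%:R / n%:R) : C)).
  rewrite -e; apply: eq_Rintegral => u /set_mem uD.
  have u0 : 0 < u by move: uD; rewrite /= in_itv/= andbT.
  have [r r0 ->] := hfun_real_ge0 n2 c0 u0.
  rewrite Normc.normcM normc_real ger0_norm// normc_rpowc.
  have -> : (Re s)%:C - 1 = (Re s - 1)%:C :> C by rewrite rmorphB.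
  by rewrite rpowcr -rmorphM /= ReD ReN.
have -> : \prod_(1 <= j < n) ceulerG ((Re s)%:C + j%:R / n%:R) =
    (\prod_(1 <= j < n) eulerG (Re s + j%:R / n%:R))%:C :> C.
  rewrite (rmorph_prod (real_complex R)); apply: eq_bigr => j _.
  by rewrite /= -ceulerG_real !natC -fmorphV -rmorphM -rmorphD.
by [].
Qed.

End InverseMellin.

(** * Termwise integration *)

Section TermwiseIntegration.
Context {R : realType}.
Local Notation C := R[i].
Local Notation mu := (@lebesgue_measure R).
Local Notation T := (measurableTypeR R).

Lemma bounded_partial_sums (v : nat -> R) (B : R) (k0 : nat) :
  (forall k, 0 <= v k) -> 0 <= B ->
  (forall k, (k0 <= k)%N -> v k <= B * 2^-1 ^+ k) ->
  exists S, forall m, \sum_(0 <= k < m) v k <= S.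
Proof.
move=> v0 B0 vB; exists (\sum_(0 <= k < k0) v k + 2 * B) => m.
apply: (@le_trans _ _ (\sum_(0 <= k < k0 + m) v k)).
  rewrite (@big_cat_nat _ _ _ m 0 (k0 + m))//= ?leq_addl// lerDl.
  by apply: sumr_ge0.
(* The bound is sharpened by the factor [1 - 2^-m] so that the induction closes. *)
apply: (@le_trans _ _ (\sum_(0 <= k < k0) v k + 2 * B * (1 - 2^-1 ^+ m))).
  elim: m => [|m IH]; first by rewrite addn0 expr0 subrr mulr0 addr0.
  rewrite addnS big_nat_recr//= (le_trans (lerD IH (vB _ (leq_addr _ _))))//.
  rewrite -addrA lerD2l exprS.
  have : B * 2^-1 ^+ (k0 + m) <= B * 2^-1 ^+ m.
    rewrite ler_wpM2l// exprD ler_piMl ?exprn_ge0 ?exprn_ile1//.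
    by rewrite invf_le1// ler1n.
  lra.
rewrite lerD2l ler_piMr ?mulr_ge0// lerBlDr lerDl exprn_ge0//.
Qed.

Lemma ccvg_series (F : nat -> C) (S : R) :
  (forall m, \sum_(0 <= k < m) normc (F k) <= S) ->
  exists l, ccvg (fun m => \sum_(0 <= k < m) F k) l.
Proof.
move=> FS.
have H (u : nat -> R) : (forall k, `|u k| <= normc (F k)) ->
    exists l : R, (fun m => \sum_(0 <= k < m) u k) @ \oo --> l.
  move=> uF; have cu : cvgn (series u).
    apply: normed_cvg.
    have H : cvgn (fun m => \sum_(0 <= k < m) `|u k|).
      apply: nondecreasing_is_cvgn.
        by apply/nondecreasing_seqP => k; rewrite big_nat_recr//= lerDl.
      exists S => _ [m _ <-]; apply: le_trans (FS m).
      by apply: ler_sum.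
    exact: H.
  by exists (limn (series u)); exact: cu.
have [l1 h1] := H _ (fun k => Re_le_normc (F k)).
have [l2 h2] := H _ (fun k => Im_le_normc (F k)).
exists (l1 +i* l2); split => /=.
  by under eq_fun do rewrite Re_sum.
by under eq_fun do rewrite Im_sum.
Qed.

(** The sum [G] of the moduli dominates all partial sums, and its integral is at most [S]. The
    pointwise bounds make [G] finite everywhere on [D], so [fine (G u)] is a genuine real
    majorant. *)
Lemma cintegral_series (D : set T) (F : nat -> T -> C) (f : T -> C) (S : R) :
  measurable D -> (forall k, cintegrable D (F k)) ->
  (forall m, \sum_(0 <= k < m) \int[mu]_(u in D) normc (F k u) <= S) ->
  (forall u, D u -> exists Su, forall m, \sum_(0 <= k < m) normc (F k u) <= Su) ->
  (forall u, D u -> ccvg (fun m => \sum_(0 <= k < m) F k u) (f u)) ->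
  cintegrable D f /\
  ccvg (fun m => \sum_(0 <= k < m) cintegral D (F k)) (cintegral D f).
Proof.
move=> mD Fi FS Fu Ff.
pose G (u : T) : \bar R := (\sum_(k <oo) (normc (F k u))%:E)%E.
have mn k : measurable_fun D (fun u => (normc (F k u))%:E).
  by apply/measurable_EFinP; apply: cmeas_normc; exact: cintegrable_cmeas.
have G0 u : (0 <= G u)%E.
  by apply: nneseries_ge0 => k _ _; rewrite lee_fin normc_ge0.
have Gpart u m : ((\sum_(0 <= k < m) normc (F k u))%:E <= G u)%E.
  rewrite -sumEFin; apply: nneseries_lim_ge => k _ _.
  by rewrite lee_fin normc_ge0.
have Gfin u : D u -> G u \is a fin_num.
  move=> Du; have [Su H] := Fu u Du; rewrite ge0_fin_numE//.
  apply: (@le_lt_trans _ _ Su%:E); last exact: ltry.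
  apply: lime_le.
    by apply: is_cvg_nneseries => k _ _; rewrite lee_fin normc_ge0.
  by apply: nearW => m; rewrite sumEFin lee_fin.
have GI : (\int[mu]_(u in D) G u <= S%:E)%E.
  rewrite integral_nneseries//; last by move=> k u _; rewrite lee_fin normc_ge0.
  apply: lime_le.
    apply: is_cvg_nneseries => k _ _; apply: integral_ge0 => u _.
    by rewrite lee_fin normc_ge0.
  apply: nearW => m.
  apply: (@le_trans _ _ (\sum_(0 <= k < m) \int[mu]_(u in D) normc (F k u))%:E).
    rewrite -sumEFin; apply: lee_sum => k _; rewrite /Rintegral fineK//.
    by apply: integrable_fin_num => //; exact: integrable_normc.
  by rewrite lee_fin.
have mG : measurable_fun D G.
  apply: ge0_emeasurable_sum => // k u _ _; by rewrite lee_fin normc_ge0.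
have iG : mu.-integrable D (fun u => (fine (G u))%:E).
  apply: (@eq_integrable _ _ _ _ _ mD G).
    by move=> u /set_mem Du; rewrite fineK// Gfin.
  apply/integrableP; split => //.
  under eq_integral do rewrite gee0_abs//.
  by apply: le_lt_trans GI _; exact: ltry.
have [||||i c] := @cdominated R D (fun m u => \sum_(0 <= k < m) F k u) f
  (fun u => fine (G u)) mD.
- move=> m; apply: cmeas_sum => k; exact: cintegrable_cmeas.
- exact: Ff.
- exact: iG.
- move=> m u Du; apply: le_trans (normc_sum _ _) _.
  by rewrite -lee_fin fineK ?Gfin// Gpart.
split => //; apply: eq_ccvg c => m.
by have [_ ->] := cintegral_sum m mD Fi.
Qed.

(** The decay of [r] enters as a family of bounds indexed by [L], the form in which [eulerG_inv_le]
    provides it. *)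
Lemma superexp_bound (y M x0 al : R) : 0 <= y -> 0 < al ->
  exists2 B, 0 <= B & forall (k : nat) (r : R),
    (forall L, r <= expR (expR (L + 1) - (x0 + k%:R * al) * L)) ->
    y ^+ k * expR (M * (x0 + k%:R * al)) * r <= B * 2^-1 ^+ k.
Proof.
(* This [L] cancels the growth rate [M] and leaves the ratio [y exp (- 2 y)], which is at most
   1/2. *)
move=> y0 al0; pose L := M + 2 * y / al.
exists (expR (expR (L + 1) - 2 * y * x0 / al)); first exact: expR_ge0.
move=> k r /(_ L) rL.
apply: (@le_trans _ _ (y ^+ k * expR (M * (x0 + k%:R * al)) *
    expR (expR (L + 1) - (x0 + k%:R * al) * L))).
  by rewrite ler_wpM2l// mulr_ge0 ?exprn_ge0 ?expR_ge0.
have -> : y ^+ k * expR (M * (x0 + k%:R * al)) *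
    expR (expR (L + 1) - (x0 + k%:R * al) * L) =
    expR (expR (L + 1) - 2 * y * x0 / al) * (y * expR (- (2 * y))) ^+ k.
  rewrite exprMn -expRM_natl -mulrA -expRD mulrCA -expRD; congr (_ * expR _).
  by rewrite /L; field; rewrite gt_eqF.
rewrite ler_wpM2l ?expR_ge0// lerXn2r ?nnegrE ?mulr_ge0 ?expR_ge0 ?invr_ge0//.
rewrite expRN ler_pdivrMr ?expR_gt0// mulrC ler_pdivlMr// mulrC.
by have := expR_ge1Dx (2 * y); lra.
Qed.

Lemma eulerG_inv_le (x L : R) : 0 < x -> (eulerG x)^-1 <= expR (expR (L + 1) - x * L).
Proof.
move=> x0; rewrite -opprB expRN lef_pV2 ?posrE ?expR_gt0 ?eulerG_gt0//.
exact: eulerG_ge.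
Qed.

End TermwiseIntegration.

(** * Termwise integration of the Mittag-Leffler series *)

Section MittagLeffler.
Context {R : realType}.
Local Notation C := R[i].
Local Notation mu := (@lebesgue_measure R).
Local Notation T := (measurableTypeR R).

(** The multiplication formula on the real axis, solved for the product; the power of [n] has the
    positive exponent [n s - 1/2] and may be dropped. *)
Lemma eulerG_mult_le (n : nat) (s : R) : (0 < n)%N -> 1 <= s ->
  (eulerG (n%:R * s))^-1 * \prod_(1 <= j < n) eulerG (s + j%:R / n%:R) <=
  expR (ln (2 * pi) * (2^-1 * (n%:R - 1))) * (eulerG s)^-1.
Proof.
move=> n0 s1; have s0 : 0 < s by rewrite (lt_le_trans _ s1).
have nR : 0 < (n%:R : R) by rewrite ltr0n.
have n1 : 1 <= (n%:R : R) by rewrite ler1n.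
have ns0 : 0 < n%:R * s by rewrite mulr_gt0.
have sn : - n%:R^-1 < Re s%:C.
  by rewrite /= (lt_trans _ s0)// oppr_lt0 invr_gt0.
have := rGamma_mult_ceulerG n0 sn.
have v2 : (2^-1 : C) = (2^-1)%:C by rewrite fmorphV /= rmorph_nat.
have e1 : 2^-1 * (1 - n%:R) = (2^-1 * (1 - n%:R))%:C :> C.
  by rewrite v2 natC rmorphM rmorphB.
have e2 : n%:R * s%:C - 2^-1 = (n%:R * s - 2^-1)%:C :> C.
  by rewrite v2 natC rmorphB rmorphM.
have e3 : n%:R * s%:C = (n%:R * s)%:C :> C by rewrite natC rmorphM.
have e4 : \prod_(1 <= j < n) ceulerG (s%:C + j%:R / n%:R) =
    (\prod_(1 <= j < n) eulerG (s + j%:R / n%:R))%:C :> C.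
  rewrite (rmorph_prod (real_complex R)); apply: eq_bigr => j _.
  by rewrite /= -ceulerG_real !natC -fmorphV -rmorphM -rmorphD.
rewrite e2 e3 e1 e4 !rpowcr !rGamma_real// -!rmorphM => /complexI E.
set Q := (eulerG (n%:R * s))^-1 * _ in E *.
have Q0 : 0 <= Q.
  rewrite mulr_ge0 ?invr_ge0 ?eulerG_ge0// prodr_ge0// => j _; exact: eulerG_ge0.
rewrite E -[_ * _ * Q]mulrA [leRHS]mulrA -expRD -mulrDr.
have -> : 2^-1 * (n%:R - 1) + 2^-1 * (1 - n%:R) = 0 :> R by ring.
rewrite mulr0 expR0 mul1r ler_peMl// (le_trans _ (expR_ge1Dx _))// lerDl.
rewrite mulr_ge0 ?ln_ge0// subr_ge0.
have : 1 <= n%:R * s by rewrite -[leLHS]mulr1 ler_pM.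
lra.
Qed.

Lemma Rintegral_normcZ (D : set T) (w : C) (f : T -> C) : measurable D ->
  cintegrable D f ->
  \int[mu]_(u in D) normc (w * f u) = normc w * \int[mu]_(u in D) normc (f u).
Proof.
move=> mD fi; have ni := integrable_normc mD fi.
rewrite -RintegralZl//; apply: eq_Rintegral => u _; exact: Normc.normcM.
Qed.

Section termwise.
Variables (n d : nat) (c : R) (a z b : C).
Hypothesis n2 : (2 <= n)%N.
Hypothesis d1 : (d <= 1)%N.
Hypothesis c0 : 0 < c.
Hypothesis a0 : 0 < Re a.
Hypothesis bn : - n%:R^-1 < Re b.

Let n0 : (0 < n)%N. Proof. exact: leq_trans n2. Qed.
Let nR : 0 < (n%:R : R). Proof. by rewrite ltr0n. Qed.
Let n1 : 1 <= (n%:R : R). Proof. by rewrite ler1n. Qed.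

(** [s k] and [x k] are the real parts of [b + a k] and of the argument of [rho k]. The shift [d] is
    0 for the first formula and 1 for the companion, which is applied at [b - 1]. *)
Let s (k : nat) : R := Re b + k%:R * Re a.
Let x (k : nat) : R := n%:R * s k + d%:R.
Let rho (k : nat) : C := rGamma (n%:R * b + d%:R + n%:R * a * k%:R).

(** Slope of a sector containing the argument of [rho k] once [1 <= s k], because then
    [k <= (1 + |Re b|) / Re a * s k]. *)
Let M : R := `|Im b| + `|Im a| * (1 + `|Re b|) / Re a.

Let s_large : exists k0, forall k, (k0 <= k)%N -> 1 <= s k.
Proof.
exists (Num.bound ((1 + `|Re b|) / Re a)) => k kk.
have h0 : 0 <= (1 + `|Re b|) / Re a by rewrite divr_ge0 ?addr_ge0// ltW.
have h1 := archi_boundP h0.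
have h2 : (Num.bound ((1 + `|Re b|) / Re a))%:R <= k%:R :> R by rewrite ler_nat.
have h3 : (1 + `|Re b|) / Re a < k%:R by rewrite (lt_le_trans h1).
rewrite ltr_pdivrMr// in h3.
have := ler_norm (- Re b); rewrite normrN /s; lra.
Qed.

Let rho_le k : 1 <= s k -> normc (rho k) <= expR (2 * M ^+ 2 * x k) / eulerG (x k).
Proof.
move=> s1.
have E : n%:R * b + d%:R + n%:R * a * k%:R =
    x k +i* (n%:R * (Im b + k%:R * Im a)).
  by apply: eqC; rewrite ?(ReD, ImD, ReM, ImM, Re_nat, Im_nat) /x /s /=; ring.
rewrite /rho E; apply: normc_rGamma_le => /=.
  have : 1 <= n%:R * s k by rewrite -[leLHS]mulr1 ler_pM.
  have : 0 <= (d%:R : R) by [].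
  rewrite /x; lra.
have M0 : 0 <= M by rewrite addr_ge0// divr_ge0 ?mulr_ge0 ?addr_ge0// ltW.
apply: (@le_trans _ _ (n%:R * (M * s k))); last first.
  by rewrite /x [leRHS]mulrDr (mulrCA n%:R M) lerDl mulr_ge0.
rewrite normrM ger0_norm// ler_pM2l// (le_trans (ler_normD _ _))//.
rewrite /M mulrDl lerD//; first by rewrite ler_peMr.
have kle : k%:R <= (1 + `|Re b|) / Re a * s k.
  rewrite mulrAC ler_pdivlMr//.
  have -> : k%:R * Re a = s k - Re b by rewrite /s; ring.
  have := ler_norm (- Re b); rewrite normrN.
  have : 0 <= `|Re b| * (s k - 1) by rewrite mulr_ge0// subr_ge0.
  lra.
have := ler_wpM2l (normr_ge0 (Im a)) kle; rewrite normrM normr_nat mulrC.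
by rewrite !mulrA.
Qed.

Let ml_series_bounded (y : C) :
  exists S, forall m, \sum_(0 <= k < m) normc (y ^+ k * rho k) <= S.
Proof.
have [k0 hk] := s_large.
have na0 : 0 < n%:R * Re a by rewrite mulr_gt0.
have [B B0 HB] := @superexp_bound R (normc y) (2 * M ^+ 2) (n%:R * Re b + d%:R)
  (n%:R * Re a) (normc_ge0 y) na0.
apply: (@bounded_partial_sums R _ B k0) => // [k|k kk]; first exact: normc_ge0.
have s1 := hk k kk.
have xE : n%:R * Re b + d%:R + k%:R * (n%:R * Re a) = x k by rewrite /x /s; ring.
have x0 : 0 < x k by rewrite /x ltr_wpDr// mulr_gt0// (lt_le_trans _ s1).
rewrite Normc.normcM normcX.
apply: (@le_trans _ _ (normc y ^+ k * expR (2 * M ^+ 2 * x k) * (eulerG (x k))^-1)).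
  by rewrite -mulrA ler_wpM2l ?exprn_ge0 ?normc_ge0//; exact: rho_le.
rewrite -xE; apply: HB => L; rewrite xE; exact: eulerG_inv_le.
Qed.

Let W : C := rpowc n%:R (n%:R * a) * z.

(** The power [u ^ (a k)] is merged with [u ^ (b - 1)], so that each term is a constant times a
    Mellin integrand at [b + a k]. *)
Let term (k : nat) (u : R) : C :=
  W ^+ k * rho k * (hfun n c u * rpowc u (b + a * k%:R - 1)).

Let Re_bak k : Re (b + a * k%:R) = s k.
Proof. by rewrite ReD ReM Re_nat Im_nat mulr0 subr0 mulrC. Qed.

Let bak k : - n%:R^-1 < Re (b + a * k%:R).
Proof. by rewrite Re_bak ltr_wpDr// mulr_ge0// ltW. Qed.

Let term_integrable k : cintegrable `]0, +oo[ (term k).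
Proof. by apply: cintegrableZ => //; exact: (mellin_hfun n2 c0 (bak k)).1. Qed.

(** The absolute integrals are explicit. [eulerG_mult_le] trades the product over [eulerG (n s)] for
    [1 / eulerG (s k)], whose superexponential decay beats the powers of [W] and the sector loss;
    [K] collects what does not depend on [k]. *)
Let term_norm_bounded : exists S, forall m,
  \sum_(0 <= k < m) \int[mu]_(u in `]0, +oo[) normc (term k u) <= S.
Proof.
have [k0 hk] := s_large.
pose K := expR (2 * M ^+ 2 * d%:R) * expR (ln (2 * pi) * (2^-1 * (n%:R - 1))).
have [B B0 HB] := @superexp_bound R (normc W) (2 * M ^+ 2 * n%:R) (Re b)
  (Re a) (normc_ge0 W) a0.
apply: (@bounded_partial_sums R _ (K * B) k0) => [k||k kk].
- by apply: Rintegral_ge0 => u _; exact: normc_ge0.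
- by rewrite !mulr_ge0// expR_ge0.
have s1 := hk k kk; have s0 : 0 < s k by rewrite (lt_le_trans _ s1).
have ns0 : 0 < n%:R * s k by rewrite mulr_gt0.
have -> : \int[mu]_(u in `]0, +oo[) normc (term k u) =
    normc W ^+ k * normc (rho k) * \prod_(1 <= j < n) eulerG (s k + j%:R / n%:R).
  rewrite -Re_bak -(mellin_hfun_norm n2 c0 (bak k)).
  rewrite -normcX -Normc.normcM.
  exact: (Rintegral_normcZ _ (measurable_itv _) (mellin_hfun n2 c0 (bak k)).1).
have P0 : 0 <= \prod_(1 <= j < n) eulerG (s k + j%:R / n%:R).
  by rewrite prodr_ge0// => j _; exact: eulerG_ge0.
(* For [d = 1] the recurrence produces the extra factor [1 / (n s k)], at most 1. *)
have xle : (eulerG (x k))^-1 <= (eulerG (n%:R * s k))^-1.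
  have [d0|d0] : d = 0%N \/ d = 1%N.
    by move: d1; rewrite leq_eqVlt ltnS leqn0 => /orP[/eqP ?|/eqP ?]; [right|left].
    by rewrite /x d0 addr0.
  rewrite /x d0 eulerG_succ// invfM ler_piMl ?invr_ge0 ?eulerG_ge0//.
  by rewrite invf_le1// -[leLHS]mulr1 ler_pM.
apply: (@le_trans _ _ (normc W ^+ k * expR (2 * M ^+ 2 * x k) *
   ((eulerG (n%:R * s k))^-1 * \prod_(1 <= j < n) eulerG (s k + j%:R / n%:R)))).
  rewrite [leRHS]mulrA; apply: (ler_wpM2r P0).
  rewrite -[leRHS]mulrA; apply: ler_wpM2l.
    by rewrite exprn_ge0// normc_ge0.
  apply: (le_trans (rho_le s1)).
  exact: (ler_wpM2l (expR_ge0 _) xle).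
apply: (@le_trans _ _ (K * (normc W ^+ k * expR (2 * M ^+ 2 * n%:R * s k) * (eulerG (s k))^-1))).
  have -> : expR (2 * M ^+ 2 * x k) =
     expR (2 * M ^+ 2 * d%:R) * expR (2 * M ^+ 2 * n%:R * s k).
    by rewrite -expRD; congr expR; rewrite /x; ring.
  have -> : K * (normc W ^+ k * expR (2 * M ^+ 2 * n%:R * s k) * (eulerG (s k))^-1) =
     normc W ^+ k * (expR (2 * M ^+ 2 * d%:R) * expR (2 * M ^+ 2 * n%:R * s k)) *
     (expR (ln (2 * pi) * (2^-1 * (n%:R - 1))) * (eulerG (s k))^-1) by rewrite /K; ring.
  by apply: ler_wpM2l; [rewrite !mulr_ge0 ?exprn_ge0 ?normc_ge0 ?expR_ge0
    |exact: eulerG_mult_le].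
rewrite -[leRHS]mulrA; apply: ler_wpM2l; first by rewrite mulr_ge0 ?expR_ge0.
by apply: HB => L; exact: eulerG_inv_le.
Qed.

(** The integral is given as a limit of explicit partial sums. The multiplication formula identifies
    them, up to the constant prefactor, with those of [mittag_leffler], whose convergence therefore
    comes along. *)
Lemma mittag_leffler_termwise :
  let f := fun u : R => hfun n c u * rpowc u (b - 1) *
    mittag_leffler (n%:R * a) (n%:R * b + d%:R)
      (rpowc u a * rpowc n%:R (n%:R * a) * z) in
  cintegrable `]0, +oo[ f /\
  ccvg (fun m => \sum_(0 <= k < m) (rpowc n%:R (n%:R * a) * z) ^+ k *
    rGamma (n%:R * b + d%:R + n%:R * a * k%:R) *
    \prod_(1 <= j < n) ceulerG (b + a * k%:R + j%:R / n%:R)) (cintegral `]0, +oo[ f).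
Proof.
move=> f; have [S HS] := term_norm_bounded.
pose Y (u : R) : C := rpowc u a * rpowc n%:R (n%:R * a) * z.
have termE k u : term k u = hfun n c u * rpowc u (b - 1) * (Y u ^+ k * rho k).
  have -> : Y u ^+ k = rpowc u (k%:R * a) * W ^+ k.
    by rewrite /Y /W -mulrA exprMn -rpowcMn.
  rewrite /term.
  have -> : b + a * k%:R - 1 = (b - 1) + k%:R * a by ring.
  by rewrite rpowcD; ring.
have [||i cv] := @cintegral_series R `]0, +oo[ term f S (measurable_itv _)
  term_integrable HS.
- move=> u _; have [Su HSu] := ml_series_bounded (Y u).
  exists (normc (hfun n c u * rpowc u (b - 1)) * Su) => m.
  under eq_bigr do rewrite termE Normc.normcM.
  by rewrite -mulr_sumr ler_wpM2l ?normc_ge0.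
- move=> u _; have [Su HSu] := ml_series_bounded (Y u).
  have [l hl] := ccvg_series HSu.
  rewrite /f (_ : mittag_leffler _ _ _ = l); last exact: ccvg_climn hl.
  apply: eq_ccvg (ccvgM (ccvg_cst (hfun n c u * rpowc u (b - 1))) hl) => m.
  by rewrite mulr_sumr; apply: eq_bigr => k _; rewrite termE.
split; first exact: i.
apply: eq_ccvg cv => m; apply: eq_bigr => k _.
have [i1 e1] := mellin_hfun n2 c0 (bak k).
by rewrite /term cintegralZ// e1.
Qed.

End termwise.

End MittagLeffler.

(** The abscissa [- 1/n] is the first pole of the product of Gamma functions, and [1 - 1/n] is its
    translate for the companion, whose exponent of [u] is lower by one. The third formula is the
    second at [b = 1]. *)
Theorem mainTheorem9 (R : realType) (n : nat) (hn : (2 <= n)%N)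
    (c : R) (hc : 0 < c) (a z : R[i]) (ha : 0 < complex.Re a) :
  (forall b : R[i], - n%:R^-1 < complex.Re b ->
    let f := fun u : R =>
      hfun n c u * rpowc u (b - 1) *
      mittag_leffler (n%:R * a) (n%:R * b)
        (rpowc u a * rpowc n%:R (n%:R * a) * z) in
    cintegrable `]0, +oo[ f /\
    mittag_leffler a b z =
      rpowc (2 * pi) (2^-1 * (1 - n%:R)) * rpowc n%:R (n%:R * b - 2^-1) *
      cintegral `]0, +oo[ f) /\
  (forall b : R[i], 1 - n%:R^-1 < complex.Re b ->
    let f := fun u : R =>
      hfun n c u * rpowc u (b - 2) *
      mittag_leffler (n%:R * a) (n%:R * (b - 1) + 1)
        (rpowc u a * rpowc n%:R (n%:R * a) * z) in
    cintegrable `]0, +oo[ f /\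
    mittag_leffler a b z =
      rpowc (2 * pi) (2^-1 * (1 - n%:R)) *
      rpowc n%:R (n%:R * (b - 1) + 2^-1) *
      cintegral `]0, +oo[ f) /\
  (let f := fun u : R =>
      hfun n c u * rpowc u (-1) *
      mittag_leffler (n%:R * a) 1
        (rpowc u a * rpowc n%:R (n%:R * a) * z) in
    cintegrable `]0, +oo[ f /\
    mittag_leffler a 1 z =
      rpowc (2 * pi) (2^-1 * (1 - n%:R)) * rpowc n%:R 2^-1 *
      cintegral `]0, +oo[ f).
Proof.
have n0 : (0 < n)%N by apply: leq_trans hn.
(* The power of [n] at [b + a k] splits into the prefactor and the [k]-th power of [n ^ (n a)], the
   factor found inside the argument of the Mittag-Leffler function. *)
have pw (e : R[i]) k : rpowc n%:R (e + n%:R * (a * k%:R)) =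
    rpowc n%:R e * rpowc n%:R (n%:R * a) ^+ k :> R[i].
  by rewrite rpowcD -rpowcMn; congr (_ * rpowc _ _); ring.
have Rbk (b : R[i]) k : - n%:R^-1 < Re b -> - n%:R^-1 < Re (b + a * k%:R).
  by move=> hb; rewrite ReD ReM Re_nat Im_nat mulr0 subr0 ltr_wpDr// mulr_ge0// ltW.
have case2 (b : R[i]) : 1 - n%:R^-1 < Re b ->
    let f := fun u : R =>
      hfun n c u * rpowc u (b - 2) *
      mittag_leffler (n%:R * a) (n%:R * (b - 1) + 1)
        (rpowc u a * rpowc n%:R (n%:R * a) * z) in
    cintegrable `]0, +oo[ f /\
    mittag_leffler a b z =
      rpowc (2 * pi) (2^-1 * (1 - n%:R)) *
      rpowc n%:R (n%:R * (b - 1) + 2^-1) *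
      cintegral `]0, +oo[ f.
  move=> hb; have hb1 : - n%:R^-1 < Re (b - 1) by rewrite ReD ReN /=; lra.
  have [] := mittag_leffler_termwise z hn (leqnn 1) hc ha hb1.
  have -> : b - 1 - 1 = b - 2 by ring.
  move=> i cv f; split; first exact: i.
  apply: ccvg_climn.
  apply: eq_ccvg (ccvgM (ccvg_cst (rpowc (2 * pi) (2^-1 * (1 - n%:R)) *
    rpowc n%:R (n%:R * (b - 1) + 2^-1))) cv) => m.
  rewrite mulr_sumr; apply: eq_bigr => k _.
  have -> : b + a * k%:R = b - 1 + a * k%:R + 1 by ring.
  rewrite (rGamma_mult_ceulerG_succ n0 (Rbk _ k hb1)).
  have -> : n%:R * (b - 1 + a * k%:R) + 2^-1 =
    (n%:R * (b - 1) + 2^-1) + n%:R * (a * k%:R) by ring.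
  have -> : n%:R * (b - 1 + a * k%:R) + 1 = n%:R * (b - 1) + 1 + n%:R * a * k%:R by ring.
  by rewrite pw exprMn; ring.
split; [|split; first exact: case2].
- move=> b hb; have [] := mittag_leffler_termwise z hn (leq0n 1) hc ha hb.
  rewrite addr0 => i cv f; split; first exact: i.
  apply: ccvg_climn.
  apply: eq_ccvg (ccvgM (ccvg_cst (rpowc (2 * pi) (2^-1 * (1 - n%:R)) *
    rpowc n%:R (n%:R * b - 2^-1))) cv) => m.
  rewrite mulr_sumr; apply: eq_bigr => k _.
  rewrite (rGamma_mult_ceulerG n0 (Rbk _ k hb)).
  have -> : n%:R * (b + a * k%:R) - 2^-1 =
    (n%:R * b - 2^-1) + n%:R * (a * k%:R) by ring.
  have -> : n%:R * (b + a * k%:R) = n%:R * b + n%:R * a * k%:R by ring.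
  by rewrite pw exprMn; ring.
- have h1 : 1 - n%:R^-1 < Re (1 : R[i]).
    by rewrite /= ltrBlDr ltrDl invr_gt0 ltr0n.
  have := case2 1 h1.
  by rewrite subrr mulr0 !add0r (_ : 1 - 2 = -1 :> R[i])//; ring.
Qed.
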